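(* Let $\Omega=\mathbb{R}$ and let the sets $O_n$ ($n\ge1$) be given by $O_n=]-\infty,-n[\,\cup\,]n,+\infty[$ for all $n$, or $O_n=]-\infty,-n[$ for all $n$, or $O_n=]n,+\infty[$ for all $n$. Let $\rho(z)=\frac1\pi\cdot\frac{1}{1+z^2}$ (so $\int_{\mathbb{R}}\rho(x)\,dx=1$) and $\rho_\zeta(z)=\frac1\zeta\rho(\frac z\zeta)$. Then the map $j:f\mapsto F$ defined by $$F(z,\zeta)=(f*\rho_\zeta)(z)$$ maps the vector space $\mathcal{E}'(\mathbb{R})$ of all distributions with compact support on $\mathbb{R}$ into an algebra $\mathcal{A}(\mathbb{R})$ (that is, into some topological algebra of the class described in the context). The map $j$ is injective and continuous from $\mathcal{E}'(\mathbb{R})$ into $\mathcal{A}(\mathbb{R})$.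
   Context: Notation: $z=x+iy\in\mathbb{C}$, $x,y\in\mathbb{R}$; $\zeta\in\mathbb{C}\setminus\{0\}$; $\arg$ is the principal argument. For $f\in\mathcal{E}'(\mathbb{R})$, $(f*\rho_\zeta)(z)=\langle f_\lambda,\rho_\zeta(z-\lambda)\rangle$, considered for $(z,\zeta)\in V_n$ with $n$ large enough depending on $f$. $\mathcal{E}'(\mathbb{R})$ carries its usual topology of strong dual of $\mathcal{C}^\infty(\mathbb{R})$. For the chosen sequence $(O_n)$ set $$A_n=\{(z,\zeta)\in\mathbb{C}^2: x\notin O_{n+1},\ |\arg\zeta|<\tfrac1n,\ 0<|\zeta|<\tfrac1n,\ |y|<\tfrac1n|\zeta|\},$$ $$B_n=\{(z,\zeta)\in\mathbb{C}^2: x\in O_n,\ 0<|\zeta|<\tfrac1n,\ |y|<\tfrac1n\},\qquad V_n=A_n\cup B_n.$$ The $V_n$ are connected open sets, decreasing in $n$. For a continuous $\phi:\mathbb{R}\to(0,\infty)$, $H_{n,\phi}$ is the Banach space of holomorphic $f:V_n\to\mathbb{C}$ for which there is a constant $c>0$ with $|f(z,\zeta)|\le c\,\phi(x)/|\zeta|^n$ on $V_n$, with norm $\|f\|_{n,\phi}=\sup_{(z,\zeta)\in V_n}|\zeta|^n|f(z,\zeta)|/\phi(x)$. If $n'\ge n$ and $\psi\ge\phi$, then $H_{n,\phi}\subset H_{n',\psi}$ via $f\mapsto f|_{V_{n'}}$ (injective), and $\mathcal{G}_a(\mathbb{R})$ is the union (algebraic inductive limit) of all $H_{n,\phi}$,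 an algebra under pointwise product. An algebra $\mathcal{A}(\mathbb{R})$ is any subalgebra of $\mathcal{G}_a(\mathbb{R})$ of the form $\bigcup_pH_{n_p,\phi_p}$, with the locally convex inductive limit topology, where $(H_{n_p,\phi_p})_p$ is an increasing sequence such that for all $p$: (i) $H_{n_p,\phi_p}\cdot H_{n_p,\phi_p}\subset H_{n_{p+1},\phi_{p+1}}$ continuously; (ii) $\frac{d}{dx}H_{n_p,\phi_p}\subset H_{n_{p+1},\phi_{p+1}}$ continuously; (iii) the inclusion $H_{n_p,\phi_p}\to H_{n_{p+1},\phi_{p+1}}$ is a compact operator. The sequence may be chosen, so the assertion is that $j$ has the stated properties for some such $\mathcal{A}(\mathbb{R})$. *)

(* Defs.v *)
From HB Require Import structures.
From mathcomp Require Import all_boot all_order all_algebra.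
From mathcomp Require Import all_classical all_reals all_analysis.
From mathcomp Require Import complex.

Set Implicit Arguments.
Unset Strict Implicit.
Unset Printing Implicit Defensive.

Import Order.TTheory GRing.Theory Num.Theory.
Import numFieldNormedType.Exports.

Local Open Scope classical_set_scope.
Local Open Scope ring_scope.
Local Open Scope complex_scope.
Local Open Scope quotient_scope.

HB.instance Definition _ (R : realType) := NormedModule.copy R[i] R[i]^o.

Local Notation Re := (@complex.Re _).
Local Notation Im := (@complex.Im _).
(* Modulus with values in [R]; the library's [`|z|] lives in [R[i]]. *)
Notation modc := ComplexField.Normc.normc.

Lemma modc_ge0 {R : rcfType} (z : R[i]) : 0 <= modc z.
Proof. by case: z => ? ?; exact: sqrtr_ge0. Qed.

Section Arg.
Context {R : realType}.
Implicit Types z : R[i].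

(* Principal argument, with values in ]-pi, pi] (see [arg_polar]). *)
Definition arg z : R :=
  if 0 <= Im z then acos (Re z / modc z) else - acos (Re z / modc z).

Lemma arg_polar z : z != 0 ->
  [/\ Re z = modc z * cos (arg z), Im z = modc z * sin (arg z)
    & - pi < arg z <= pi].
Proof.
case: z => x y z0.
have n2 : modc (x +i* y) ^+ 2 = x ^+ 2 + y ^+ 2.
  by rewrite /= sqr_sqrtr// addr_ge0// sqr_ge0.
have n0 : 0 < modc (x +i* y).
  rewrite lt_neqAle sqrtr_ge0 andbT eq_sym; apply/eqP => /ComplexField.Normc.eq0_normc.
  by move/eqP; rewrite (negbTE z0).
set r := modc _ in n2 n0 *.
have xr : x ^+ 2 <= r ^+ 2 by rewrite n2 lerDl sqr_ge0.
have hx : -1 <= x / r <= 1.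
  rewrite ler_pdivlMr// ler_pdivrMr// mulN1r mul1r -ler_norml.
  by rewrite -(@ler_pXn2r _ 2)// ?nnegrE ?(ltW n0)// real_normK ?num_real.
have yE : r * Num.sqrt (1 - (x / r) ^+ 2) = `|y|.
  rewrite -[X in X * _](gtr0_norm n0) -(sqrtr_sqr r) -sqrtrM ?sqr_ge0//.
  rewrite -(sqrtr_sqr y); congr Num.sqrt; rewrite mulrBr mulr1 -exprMn mulrCA divff ?gt_eqF// mulr1.
  by rewrite n2 addrC addKr.
have xE : x = r * (x / r) by rewrite mulrCA divff ?gt_eqF// mulr1.
have a0 := acos_ge0 hx; have api := acos_lepi hx.
rewrite /arg /= -/r; case: ifPn => y0.
  split; rewrite ?acosK ?in_itv//= ?sin_acos// ?yE ?ger0_norm//.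
  by rewrite api andbT (lt_le_trans _ a0)// oppr_lt0 pi_gt0.
rewrite -ltNge in y0.
split; rewrite ?cosN ?sinN ?acosK ?in_itv//= ?sin_acos// ?mulrN ?yE.
  by rewrite ltr0_norm// opprK.
rewrite ltrN2 (le_trans _ (pi_ge0 R)) ?oppr_le0// andbT.
apply: acos_ltpi; case/andP: hx => h1 ->; rewrite andbT lt_neqAle h1 andbT.
apply/eqP => h; move: yE; rewrite -h sqrrN expr1n subrr sqrtr0 mulr0.
by move/esym/eqP; rewrite normr_eq0 => /eqP y00; rewrite y00 ltxx in y0.
Qed.

End Arg.

Section Domains.
Context {R : realType}.

Inductive ends := both_ends | left_end | right_end.

Definition Oset (e : ends) (n : nat) : set R :=
  match e with
  | both_ends => [set x | x < - n%:R] `|` [set x | n%:R < x]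
  | left_end => [set x | x < - n%:R]
  | right_end => [set x | n%:R < x]
  end.

(* A point [p : R[i] * R[i]] stands for the pair [(z, zeta)]. *)
Definition Aset (e : ends) (n : nat) : set (R[i] * R[i]) :=
  [set p | [/\ ~ Oset e n.+1 (Re p.1), `|arg p.2| < n%:R^-1,
               0 < modc p.2 < n%:R^-1 & `|Im p.1| < n%:R^-1 * modc p.2]].

Definition Bset (e : ends) (n : nat) : set (R[i] * R[i]) :=
  [set p | [/\ Oset e n (Re p.1), 0 < modc p.2 < n%:R^-1
             & `|Im p.1| < n%:R^-1]].

Definition Vset (e : ends) (n : nat) : set (R[i] * R[i]) :=
  Aset e n `|` Bset e n.

Lemma Oset_decr e n : Oset e n.+1 `<=` Oset e n.
Proof.
have h : n%:R < n.+1%:R :> R by rewrite ltr_nat.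
have h' : - n.+1%:R < - n%:R :> R by rewrite ltrN2.
case: e => x /=; last exact: lt_trans.
  by case=> xn; [left; exact: lt_trans h'|right; exact: lt_trans xn].
by move=> xn; exact: lt_trans h'.
Qed.

Lemma Vset_decrS e n : (0 < n)%N -> Vset e n.+1 `<=` Vset e n.
Proof.
move=> n0.
have nS : n.+1%:R^-1 < n%:R^-1 :> R.
  by rewrite ltf_pV2 ?ltr_nat// posrE ltr0n.
have n1 : n%:R^-1 <= 1 :> R by rewrite invf_le1 ?ltr0n ?ler1n.
move=> p [|] [].
  move=> Ox ax /andP[z0 zn] yz.
  have zn' : 0 < modc p.2 < n%:R^-1 by rewrite z0 (lt_trans zn nS).
  have [hO|hO] := pselect (Oset e n.+1 (Re p.1)).
    right; split => //; first exact: Oset_decr.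
    apply: (le_lt_trans _ (lt_trans zn nS)); apply: (le_trans (ltW yz)).
      by rewrite -[leRHS]mul1r ler_pM2r// (ltW (lt_le_trans nS n1)).
  left; split => //; first exact: lt_trans nS.
  by apply: (lt_trans yz); rewrite ltr_pM2r.
move=> Ox /andP[z0 zn] yz; right; split; first exact: Oset_decr.
  by rewrite z0 (lt_trans zn nS).
exact: lt_trans nS.
Qed.

Lemma Vset_decr e m n : (0 < n)%N -> (n <= m)%N -> Vset e m `<=` Vset e n.
Proof.
move=> n0 /subnK <-; elim: (m - n)%N => // k IH.
rewrite addSn; apply: subset_trans IH; apply: Vset_decrS.
by rewrite addn_gt0 n0 orbT.
Qed.

Lemma Vset_neq0 e n : (0 < n)%N -> Vset e n !=set0.
Proof.
move=> n0; pose t : R := n%:R^-1 / 2.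
have i0 : 0 < n%:R^-1 :> R by rewrite invr_gt0 ltr0n.
have t0 : 0 < t by rewrite divr_gt0.
have mt : modc t%:C = t by rewrite /= expr0n /= addr0 sqrtr_sqr gtr0_norm.
exists (0, t%:C); left; split.
- have h1 : (n.+1%:R < 0 :> R) = false by rewrite ltrn0.
  have h2 : (0 < - n.+1%:R :> R) = false by rewrite oppr_gt0 h1.
  by case: e => /=; [case| |]; rewrite ?h1 ?h2.
- have at0 : arg t%:C = 0 by rewrite /arg mt /= lexx divff ?gt_eqF// acos1.
  by rewrite at0 normr0.
- by rewrite -[modc _]/(modc t%:C) mt t0 /t ltr_pdivrMr// ltr_pMr// ltr1n.
- by rewrite -[modc _]/(modc t%:C) mt /= normr0 mulr_gt0.
Qed.

End Domains.

Section WeightedHolomorphic.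
Context {R : realType}.

Record weight := Weight {
  weight_fun :> R -> R;
  weight_continuous : continuous weight_fun;
  weight_gt0 : forall x, 0 < weight_fun x
}.

(* A function on [Vset e n] is represented by its extension by zero; holomorphy
   is complex Frechet differentiability in both variables. *)
Definition Hpred (e : ends) (n : nat) (phi : weight)
    : {pred R[i] * R[i] -> R[i]} :=
  fun f => `[< [/\ forall p, Vset e n p -> differentiable f p,
    (exists2 c : R, 0 < c & forall p, Vset e n p ->
      modc (f p) <= c * phi (Re p.1) / modc p.2 ^+ n)
    & forall p, ~ Vset e n p -> f p = 0] >].

Record Hspace (e : ends) (n : nat) (phi : weight) := HspaceOf {
  Hfun :> R[i] * R[i] -> R[i];
  _ : Hfun \in Hpred e n phi
}.

End WeightedHolomorphic.

Arguments weight R : clear implicits.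

Section HspaceStructure.
Context {R : realType} (e : ends) (n : nat) (phi : weight R).

HB.instance Definition _ := [isSub for @Hfun R e n phi].
HB.instance Definition _ := [Choice of Hspace e n phi by <:].

Lemma modcN0 (p : R[i] * R[i]) : Vset e n p -> 0 < modc p.2.
Proof. by case=> -[] // => [_ _|_] /andP[]. Qed.

Lemma Hpred_submod : submod_closed (@Hpred R e n phi).
Proof.
split.
  apply/asboolP; split=> [p _||p _ //]; first exact: differentiable_cst.
  exists 1 => // p Vp; rewrite ComplexField.Normc.normc0 mul1r divr_ge0//.
    exact/ltW/weight_gt0.
  exact/exprn_ge0/ltW/modcN0.
move=> a f g /asboolP[df [c c0 fc] f0] /asboolP[dg [d d0 gd] g0].
apply/asboolP; split=> [p Vp||p Vp].
- apply: differentiableD; last exact: dg.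
  by apply: differentiableZ; exact: df.
- exists (modc a * c + d).
    by rewrite ltr_wpDl// mulr_ge0 ?modc_ge0// ltW.
  move=> p Vp; apply: (le_trans (le_normcD _ _)).
  rewrite ComplexField.Normc.normcM mulrDl mulrDl lerD ?gd// -!mulrA.
  by rewrite ler_wpM2l ?modc_ge0// mulrA fc.
- by rewrite -[LHS]/(a * f p + g p) f0// g0// mulr0 addr0.
Qed.

HB.instance Definition _ :=
  GRing.isSubmodClosed.Build _ _ (@Hpred R e n phi) Hpred_submod.
HB.instance Definition _ := [SubChoice_isSubLmodule of Hspace e n phi by <:].

Definition Hnorm (f : Hspace e n phi) : R :=
  sup [set modc p.2 ^+ n * modc (f p) / phi (Re p.1) | p in Vset e n].

End HspaceStructure.
Section HspaceNorm.
Context {R : realType} (e : ends) (n : nat) (phi : weight R).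
Implicit Types f g : Hspace e n phi.

Lemma Hnorm_ge f p : Vset e n p ->
  modc p.2 ^+ n * modc (f p) / phi (Re p.1) <= Hnorm f.
Proof.
move=> Vp; apply: ub_le_sup; last by exists p.
case: f => f /= /asboolP[_ [c c0 fc] _].
exists c => _ [q Vq <-].
rewrite ler_pdivrMr ?weight_gt0// mulrC -ler_pdivlMr ?fc//.
exact/exprn_gt0/(modcN0 Vq).
Qed.

Lemma Hnorm_le f c : 0 <= c ->
  (forall p, Vset e n p -> modc p.2 ^+ n * modc (f p) / phi (Re p.1) <= c) ->
  Hnorm f <= c.
Proof.
move=> c0 fc; have [V0|/set0P[q Vq]] := eqVneq (Vset e n : set (R[i] * R[i])) set0.
  by rewrite /Hnorm V0 image_set0 sup0.
apply: ge_sup; first by exists (modc q.2 ^+ n * modc (f q) / phi (Re q.1)); exists q.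
by move=> _ [p Vp <-]; exact: fc.
Qed.

Lemma Hnorm_ge0 f : 0 <= Hnorm f.
Proof.
have [V0|/set0P[q Vq]] := eqVneq (Vset e n : set (R[i] * R[i])) set0.
  by rewrite /Hnorm V0 image_set0 sup0.
apply: le_trans (Hnorm_ge f Vq).
by rewrite !mulr_ge0 ?exprn_ge0 ?modc_ge0// invr_ge0 ltW// weight_gt0.
Qed.

Lemma Hnorm_triangle f g : Hnorm (f + g) <= Hnorm f + Hnorm g.
Proof.
apply: Hnorm_le; first by rewrite addr_ge0// Hnorm_ge0.
move=> p Vp; apply: le_trans (lerD (Hnorm_ge f Vp) (Hnorm_ge g Vp)).
rewrite -mulrDl -mulrDr ler_wpM2r ?invr_ge0 ?(ltW (weight_gt0 _ _))//.
by rewrite ler_wpM2l ?exprn_ge0 ?modc_ge0// le_normcD.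
Qed.

Let HnormZ_le (a : R[i]) f : Hnorm (a *: f) <= modc a * Hnorm f.
Proof.
apply: Hnorm_le; first by rewrite mulr_ge0 ?modc_ge0 ?Hnorm_ge0.
move=> p Vp; rewrite [modc ((a *: f) p)]ComplexField.Normc.normcM.
rewrite mulrCA -!mulrA ler_wpM2l ?modc_ge0// !mulrA.
exact: Hnorm_ge.
Qed.

Lemma HnormZ (a : R[i]) f : Hnorm (a *: f) = modc a * Hnorm f.
Proof.
apply/eqP; rewrite eq_le HnormZ_le /=.
have [->|a0] := eqVneq a 0.
  by rewrite ComplexField.Normc.normc0 mul0r Hnorm_ge0.
have ma0 : 0 < modc a.
  rewrite lt_neqAle modc_ge0 andbT eq_sym; apply/eqP.
  by move/ComplexField.Normc.eq0_normc/eqP; rewrite (negbTE a0).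
rewrite -ler_pdivlMl// -ComplexField.Normc.normcV.
rewrite -[in leLHS](scalerK a0 f); exact: HnormZ_le.
Qed.

Lemma Hnorm_eq0 f : Hnorm f = 0 -> f = 0.
Proof.
move=> f0; apply/val_inj/funext => p /=.
have [Vp|Vp] := pselect (Vset e n p); last first.
  by case: f {f0} => f /= /asboolP[_ _]; exact.
have := Hnorm_ge f Vp; rewrite f0 ler_pdivrMr ?weight_gt0// mul0r.
rewrite pmulr_rle0 ?exprn_gt0 ?(modcN0 Vp)// => h.
apply: ComplexField.Normc.eq0_normc; apply/eqP.
by rewrite eq_le h modc_ge0.
Qed.

(* The library requires the norm of a normed space over [R[i]] to take its
   (nonnegative real) values in [R[i]]. *)
Definition HnormC f : R[i] := (Hnorm f)%:C.

Let HnormC_triangle f g : HnormC (f + g) <= HnormC f + HnormC g.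
Proof. by rewrite /HnormC -rmorphD lecR Hnorm_triangle. Qed.

Let HnormCZ (a : R[i]) f : HnormC (a *: f) = `|a| * HnormC f.
Proof. by rewrite /HnormC HnormZ rmorphM; case: a. Qed.

Let HnormC_eq0 f : HnormC f = 0 -> f = 0.
Proof. by move=> [] /Hnorm_eq0. Qed.

HB.instance Definition _ :=
  Lmodule_isNormed.Build R[i] (Hspace e n phi) HnormC_triangle HnormCZ HnormC_eq0.

End HspaceNorm.
Section Smooth.
Context {R : realType}.
Implicit Types g : R -> R[i].

(* Real derivatives of complex-valued functions, taken componentwise. *)
Definition cderive (k : nat) g : R -> R[i] :=
  fun x => derive1n k (Re \o g) x +i* derive1n k (Im \o g) x.

Definition smooth : {pred R -> R[i]} :=
  fun g => `[< forall k x,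
    derivable (derive1n k (Re \o g)) x 1 /\ derivable (derive1n k (Im \o g)) x 1 >].

Record Cinfty := CinftyOf { Cinfty_fun :> R -> R[i]; _ : Cinfty_fun \in smooth }.

HB.instance Definition _ := [isSub for Cinfty_fun].
HB.instance Definition _ := [Choice of Cinfty by <:].

Let derivable_iter_lin (u v : R -> R) (a b : R) :
  (forall k x, derivable (derive1n k u) x 1) -> (forall k x, derivable (derive1n k v) x 1) ->
  forall k, (derive1n k (fun x => a * u x + b * v x)) =
            (fun x => a * (derive1n k u) x + b * (derive1n k v) x).
Proof.
move=> du dv; elim=> // k IH; rewrite derive1nS IH; apply/funext => x.
have da : derivable (fun y => a * (derive1n k u) y) x 1 by exact: derivableZ.
have db : derivable (fun y => b * (derive1n k v) y) x 1 by exact: derivableZ.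
rewrite derive1E (deriveD da db) (deriveZ a (du k x)) (deriveZ b (dv k x)).
by rewrite !derive1nS !derive1E.
Qed.

Let derivable_lin (u v : R -> R) (a b : R) :
  (forall k x, derivable (derive1n k u) x 1) -> (forall k x, derivable (derive1n k v) x 1) ->
  forall k x, derivable (derive1n k (fun x => a * u x + b * v x)) x 1.
Proof.
move=> du dv k x; rewrite derivable_iter_lin//.
by apply: derivableD; apply: derivableZ.
Qed.

Lemma smooth_submod : submod_closed smooth.
Proof.
have d0 k : derive1n k (fun=> 0 : R) = fun=> 0.
  by elim: k => // k IH; rewrite derive1nS IH; apply/funext => x; rewrite derive1_cst.
split.
  apply/asboolP => k x; rewrite (_ : Re \o 0 = fun=> 0)//.
  by rewrite (_ : Im \o 0 = fun=> 0)// d0; split; exact: derivable_cst.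
move=> [a b] f g /asboolP df /asboolP dg.
have f1 k x : derivable (derive1n k (Re \o f)) x 1 by have [] := df k x.
have f2 k x : derivable (derive1n k (Im \o f)) x 1 by have [] := df k x.
have g1 k x : derivable (derive1n k (Re \o g)) x 1 by have [] := dg k x.
have g2 k x : derivable (derive1n k (Im \o g)) x 1 by have [] := dg k x.
apply/asboolP => k x; split.
  rewrite (_ : Re \o _ = fun x =>
      1 * (a * (Re \o f) x + (- b) * (Im \o f) x) + 1 * (Re \o g) x); last first.
    apply/funext => y /=; rewrite -[(_ + _) y]/((a +i* b) * f y + g y).
    by case: (f y) (g y) => [? ?] [? ?] /=; rewrite !mul1r mulNr.
  by apply: derivable_lin => //; exact: derivable_lin.
rewrite (_ : Im \o _ = fun x =>
    1 * (a * (Im \o f) x + b * (Re \o f) x) + 1 * (Im \o g) x); last first.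
  apply/funext => y /=; rewrite -[(_ + _) y]/((a +i* b) * f y + g y).
  by case: (f y) (g y) => [? ?] [? ?] /=; rewrite !mul1r.
by apply: derivable_lin => //; exact: derivable_lin.
Qed.

HB.instance Definition _ := GRing.isSubmodClosed.Build _ _ smooth smooth_submod.
HB.instance Definition _ := [SubChoice_isSubLmodule of Cinfty by <:].

Definition jet (t : Cinfty) : {ptws nat -> {family compact, R -> R[i]}} :=
  fun k => cderive k t.

(* Uniform convergence on compact sets of all the derivatives. *)
HB.instance Definition _ := Topological.copy Cinfty (initial_topology jet).

End Smooth.

Arguments Cinfty R : clear implicits.

Section CompactlySupportedDistributions.
Context {R : realType}.

Definition vN_bounded (K : numDomainType) (E : preTopologicalLmodType K)
    (B : set E) :=
  forall U : set E, nbhs 0 U -> exists2 r : K, 0 < r &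
    forall c : K, r <= `|c| -> B `<=` [set c *: u | u in U].

Definition dual_pred : {pred Cinfty R -> R[i]} :=
  fun f => `[< linear f /\ continuous f >].

Record dual := DualOf { dual_fun :> Cinfty R -> R[i]; _ : dual_fun \in dual_pred }.

HB.instance Definition _ := [isSub for dual_fun].
HB.instance Definition _ := [Choice of dual by <:].

Lemma dual_submod : submod_closed dual_pred.
Proof.
split.
  apply/asboolP; split=> [a u v|x]; last exact: (@cst_continuous (Cinfty R) R[i] 0).
  by rewrite -![RHS]/(a *: (0 : R[i]) + 0) scaler0 addr0.
move=> a f g /asboolP[lf cf] /asboolP[lg cg]; apply/asboolP; split=> [b u v|x].
  rewrite -![(_ + _) _]/(a * f _ + g _) lf lg.
  rewrite mulrDr scalerDr addrACA; congr (_ + _ + _); exact: mulrCA.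
exact: (cvgD (FF := nbhs_filter x) (cvgZr (FF := nbhs_filter x) (cf x)) (cg x)).
Qed.

HB.instance Definition _ := GRing.isSubmodClosed.Build _ _ dual_pred dual_submod.
HB.instance Definition _ := [SubChoice_isSubLmodule of dual by <:].

(* Strong topology: uniform convergence on the bounded sets. *)
HB.instance Definition _ := Topological.copy dual
  (initial_topology (dual_fun : dual ->
    {family @vN_bounded R[i] (Cinfty R), Cinfty R -> R[i]})).

End CompactlySupportedDistributions.
Arguments dual R : clear implicits.

Section Regularization.
Context {R : realType}.
Implicit Types f : dual R.

Definition dist_support f : set R :=
  ~` \bigcup_(U in [set U : set R | open U /\ forall t : Cinfty R,
        compact (closure [set x | t x != 0]) ->
        closure [set x | t x != 0] `<=` U -> f t = 0]) U.

(* [t] is a smooth function on [R] that coincides with [g] near [K]. *)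
Definition extends_near (K : set R) (g : R -> R[i]) (t : Cinfty R) : Prop :=
  exists2 U : set R, open U /\ K `<=` U & forall x, U x -> t x = g x.

(* On [Bset] the function [rho_ zeta (z - lambda)] of [lambda] may have a real
   pole, away from the support of the distribution. So the pairing is that of
   a compactly supported distribution with a function [g] that is smooth near
   its support only; it does not depend on the extension of [g], and is 0 (a
   junk value) when [g] is not smooth near the support. *)
Definition pairing f (g : R -> R[i]) : R[i] :=
  xget 0 [set f t | t in extends_near (dist_support f) g].

Definition rho (z : R[i]) : R[i] := (pi : R)%:C^-1 * (1 + z ^+ 2)^-1.

Definition rho_ (zeta z : R[i]) : R[i] := zeta^-1 * rho (z / zeta).

Definition regularize f (p : R[i] * R[i]) : R[i] :=
  pairing f (fun lambda : R => rho_ p.2 (p.1 - lambda%:C)).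

Definition regularize_defined f (p : R[i] * R[i]) : Prop :=
  exists t : Cinfty R, extends_near (dist_support f)
    (fun lambda : R => rho_ p.2 (p.1 - lambda%:C)) t.

End Regularization.

Section Germs.
Context {R : realType} (e : ends).

Definition negligible : {pred R[i] * R[i] -> R[i]} :=
  fun f => `[< exists2 n, (0 < n)%N & forall p, Vset e n p -> f p = 0 >].

Lemma negligible_ideal : idealr_closed negligible.
Proof.
split; first by apply/asboolP; exists 1%N.
  apply/negP => /asboolP[n n0]; have [p Vp] := @Vset_neq0 R e n n0.
  by move=> /(_ _ Vp) /eqP; rewrite oner_eq0.
move=> a f g /asboolP[n n0 f0] /asboolP[m m0 g0]; apply/asboolP.
exists (maxn n m) => [|p Vp]; first by rewrite leq_max n0.
rewrite -[LHS]/(a p * f p + g p) f0 ?g0 ?mulr0 ?addr0//.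
  by apply: Vset_decr Vp => //; exact: leq_maxr.
by apply: Vset_decr Vp => //; exact: leq_maxl.
Qed.

HB.instance Definition _ := isIdealr.Build _ negligible negligible_ideal.

(* Functions on [R[i] * R[i]], identified when they coincide on some [Vset e n]
   with [0 < n]; this commutative algebra contains [Ga]. *)
Definition germ : Type := {ideal_quot negligible}.

HB.instance Definition _ := GRing.ComNzRing.on germ.

Definition germ_of (f : R[i] * R[i] -> R[i]) : germ := \pi_germ f.

Lemma germ_of_eq f g : germ_of f = germ_of g <->
  exists2 n, (0 < n)%N & forall p, Vset e n p -> f p = g p.
Proof.
rewrite /germ_of; split.
  move/eqP; rewrite -Quotient.idealrBE => /asboolP[n n0 h].
  by exists n => // p /h /eqP; rewrite subr_eq0 => /eqP.
move=> [n n0 h]; apply/eqP; rewrite -Quotient.idealrBE; apply/asboolP.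
by exists n => // p /h fg; rewrite -[LHS]/(f p - g p) fg subrr.
Qed.

Lemma germ_ofD f g : germ_of (f + g) = germ_of f + germ_of g.
Proof. by rewrite /germ_of !piE. Qed.

Lemma germ_ofM f g : germ_of (f * g) = germ_of f * germ_of g.
Proof. by rewrite /germ_of !piE. Qed.

Lemma germ_of1 : germ_of 1 = 1.
Proof. by rewrite /germ_of !piE. Qed.

Definition germ_scale (a : R[i]) (u : germ) : germ := germ_of (cst a) * u.

Let germ_scaleA a b u : germ_scale a (germ_scale b u) = germ_scale (a * b) u.
Proof. by rewrite /germ_scale mulrA -germ_ofM. Qed.

Let germ_scale1 : left_id 1 germ_scale.
Proof. by move=> u; rewrite /germ_scale germ_of1 mul1r. Qed.

Let germ_scaleDr : right_distributive germ_scale +%R.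
Proof. by move=> a u v; rewrite /germ_scale mulrDr. Qed.

Let germ_scaleDl u : {morph germ_scale^~ u : a b / a + b}.
Proof. by move=> a b; rewrite /germ_scale -mulrDl -germ_ofD. Qed.

HB.instance Definition _ := GRing.Zmodule_isLmodule.Build R[i] germ
  germ_scaleA germ_scale1 germ_scaleDr germ_scaleDl.

Let germ_scaleAl (a : R[i]) (u v : germ) : a *: (u * v) = (a *: u) * v.
Proof. exact: mulrA. Qed.

HB.instance Definition _ := GRing.Lmodule_isLalgebra.Build R[i] germ germ_scaleAl.
HB.instance Definition _ := GRing.Lalgebra_isComAlgebra.Build R[i] germ.

Lemma germ_ofZ a f : germ_of (a *: f) = a *: germ_of f.
Proof. by rewrite -[RHS]germ_ofM. Qed.

Definition Ga : set germ :=
  [set u | exists (n : nat) (phi : weight R) (h : Hspace e n phi),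
             (0 < n)%N /\ u = germ_of h].

End Germs.
Arguments germ R e : clear implicits.
Section Algebras.
Context {R : realType}.

Definition compact_operator (E F : normedModType R[i]) (T : E -> F) : Prop :=
  linear T /\ forall B : set E, bounded_set B -> precompact (T @` B).

Definition partial_x (f : R[i] * R[i] -> R[i]) (p : R[i] * R[i]) : R[i] :=
  cderive 1 (fun x : R => f (x +i* Im p.1, p.2)) (Re p.1).

Definition Apred (e : ends) (idx : nat -> nat) (wgt : nat -> weight R)
    : {pred germ R e} :=
  fun u => `[< exists k (h : Hspace e (idx k) (wgt k)), u = germ_of e h >].

(* The inclusions between the spaces [Hspace] are restrictions of functions,
   whence the monotonicity of [alg_idx]. *)
Record algebra_data (e : ends) := AlgebraData {
  alg_idx : nat -> nat;
  alg_wgt : nat -> weight R;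
  alg_step := fun k => Hspace e (alg_idx k) (alg_wgt k);
  alg_idx_gt0 : forall k, (0 < alg_idx k)%N;
  alg_idx_le : forall k, (alg_idx k <= alg_idx k.+1)%N;
  alg_mul : forall k, exists2 m : alg_step k * alg_step k -> alg_step k.+1,
    continuous m &
    forall f g p, Vset e (alg_idx k.+1) p -> m (f, g) p = f p * g p;
  alg_der : forall k, exists2 d : alg_step k -> alg_step k.+1,
    continuous d &
    forall f p, Vset e (alg_idx k.+1) p -> d f p = partial_x f p;
  alg_incl : forall k, exists2 i : alg_step k -> alg_step k.+1,
    compact_operator i &
    forall f p, Vset e (alg_idx k.+1) p -> i f p = f p;
  alg_closed : GRing.subalg_closed (@Apred e alg_idx alg_wgt)
}.

Section Algebra.
Context (e : ends) (D : algebra_data e).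

Definition alg_pred : {pred germ R e} := Apred (alg_idx D) (alg_wgt D).

Record alg := AlgOf { alg_germ :> germ R e; _ : alg_germ \in alg_pred }.

HB.instance Definition _ := [isSub for alg_germ].
HB.instance Definition _ := [Choice of alg by <:].
HB.instance Definition _ :=
  GRing.isSubalgClosed.Build _ _ alg_pred (alg_closed D).
HB.instance Definition _ := [SubChoice_isSubAlgebra of alg by <:].
HB.instance Definition _ := [SubNzRing_isSubComNzRing of alg by <:].

Lemma alg_sub_Ga (u : alg) : Ga (alg_germ u).
Proof.
case: u => u /= /asboolP[k [h ->]].
by exists (alg_idx D k), (alg_wgt D k), h; split => //; exact: alg_idx_gt0.
Qed.

Lemma alg_inj_subproof k (h : alg_step D k) : germ_of e h \in alg_pred.
Proof. by apply/asboolP; exists k, h. Qed.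

Definition alg_inj k (h : alg_step D k) : alg := AlgOf (alg_inj_subproof h).

Definition absolutely_convex (U : set alg) : Prop :=
  forall (a b : R[i]) u v, `|a| + `|b| <= 1 -> U u -> U v -> U (a *: u + b *: v).

(* Base of neighborhoods of 0 of the locally convex inductive limit topology. *)
Definition alg_nbhs0 (U : set alg) : Prop :=
  absolutely_convex U /\ forall k, nbhs (0 : alg_step D k) (@alg_inj k @^-1` U).

Definition alg_open : set_system alg :=
  [set V | forall a, V a -> exists2 U, alg_nbhs0 U & forall u, U u -> V (a + u)].

Let alg_openT : alg_open setT.
Proof.
move=> a _; exists setT => //; split => // k; rewrite preimage_setT.
exact: filterT.
Qed.

Let alg_openI : setI_closed alg_open.
Proof.
move=> V W oV oW a [Va Wa].
have [U [cU nU] UV] := oV _ Va; have [U' [cU' nU'] UW] := oW _ Wa.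
exists (U `&` U') => [|u [Uu U'u]]; last by split; [exact: UV|exact: UW].
split=> [c d u v cd [Uu U'u] [Uv U'v]|k]; first by split; [exact: cU|exact: cU'].
by rewrite preimage_setI; exact: filterI.
Qed.

Let alg_open_bigU (I : Type) (V : I -> set alg) :
  (forall i, alg_open (V i)) -> alg_open (\bigcup_i V i).
Proof.
move=> oV a [i _ Vi]; have [U nU UV] := oV i _ Vi.
by exists U => // u /UV; exists i.
Qed.

HB.instance Definition _ :=
  isOpenTopological.Build alg alg_openT alg_openI alg_open_bigU.

End Algebra.

End Algebras.

Arguments algebra_data R e : clear implicits.

(* Main.v *)
Require Import Defs.
From HB Require Import structures.
From mathcomp Require Import all_boot all_order all_algebra.
From mathcomp Require Import all_classical all_reals all_analysis.
From mathcomp Require Import complex ring lra.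

(* For a distribution f with |f(t)| <= C p_k(t), where p_k(t) is the supremum of
   |t|, ..., |t^(k)| on [-k, k], partial fractions give
     (f * rho_zeta)(z) = (G(z - i zeta) - G(z + i zeta)) / (2 pi i),
   where G(w) = f(lambda |-> 1 / (w - lambda)) is holomorphic off [-k, k]. On V_n
   with n large both points are at a distance at least |zeta| / 2 from [-k, k],
   which bounds F by a power of 1 / |zeta|.

   The algebra is the union of the H_{n, phi} with n = 2^p, phi = (1 + x^2)^n:
   products stay in the next space, and so do derivatives by Cauchy's estimates,
   as V_n contains a bidisc of radius c |zeta| around each point of V_2n. The
   inclusions are compact by Montel's theorem, the extra factors
   |zeta|^n / (1 + x^2)^n being small outside a compact part of V_2n.

   Injectivity: if F = 0, then G(z - i zeta) = G(z + i zeta). Moving zeta off the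
   real axis yields G(w + c) = G(w) for some c > 0, hence G = 0 on a line since G
   vanishes at infinity. So all moments of f vanish, and polynomials are dense
   in C^k by Weierstrass.

   Continuity: the strong dual is not metrizable. Given an absolutely convex
   neighborhood U of 0 there are d_k > 0 such that |g| <= d_k p_k implies
   2^(k+1) j(g) in U. If |g| < 1 on the bounded set of the t such that
   p_k(t) <= 1 / d_k for all k, then by Ascoli |g| <= sum_(k < K) d_k p_k for
   some K; by Hahn-Banach g is a sum of g_k with |g_k| <= d_k p_k, and
   j(g) = sum 2^-(k+1) (2^(k+1) j(g_k)) is in U. *)

Set Implicit Arguments.
Unset Strict Implicit.
Unset Printing Implicit Defensive.

Import Order.TTheory GRing.Theory Num.Theory.
Import numFieldNormedType.Exports.
Import ComplexField.Normc.

Local Open Scope classical_set_scope.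
Local Open Scope ring_scope.
Local Open Scope complex_scope.

Local Notation Re := (@complex.Re _).
Local Notation Im := (@complex.Im _).

(** * Goursat and the maximum principle *)

(** The complex analysis needs neither power series nor Cauchy's integral formula. Goursat's
    theorem, proved for functions that are continuous on a square and holomorphic off finitely many
    points, gives a maximum principle up to a constant factor. Applied to first and second divided
    differences, which are a priori only continuous at their base points, it bounds the derivative,
    the increments and the second-order Taylor remainder. Slices along complex lines carry these
    bounds to two variables. The constant of the remainder is uniform on bounded families, so
    holomorphy passes to pointwise limits.

    In the embedding the obstacle is the part B_n of V_n, where z - i zeta or z + i zeta may be
    real: the kernel then has a pole on the line, though off the support. It is therefore composed
    with a bounded smooth function equal to the identity near the support, which makes it smooth on
    the whole line. All bounds are kept linear in C, with factors that depend on k only, because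
    continuity rests on this uniformity. *)

Section Modulus.
Context {R : realType}.
Implicit Types z w : R[i].

Lemma modcB z w : modc (z - w) = modc (w - z).
Proof. by rewrite -(normcN (z - w)) opprB. Qed.

Lemma modc_eq0 z : (modc z == 0) = (z == 0).
Proof.
apply/eqP/eqP => [/eq0_normc//|->]; exact: normc0.
Qed.

Lemma modc_gt0 z : (0 < modc z) = (z != 0).
Proof. by rewrite lt_neqAle modc_ge0 andbT eq_sym modc_eq0. Qed.

Lemma sqr_modc z : modc z ^+ 2 = Re z ^+ 2 + Im z ^+ 2.
Proof. by case: z => x y /=; rewrite sqr_sqrtr// addr_ge0// sqr_ge0. Qed.

Lemma Re_le_modc z : `|Re z| <= modc z.
Proof.
rewrite -(@ler_pXn2r _ 2)// ?nnegrE ?modc_ge0//.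
by rewrite sqr_modc real_normK ?num_real// lerDl sqr_ge0.
Qed.

Lemma Im_le_modc z : `|Im z| <= modc z.
Proof.
rewrite -(@ler_pXn2r _ 2)// ?nnegrE ?modc_ge0//.
by rewrite sqr_modc real_normK ?num_real// lerDr sqr_ge0.
Qed.

Lemma modc_le_ReIm z : modc z <= `|Re z| + `|Im z|.
Proof.
rewrite -(@ler_pXn2r _ 2)// ?nnegrE ?modc_ge0 ?addr_ge0//.
rewrite sqr_modc sqrrD !real_normK ?num_real// lerD2r lerDl.
by rewrite mulrn_wge0// mulr_ge0.
Qed.

Lemma le_modcB z w : modc (z - w) <= modc z + modc w.
Proof. by rewrite -(normcN w) le_normcD. Qed.

Lemma le_dist_modc z w : modc z - modc w <= modc (z - w).
Proof. by rewrite lerBlDr -[in leLHS](subrK w z) le_normcD. Qed.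

Lemma modc_triangle w z t : modc (z - t) <= modc (z - w) + modc (w - t).
Proof. by rewrite -[z - t](subrKA w) le_normcD. Qed.

Lemma modcX z n : modc (z ^+ n) = modc z ^+ n.
Proof. by elim: n => [|n IH]; rewrite ?expr0 ?normc1// !exprS normcM IH. Qed.

Lemma modc_real (x : R) : modc x%:C = `|x|.
Proof. by rewrite /= expr0n /= addr0 sqrtr_sqr. Qed.

Lemma modci : modc ('i : R[i]) = 1.
Proof. by rewrite /= expr0n /= add0r expr1n sqrtr1. Qed.

Lemma cReD z w : Re (z + w) = Re z + Re w. Proof. by case: z w => [? ?] []. Qed.
Lemma cImD z w : Im (z + w) = Im z + Im w. Proof. by case: z w => [? ?] []. Qed.
Lemma cReN z : Re (- z) = - Re z. Proof. by case: z. Qed.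
Lemma cImN z : Im (- z) = - Im z. Proof. by case: z. Qed.
Lemma cReM z w : Re (z * w) = Re z * Re w - Im z * Im w.
Proof. by case: z w => [? ?] []. Qed.
Lemma cImM z w : Im (z * w) = Re z * Im w + Im z * Re w.
Proof. by case: z w => [? ?] []. Qed.

Lemma complex_eq z w : Re z = Re w -> Im z = Im w -> z = w.
Proof. by case: z w => [? ?] [? ?] /= -> ->. Qed.

End Modulus.

(** * Real derivatives, primitives and the mean value theorem *)

Section RealDerivative.
Context {R : realType}.
Implicit Types (u : R -> R) (x l : R).

Lemma is_derive_epsP u x l : is_derive x (1 : R) u l <->
  forall e : R, 0 < e -> exists2 d : R, 0 < d &
    forall h, `|h| < d -> `|u (x + h) - u x - l * h| <= e * `|h|.
Proof.
split=> [ud e e0|H].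
  have [dx <-] := ud.
  have /cvgrPdist_le/(_ _ e0) := dx.
  move=> /nbhs_ballP[d /= d0 H]; exists d => // h hd.
  have [->|h0] := eqVneq h 0; first by rewrite addr0 subrr normr0 mulr0 subrr normr0 mulr0.
  have := H h; rewrite /ball/= sub0r normrN => /(_ hd h0).
  rewrite -[_ *: _]/(h^-1 * _) -[h *: 1]/(h * 1) mulr1 [h + x]addrC.
  move=> Hh; rewrite -ler_pdivrMr ?normr_gt0// -normfV -normrM.
  rewrite distrC in Hh; apply: le_trans Hh; rewrite le_eqVlt; apply/orP; left; apply/eqP.
  congr (`|_|); rewrite -[lim _]/('D_1 u x); field; exact: h0.
have cv : h^-1 *: ((u \o shift x) (h *: (1 : R)) - u x) @[h --> (0:R)^'] --> l.
  apply/cvgrPdist_le => e e0; have [d d0 Hd] := H e e0.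
  apply/nbhs_ballP; exists d => //= h; rewrite /ball/= sub0r normrN => hd h0.
  have := Hd h hd.
  rewrite -[_ *: _]/(h^-1 * _) -[h *: 1]/(h * 1) mulr1 [h + x]addrC.
  rewrite -ler_pdivrMr ?normr_gt0// -normfV -normrM => Hh.
  rewrite distrC; apply: le_trans Hh; rewrite le_eqVlt; apply/orP; left; apply/eqP.
  congr (`|_|); field; exact: h0.
apply: DeriveDef; first by apply/cvg_ex; exists l.
exact: cvg_lim.
Qed.

Lemma mvt u (du : R -> R) (x y : R) : x <= y ->
  (forall t, x <= t <= y -> is_derive t (1 : R) u (du t)) ->
  exists2 c, x <= c <= y & u y - u x = du c * (y - x).
Proof.
move=> xy H.
have [] := @MVT_segment _ u du x y xy.
- by move=> t; rewrite in_itv/= => /andP[a b]; apply: H; rewrite !ltW.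
- apply: derivable_within_continuous => t; rewrite in_itv/= => txy.
  by have [] := H t txy.
- by move=> c; rewrite in_itv/= => cxy E; exists c.
Qed.

Lemma continuous_prim (a : R) (g : R -> R) : continuous g ->
  exists G : R -> R, forall x, a < x -> is_derive x (1 : R) G (g x).
Proof.
move=> cg; exists (fun x => \int[lebesgue_measure]_(t in [set` Interval (BLeft a) (BRight x)]) (g t))%R.
move=> x ax.
have [] := @continuous_FTC1 R g (BLeft a) x (x + 1).
- by rewrite ltrDl.
- apply: continuous_compact_integrable; first exact: segment_compact.
  by move=> y; apply: continuous_subspaceT.
- by [].
- exact: cg.
move=> dx; rewrite derive1E => E; exact: (DeriveDef dx E).
Qed.

(** The mean value theorem applied to [u] minus a primitive of [a + b t]. The comparison is with an
    affine integrand because affine functions integrate to 0 along closed contours, which is the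
    point of Goursat's argument. *)
Lemma le_prim_affine (a b e x y : R) u (du : R -> R) : x <= y ->
  (forall t, x <= t <= y -> is_derive t (1 : R) u (du t)) ->
  (forall t, x <= t <= y -> `|du t - (a + b * t)| <= e) ->
  `|u y - u x - (a * (y - x) + b * (y ^+ 2 - x ^+ 2) / 2)| <= e * (y - x).
Proof.
move=> xy H He.
pose v t := u t - (a * t + b / 2 * (t * t)).
have [|c cxy] := @mvt v (fun t => du t - (a + b * t)) x y xy.
  move=> t txy; have Ht := H t txy.
  apply: is_derive_eq; rewrite -[_ *: _]/(_ * _); rewrite /GRing.scale/=; lra.
rewrite /v => E.
have -> : u y - u x - (a * (y - x) + b * (y ^+ 2 - x ^+ 2) / 2) =
  (du c - (a + b * c)) * (y - x) by rewrite -E; lra.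
rewrite normrM [X in _ * X]ger0_norm ?subr_ge0// ler_wpM2r ?subr_ge0//.
exact: He.
Qed.

End RealDerivative.

Section Goursat.
Context {R : realType}.

Lemma exists_pow2_gt (x : R) : exists n, x < 2 ^+ n.
Proof.
exists (Num.bound `|x|); apply: (le_lt_trans (ler_norm x)).
apply: (lt_le_trans (archi_boundP (normr_ge0 x))).
have -> : (2 : R) ^+ Num.bound `|x| = (2 ^ Num.bound `|x|)%N%:R by rewrite natrX.
by rewrite ler_nat ltnW// ltn_expl.
Qed.

(** Goursat's quadrisection for an arbitrary subadditive function of rectangles. Were its value
    positive, one quarter would at each step stay above a threshold quadratic in the half-perimeter,
    against the local bound at the limit point. *)
Lemma bisection (N : R -> R -> R -> R -> R) (x1 x2 y1 y2 : R) :
  x1 <= x2 -> y1 <= y2 ->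
  (forall a m b c d, N a b c d <= N a m c d + N m b c d) ->
  (forall a b c m d, N a b c d <= N a b c m + N a b m d) ->
  (forall p q, x1 <= p <= x2 -> y1 <= q <= y2 -> forall e, 0 < e ->
     exists2 d, 0 < d & forall a b c f, x1 <= a <= p -> p <= b <= x2 ->
       y1 <= c <= q -> q <= f <= y2 -> (b - a) + (f - c) < d ->
       N a b c f <= e * ((b - a) + (f - c)) ^+ 2) ->
  N x1 x2 y1 y2 <= 0.
Proof.
move=> x12 y12 subx suby loc; rewrite leNgt; apply/negP => N0.
pose w := x2 - x1; pose h := y2 - y1; pose m := w + h.
have w0 : 0 <= w by rewrite subr_ge0.
have h0 : 0 <= h by rewrite subr_ge0.
(* A rectangle reduced to a point is settled by the local bound there, whose right-hand side is
   0. *)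
have m0 : 0 < m.
  rewrite lt_neqAle addr_ge0// andbT; apply/eqP => m0.
  have [||d d0] := loc x1 y1 _ _ 1 ltr01; rewrite ?lexx//.
  move=> /(_ x1 x2 y1 y2); rewrite !lexx x12 y12 -/w -/h -/m -m0 expr0n/= mulr0 leNgt N0.
  by move=> H; have := H isT isT isT isT d0.
(* Half of the ratio to [m ^+ 2], so that the whole rectangle is strictly above the threshold in
   [Bad]. *)
pose e := N x1 x2 y1 y2 / (2 * m ^+ 2).
have e0 : 0 < e by rewrite divr_gt0// mulr_gt0// exprn_gt0.
pose t n : R := (2 ^+ n)^-1.
have t0 n : 0 < t n by rewrite invr_gt0 exprn_gt0.
have tS n : t n = t n.+1 + t n.+1.
  have tn := t0 n; have tn1 : (2:R) ^+ n != 0 by rewrite expf_neq0.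
  rewrite /t exprS; field; exact: tn1.
pose Bad n (s : R * R) :=
  e * (m * t n) ^+ 2 < N s.1 (s.1 + w * t n) s.2 (s.2 + h * t n).
have step n s : exists s' : R * R, Bad n s ->
   [/\ Bad n.+1 s', s.1 <= s'.1 /\ s'.1 + w * t n.+1 <= s.1 + w * t n
     & s.2 <= s'.2 /\ s'.2 + h * t n.+1 <= s.2 + h * t n].
  have wt : 0 <= w * t n.+1 by rewrite mulr_ge0// ltW.
  have ht : 0 <= h * t n.+1 by rewrite mulr_ge0// ltW.
  have [bs|] := pselect (Bad n s); last by exists s.
  case: s bs => a c bs.
  pose a' := a + w * t n.+1; pose c' := c + h * t n.+1.
  (* If no quarter is bad, the four bounds add up to the threshold of the parent, as halving the
     sides divides it by 4. *)
  suff : [\/ Bad n.+1 (a, c), Bad n.+1 (a, c'), Bad n.+1 (a', c) | Bad n.+1 (a', c')].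
    have tn := tS n.
    case=> B; [exists (a, c)|exists (a, c')|exists (a', c)|exists (a', c')] => _;
      split => //=; rewrite ?tn ?mulrDr; split; rewrite /a' /c'; lra.
  apply: contrapT => nB; move: bs; rewrite /Bad /=; apply/negP; rewrite -leNgt.
  have B1 : N a (a + w * t n.+1) c (c + h * t n.+1) <= e * (m * t n.+1) ^+ 2.
    by rewrite leNgt; apply/negP => H; apply: nB; constructor 1.
  have B2 : N a (a + w * t n.+1) c' (c' + h * t n.+1) <= e * (m * t n.+1) ^+ 2.
    by rewrite leNgt; apply/negP => H; apply: nB; constructor 2.
  have B3 : N a' (a' + w * t n.+1) c (c + h * t n.+1) <= e * (m * t n.+1) ^+ 2.
    by rewrite leNgt; apply/negP => H; apply: nB; constructor 3.
  have B4 : N a' (a' + w * t n.+1) c' (c' + h * t n.+1) <= e * (m * t n.+1) ^+ 2.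
    by rewrite leNgt; apply/negP => H; apply: nB; constructor 4.
  have -> : a + w * t n = a' + w * t n.+1 by rewrite /a' tS mulrDr addrA.
  have -> : c + h * t n = c' + h * t n.+1 by rewrite /c' tS mulrDr addrA.
  have S1 := subx a a' (a' + w * t n.+1) c (c' + h * t n.+1).
  have S2 := suby a a' c c' (c' + h * t n.+1).
  have S3 := suby a' (a' + w * t n.+1) c c' (c' + h * t n.+1).
  have -> : e * (m * t n) ^+ 2 = 4 * (e * (m * t n.+1) ^+ 2).
    by rewrite tS; ring.
  rewrite /a' /c' in B1 B2 B3 B4 S1 S2 S3 *.
  lra.
have [F HF] := @choice _ _ (fun (ns : nat * (R * R)) (s' : R * R) => Bad ns.1 ns.2 ->
   [/\ Bad ns.1.+1 s', ns.2.1 <= s'.1 /\ s'.1 + w * t ns.1.+1 <= ns.2.1 + w * t ns.1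
     & ns.2.2 <= s'.2 /\ s'.2 + h * t ns.1.+1 <= ns.2.2 + h * t ns.1]) (fun ns => step ns.1 ns.2).
pose s := fix s n := if n is k.+1 then F (k, s k) else (x1, y1).
have B n : Bad n (s n).
  elim: n => [|n IH]; last by have [] := HF (n, s n) IH.
  rewrite /Bad/= /t expr0 invr1 !mulr1 [x1 + w]addrC [y1 + h]addrC !subrK /e /=.
  have -> : N x1 x2 y1 y2 / (2 * m ^+ 2) * m ^+ 2 = N x1 x2 y1 y2 / 2.
    by field; rewrite gt_eqF.
  lra.
have mono n k : [/\ (s n).1 <= (s (k + n)%N).1, (s (k + n)%N).1 + w * t (k + n)%N <= (s n).1 + w * t n,
   (s n).2 <= (s (k + n)%N).2 & (s (k + n)%N).2 + h * t (k + n)%N <= (s n).2 + h * t n].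
  elim: k => [|k [A1 A2 A3 A4]]; first by rewrite add0n !lexx.
  have [_ [C1 C2] [C3 C4]] := HF ((k + n)%N, s (k + n)%N) (B _).
  by rewrite !addSn; split; [apply: le_trans C1|apply: le_trans A2|apply: le_trans C3|apply: le_trans A4].
have cross1 n k : (s n).1 <= (s k).1 + w * t k.
  have [_ H _ _] := mono k n; have [H' _ _ _] := mono n k.
  rewrite addnC in H'; apply: (le_trans H'); apply: le_trans H.
  by rewrite lerDl mulr_ge0// ltW.
have cross2 n k : (s n).2 <= (s k).2 + h * t k.
  have [_ _ _ H] := mono k n; have [_ _ H' _] := mono n k.
  rewrite addnC in H'; apply: (le_trans H'); apply: le_trans H.
  by rewrite lerDl mulr_ge0// ltW.
(* The common point of the nested rectangles. *)
pose p := sup (range (fun n => (s n).1)); pose q := sup (range (fun n => (s n).2)).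
have p1 n : (s n).1 <= p.
  by apply: ub_le_sup; [exists ((s 0%N).1 + w * t 0%N) => _ [k _ <-]|exists n].
have q1 n : (s n).2 <= q.
  by apply: ub_le_sup; [exists ((s 0%N).2 + h * t 0%N) => _ [k _ <-]|exists n].
have p2 n : p <= (s n).1 + w * t n.
  by apply: ge_sup; [exists (s 0%N).1; exists 0%N|move=> _ [k _ <-]].
have q2 n : q <= (s n).2 + h * t n.
  by apply: ge_sup; [exists (s 0%N).2; exists 0%N|move=> _ [k _ <-]].
have T0 : t 0%N = 1 by rewrite /t expr0 invr1.
have E1 : x1 + w = x2 by rewrite addrC subrK.
have E2 : y1 + h = y2 by rewrite addrC subrK.
have px : x1 <= p <= x2.
  by have := p1 0%N; have := p2 0%N; rewrite T0 mulr1 /= E1 => -> ->.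
have qy : y1 <= q <= y2.
  by have := q1 0%N; have := q2 0%N; rewrite T0 mulr1 /= E2 => -> ->.
have [d d0 Hd] := loc p q px qy e e0.
have [n Hn] := exists_pow2_gt (m / d).
have mt : m * t n < d.
  by rewrite /t ltr_pdivrMr ?exprn_gt0// mulrC -ltr_pdivrMr.
have [A1 A2 A3 A4] := mono 0%N n; rewrite addn0 T0 !mulr1 /= E1 E2 in A1 A2 A3 A4.
have := B n; rewrite /Bad; apply/negP; rewrite -leNgt.
have -> : m * t n = (s n).1 + w * t n - (s n).1 + ((s n).2 + h * t n - (s n).2).
  by rewrite /m; lra.
apply: Hd.
- by rewrite A1 p1.
- by rewrite p2 A2.
- by rewrite A3 q1.
- by rewrite q2 A4.
- by apply: le_lt_trans mt; rewrite /m; lra.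
Qed.

End Goursat.

Section Contour.
Context {R : realType}.
Implicit Types (a b c f m x y : R) (phi : R[i] -> R[i]) (z p : R[i]).

Definition unit_square : set R[i] := [set z | -1 <= Re z <= 1 /\ -1 <= Im z <= 1].

Definition cont_at phi p := forall e : R, 0 < e -> exists2 d : R, 0 < d &
  forall z, unit_square z -> modc (z - p) < d -> modc (phi z - phi p) <= e.

Definition holo_at phi p (l : R[i]) := forall e : R, 0 < e -> exists2 d : R, 0 < d &
  forall z, unit_square z -> modc (z - p) < d ->
    modc (phi z - phi p - l * (z - p)) <= e * modc (z - p).

Lemma holo_cont phi p l : holo_at phi p l -> cont_at phi p.
Proof.
move=> H e e0; have [d d0 Hd] := H 1 ltr01.
have l1 : 0 < 1 + modc l by rewrite ltr_wpDr// modc_ge0.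
exists (Num.min d (e / (1 + modc l))); first by rewrite lt_min d0 divr_gt0.
move=> z Qz; rewrite lt_min => /andP[zd ze].
have := Hd z Qz zd; rewrite mul1r => h1.
have -> : phi z - phi p = (phi z - phi p - l * (z - p)) + l * (z - p) by rewrite subrK.
apply: (le_trans (le_normcD _ _)); rewrite normcM.
rewrite ltr_pdivlMr// in ze; apply: le_trans (ltW ze).
by rewrite [leRHS]mulrDr mulr1 lerD// mulrC.
Qed.

(** The derivatives are two-sided even at the endpoints, so [cprim_ex] first extends [g]
    continuously beyond them by means of [clamp]. *)
Definition cprim (g P : R -> R[i]) := forall x : R, -1 <= x <= 1 ->
  is_derive x (1 : R) (Re \o P) (Re (g x)) /\ is_derive x (1 : R) (Im \o P) (Im (g x)).

Definition clamp (x : R) := Num.max (-1) (Num.min 1 x).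

Lemma clamp_id x : -1 <= x <= 1 -> clamp x = x.
Proof. by move=> /andP[a b]; rewrite /clamp (min_idPr b) (max_idPr a). Qed.

Lemma clamp_bound x : -1 <= clamp x <= 1.
Proof.
by rewrite /clamp le_max lexx/= ge_max ge_min lexx/= andbT; lra.
Qed.

Lemma clamp_lip x y : `|clamp x - clamp y| <= `|x - y|.
Proof.
have o : (-1 : R) <= 1 by lra.
rewrite /clamp; case: (leP 1 x) => hx; case: (leP 1 y) => hy;
  rewrite ?(max_idPr o); rewrite ?subrr ?normr0//.
- by case: (leP (-1) y) => hy'; rewrite ler_norml; apply/andP; split;
    case: (ler0P (x - y)); lra.
- by case: (leP (-1) x) => hx'; rewrite ler_norml; apply/andP; split;
    case: (ler0P (x - y)); lra.
- by case: (leP (-1) y) => hy'; case: (leP (-1) x) => hx'; rewrite ler_norml;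
    apply/andP; split; case: (ler0P (x - y)); lra.
Qed.

Lemma cprim_ex (g : R -> R[i]) :
  (forall x : R, -1 <= x <= 1 -> forall e : R, 0 < e -> exists2 d : R, 0 < d &
     forall y : R, -1 <= y <= 1 -> `|y - x| < d -> modc (g y - g x) <= e) ->
  exists P, cprim g P.
Proof.
move=> cg.
have cu (F : R[i] -> R) : (forall z w, `|F z - F w| <= modc (z - w)) ->
    continuous (fun x => F (g (clamp x))).
  move=> FL x; apply/cvgrPdist_le => e e0.
  have [d d0 Hd] := cg _ (clamp_bound x) e e0.
  apply/nbhs_ballP; exists d => //= y xy; apply: (le_trans (FL _ _)).
  rewrite modcB; apply: Hd; first exact: clamp_bound.
  by apply: le_lt_trans (clamp_lip _ _) _; rewrite distrC.
(* Starting the primitive at -2 leaves -1 in the interior. *)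
have [|A HA] := @continuous_prim R (-2) _ (cu (@complex.Re _) _).
  by move=> z w; rewrite -cReN -cReD Re_le_modc.
have [|B HB] := @continuous_prim R (-2) _ (cu (@complex.Im _) _).
  by move=> z w; rewrite -cImN -cImD Im_le_modc.
exists (fun x => A x +i* B x) => x x1.
have x2 : -2 < x by lra.
by have := HA x x2; have := HB x x2; rewrite clamp_id.
Qed.

Lemma cprim_le g P (al be : R[i]) (e x y : R) : cprim g P ->
  -1 <= x -> x <= y -> y <= 1 ->
  (forall t, x <= t <= y -> modc (g t - (al + be * t%:C)) <= e) ->
  modc (P y - P x - (al * (y - x)%:C + be * ((y ^+ 2 - x ^+ 2) / 2)%:C)) <= 2 * e * (y - x).
Proof.
move=> HP x1 xy y1 He.
have H1 t : x <= t <= y -> is_derive t (1 : R) (Re \o P) (Re (g t)).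
  by move=> txy; have [] // := HP t _; lra.
have H2 t : x <= t <= y -> is_derive t (1 : R) (Im \o P) (Im (g t)).
  by move=> txy; have [] // := HP t _; lra.
apply: (le_trans (modc_le_ReIm _)).
have -> : 2 * e * (y - x) = e * (y - x) + e * (y - x) by ring.
apply: lerD.
  apply: (le_trans _ (@le_prim_affine R (Re al) (Re be) e x y _ _ xy H1 _)).
    by rewrite !(cReD, cReN, cReM)/= !mulr0 !subr0 -mulrA.
  move=> t txy; apply: le_trans (He t txy); apply: le_trans (Re_le_modc _).
  by rewrite !(cReD, cReN, cReM)/= mulr0 subr0.
apply: (le_trans _ (@le_prim_affine R (Im al) (Im be) e x y _ _ xy H2 _)).
  by rewrite !(cImD, cImN, cImM)/= !mulr0 !add0r -mulrA.
move=> t txy; apply: le_trans (He t txy); apply: le_trans (Im_le_modc _).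
by rewrite !(cImD, cImN, cImM)/= mulr0 add0r.
Qed.

Section Rectangles.
Variables (phi : R[i] -> R[i]) (H W : R -> R -> R[i]).
Hypothesis Hprim : forall y : R, -1 <= y <= 1 -> cprim (fun x => phi (x +i* y)) (H y).
Hypothesis Wprim : forall x : R, -1 <= x <= 1 -> cprim (fun y => phi (x +i* y)) (W x).

(* Contour integral along the boundary of [a, b] x [c, f], written with the
   primitives of the restrictions of [phi] to the horizontal and vertical lines. *)
Definition rect_int a b c f := (H c b - H c a) + 'i * (W b f - W b c)
  - (H f b - H f a) - 'i * (W a f - W a c).

Lemma rect_int_x m a b c f : rect_int a b c f = rect_int a m c f + rect_int m b c f.
Proof. by rewrite /rect_int; ring. Qed.

Lemma rect_int_y m a b c f : rect_int a b c f = rect_int a b c m + rect_int a b m f.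
Proof. by rewrite /rect_int; ring. Qed.

(** The contour integral of the affine function vanishes exactly, so only the deviation is left:
    each side contributes [2 * e] times its length, the 2 coming from separate estimates of real and
    imaginary parts. *)
Lemma rect_int_le al be e a b c f : -1 <= a -> a <= b -> b <= 1 ->
  -1 <= c -> c <= f -> f <= 1 ->
  (forall x y, a <= x <= b -> c <= y <= f ->
     modc (phi (x +i* y) - (al + be * (x +i* y))) <= e) ->
  modc (rect_int a b c f) <= 4 * e * ((b - a) + (f - c)).
Proof.
move=> a1 ab b1 c1 cf f1 He.
have hor y : c <= y <= f -> modc (H y b - H y a - ((al + be * ('i * y%:C)) * (b - a)%:C
    + be * ((b ^+ 2 - a ^+ 2) / 2)%:C)) <= 2 * e * (b - a).
  move=> cyf; apply: (@cprim_le _ _ _ _ _ a b (Hprim _)) => //; first by lra.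
  move=> t atb; have := He t y atb cyf; congr (modc _ <= _).
  by congr (_ - _); rewrite -addrA -mulrDr; congr (_ + _ * _); apply: complex_eq;
    rewrite !(cReD, cImD, cReM, cImM)/=; lra.
have ver x : a <= x <= b -> modc (W x f - W x c - ((al + be * x%:C) * (f - c)%:C
    + (be * 'i) * ((f ^+ 2 - c ^+ 2) / 2)%:C)) <= 2 * e * (f - c).
  move=> axb; apply: (@cprim_le _ _ _ _ _ c f (Wprim _)) => //; first by lra.
  move=> t ctf; have := He x t axb ctf; congr (modc _ <= _).
  by congr (_ - _); rewrite -addrA -mulrA -mulrDr; congr (_ + _ * _); apply: complex_eq;
    rewrite !(cReD, cImD, cReM, cImM)/=; lra.
have h1 : c <= c <= f by rewrite lexx.
have h2 : c <= f <= f by rewrite lexx andbT.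
have v1 : a <= a <= b by rewrite lexx.
have v2 : a <= b <= b by rewrite lexx andbT.
move: h1 h2 v1 v2 => /hor h1 /hor h2 /ver v1 /ver v2.
set h1' := (X in modc X <= _) in h1; set h2' := (X in modc X <= _) in h2.
set v1' := (X in modc X <= _) in v1; set v2' := (X in modc X <= _) in v2.
have -> : rect_int a b c f = h1' + 'i * v2' - h2' - 'i * v1'.
  rewrite /rect_int /h1' /h2' /v1' /v2' !rmorphB/=.
  have ii : ('i : R[i]) * 'i = -1 by apply: complex_eq; rewrite /=; lra.
  by ring.
apply: (le_trans (le_modcB _ _)); rewrite normcM modci mul1r.
apply: (le_trans (lerD (le_modcB _ _) v1)).
apply: (le_trans (lerD (lerD (le_normcD _ _) h2) (lexx _))).
rewrite normcM modci mul1r.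
apply: (le_trans (lerD (lerD (lerD h1 v2) (lexx _)) (lexx _))).
by lra.
Qed.

(** Induction on the exceptional points. Without any, differentiability gives the local bound of
    [bisection]. An exceptional point is enclosed in a small rectangle: the four surrounding
    rectangles avoid it, and on the small one continuity suffices because its perimeter tends to
    0. *)
Lemma rect_int_eq0 (S : seq R[i]) a b c f :
  (forall p, unit_square p -> cont_at phi p) ->
  -1 <= a -> a <= b -> b <= 1 -> -1 <= c -> c <= f -> f <= 1 ->
  (forall x y, a <= x <= b -> c <= y <= f -> (x +i* y) \notin S ->
     exists l, holo_at phi (x +i* y) l) ->
  rect_int a b c f = 0.
Proof.
move=> cphi.
elim: S a b c f => [|w S IH] a b c f a1 ab b1 c1 cf f1 hol.
  apply: eq0_normc; apply/eqP; rewrite eq_le modc_ge0 andbT.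
  apply: (@bisection R (fun a b c f => modc (rect_int a b c f))) => //.
  - by move=> x1 m x2 y1 y2; rewrite (rect_int_x m) le_normcD.
  - by move=> x1 x2 y1 m y2; rewrite (rect_int_y m) le_normcD.
  move=> p q pab qcf e e0; have [l] := hol p q pab qcf isT.
  (* With deviation [e / 4 * m], [rect_int_le] returns exactly [e * m ^+ 2]. *)
  move=> /(_ (e / 4)) []; first by rewrite divr_gt0.
  move=> d d0 Hd; exists d => // a' b' c' f' /andP[aa ap] /andP[pb bb] /andP[cc cq] /andP[qf ff] md.
  set m := _ + _ in md *.
  have -> : e * m ^+ 2 = 4 * (e / 4 * m) * m by field.
  apply: (@rect_int_le (phi (p +i* q) - l * (p +i* q)) l); try lra.
  move=> x y xab ycf.
  have zm : modc ((x +i* y) - (p +i* q)) <= m.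
    apply: (le_trans (modc_le_ReIm _)) => /=; rewrite /m.
    by apply: lerD; rewrite ler_norml; apply/andP; split; lra.
  have := Hd (x +i* y) _ (le_lt_trans zm md) => /(_ _)/le_trans H1.
  rewrite (_ : _ - _ = phi (x +i* y) - phi (p +i* q) - l * ((x +i* y) - (p +i* q))); last by ring.
  apply: H1; first by split => /=; lra.
  by rewrite ler_wpM2l// divr_ge0// ltW.
have [wr|wr] := pselect (a <= Re w <= b /\ c <= Im w <= f); last first.
  apply: IH => // x y xab ycf xS; apply: hol => //; rewrite inE negb_or xS andbT.
  by apply/eqP => E; apply: wr; rewrite -E.
case: w hol wr => p q hol /= [/andP[ap pb] /andP[cq qf]].
have [|d d0 Hd] := cphi (p +i* q) _ 1 ltr01; first by split => /=; lra.
apply: eq0_normc; apply/eqP; rewrite eq_le modc_ge0 andbT.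
apply/ler_addgt0Pr => e e0; rewrite add0r.
(* The small rectangle has sides at most [2 * h]: [d / 4] keeps it within [d] of the exceptional
   point, and [e / 16] makes the bound [4 * 1 * (2 * h + 2 * h)] at most [e]. *)
pose h := Num.min (d / 4) (e / 16).
have h0 : 0 < h by rewrite lt_min !divr_gt0.
have hd : h <= d / 4 by rewrite ge_min lexx.
have he : h <= e / 16 by rewrite ge_min lexx orbT.
pose a' := Num.max a (p - h); pose b' := Num.min b (p + h).
pose c' := Num.max c (q - h); pose f' := Num.min f (q + h).
have aa : a <= a' by rewrite le_max lexx.
have ap' : a' <= p by rewrite ge_max ap/=; lra.
have bb : b' <= b by rewrite ge_min lexx.
have pb' : p <= b' by rewrite le_min pb/=; lra.
have cc : c <= c' by rewrite le_max lexx.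
have cq' : c' <= q by rewrite ge_max cq/=; lra.
have ff : f' <= f by rewrite ge_min lexx.
have qf' : q <= f' by rewrite le_min qf/=; lra.
have ah : p - h <= a' by rewrite le_max lexx orbT.
have bh : b' <= p + h by rewrite ge_min lexx orbT.
have ch : q - h <= c' by rewrite le_max lexx orbT.
have fh : f' <= q + h by rewrite ge_min lexx orbT.
have sub x1 x2 y1 y2 : a <= x1 -> x1 <= x2 -> x2 <= b -> c <= y1 -> y1 <= y2 -> y2 <= f ->
    (x2 < p) || (p < x1) || (y2 < q) || (q < y1) -> rect_int x1 x2 y1 y2 = 0.
  move=> ? ? ? ? ? ? out; apply: IH; try lra.
  move=> x y xx yy xS; apply: hol; try lra.
  rewrite inE negb_or xS andbT; apply/eqP => -[E1 E2].
  by move: out; rewrite -E1 -E2; lra.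
rewrite (rect_int_x a') (rect_int_x b' a') (rect_int_y c' a') (rect_int_y f' a' b' c').
(* Either clipping at the border has made the strip degenerate, or the strip lies strictly to one
   side of the exceptional point. *)
have -> : rect_int a a' c f = 0.
  have [aE|] := eqVneq a' a; first by rewrite aE /rect_int; ring.
  rewrite eq_sym /a'; case: (leP a (p - h)) => [ah'|_]; last by rewrite eqxx.
  by move=> _; apply: sub => //; lra.
have -> : rect_int b' b c f = 0.
  have [bE|] := eqVneq b' b; first by rewrite bE /rect_int; ring.
  rewrite eq_sym /b'; case: (leP b (p + h)) => [_|bh']; first by rewrite eqxx.
  by move=> _; apply: sub => //; lra.
have -> : rect_int a' b' c c' = 0.
  have [aE|] := eqVneq c' c; first by rewrite aE /rect_int; ring.
  rewrite eq_sym /c'; case: (leP c (q - h)) => [ah'|_]; last by rewrite eqxx.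
  by move=> _; apply: sub => //; lra.
have -> : rect_int a' b' f' f = 0.
  have [bE|] := eqVneq f' f; first by rewrite bE /rect_int; ring.
  rewrite eq_sym /f'; case: (leP f (q + h)) => [_|bh']; first by rewrite eqxx.
  by move=> _; apply: sub => //; lra.
rewrite !(add0r, addr0).
apply: (le_trans (@rect_int_le (phi (p +i* q)) 0 1 a' b' c' f' _ _ _ _ _ _ _)); try lra.
move=> x y xx yy; rewrite mul0r addr0; apply: Hd; first by split => /=; lra.
apply: (le_lt_trans (modc_le_ReIm _)) => /=.
have : `|x - p| <= h by rewrite ler_norml; lra.
have : `|y - q| <= h by rewrite ler_norml; lra.
lra.
Qed.

End Rectangles.

Lemma goursat phi (S : seq R[i]) :
  (forall p, unit_square p -> cont_at phi p) ->
  (forall p, unit_square p -> p \notin S -> exists l, holo_at phi p l) ->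
  exists H1 H2 W1 W2, [/\ cprim (fun x => phi (x +i* (-1))) H1,
    cprim (fun x => phi (x +i* 1)) H2, cprim (fun y => phi ((-1) +i* y)) W1,
    cprim (fun y => phi (1 +i* y)) W2 &
    (H1 1 - H1 (-1)) + 'i * (W2 1 - W2 (-1)) - (H2 1 - H2 (-1)) - 'i * (W1 1 - W1 (-1)) = 0].
Proof.
move=> cphi hphi.
have hx y : exists P, -1 <= y <= 1 -> cprim (fun x => phi (x +i* y)) P.
  have [y1|] := pselect (-1 <= y <= 1); last by exists (fun=> 0).
  have [|P HP] := @cprim_ex (fun x => phi (x +i* y)); last by exists P.
  move=> x x1 e e0; have [|d d0 Hd] := cphi (x +i* y) _ e e0; first by [].
  exists d => // t t1 tx; apply: Hd; first by [].
  by rewrite (_ : _ - _ = (t - x)%:C) ?modc_real//; apply: complex_eq => //=; rewrite subrr.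
have hy x : exists P, -1 <= x <= 1 -> cprim (fun y => phi (x +i* y)) P.
  have [x1|] := pselect (-1 <= x <= 1); last by exists (fun=> 0).
  have [|P HP] := @cprim_ex (fun y => phi (x +i* y)); last by exists P.
  move=> y y1 e e0; have [|d d0 Hd] := cphi (x +i* y) _ e e0; first by [].
  exists d => // t t1 ty; apply: Hd; first by [].
  rewrite (_ : _ - _ = 'i * (t - y)%:C) ?normcM ?modci ?mul1r ?modc_real//.
  by apply: complex_eq => /=; lra.
have [H HH] := @choice _ _ (fun y P => -1 <= y <= 1 -> cprim (fun x => phi (x +i* y)) P) hx.
have [W HW] := @choice _ _ (fun x P => -1 <= x <= 1 -> cprim (fun y => phi (x +i* y)) P) hy.
exists (H (-1)), (H 1), (W (-1)), (W 1).
split; [by apply: HH; lra|by apply: HH; lra|by apply: HW; lra|by apply: HW; lra|].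
apply: (@rect_int_eq0 phi H W HH HW S (-1) 1 (-1) 1) => //; try lra.
by move=> x y xx yy xS; apply: hphi.
Qed.

End Contour.

(** * Divided differences *)

Section DividedDifference.
Context {R : realType}.
Implicit Types (phi : R[i] -> R[i]) (z p v l : R[i]).

(** Here [l] is meant to be the derivative at [v]. This makes the quotient continuous at [v], but
    its differentiability there is not known beforehand, so [v] becomes an exceptional point for
    Goursat's theorem. *)
Definition dquot phi v l z := if z == v then l else (phi z - phi v) / (z - v).

Lemma dquot_at phi v l : dquot phi v l v = l.
Proof. by rewrite /dquot eqxx. Qed.

Lemma dquotM phi v l z : dquot phi v l z * (z - v) = phi z - phi v.
Proof.
rewrite /dquot; case: eqVneq => [->|zv]; first by rewrite !subrr mulr0.
by rewrite divfK// subr_eq0.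
Qed.

Lemma dquot_cont_at phi v l : holo_at phi v l -> cont_at (dquot phi v l) v.
Proof.
move=> H e e0; have [d d0 Hd] := H e e0; exists d => // z Qz zd.
have := Hd z Qz zd; rewrite dquot_at -(dquotM phi v l) -mulrBl normcM.
have [->|zv] := eqVneq z v; first by move=> _; rewrite dquot_at subrr normc0 ltW.
by rewrite ler_pM2r// modc_gt0 subr_eq0.
Qed.

Lemma dquotB phi v l z p : z != v -> p != v ->
  dquot phi v l z - dquot phi v l p =
  (phi z - phi p - dquot phi v l p * (z - p)) / (z - v).
Proof.
move=> zv pv; rewrite /dquot (negbTE zv) (negbTE pv).
by field; rewrite !subr_eq0 zv pv.
Qed.

Let near_neq p v : p != v ->
  exists2 d : R, 0 < d & forall z, modc (z - p) < d -> modc (p - v) / 2 <= modc (z - v).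
Proof.
move=> pv; exists (modc (p - v) / 2) => [|z zp].
  by rewrite divr_gt0// modc_gt0 subr_eq0.
have := modc_triangle z p v; rewrite [modc (p - z)]modcB; lra.
Qed.

Let near_neq0 p v z : p != v -> modc (p - v) / 2 <= modc (z - v) -> z != v.
Proof.
move=> pv; apply: contraTneq => ->; rewrite subrr normc0 -ltNge.
by rewrite divr_gt0// modc_gt0 subr_eq0.
Qed.

Lemma dquot_cont phi v l p : p != v -> cont_at phi p -> cont_at (dquot phi v l) p.
Proof.
move=> pv H e e0; have [d1 d10 H1] := near_neq pv.
set m := modc (p - v) in H1; set q := dquot phi v l p.
have m0 : 0 < m by rewrite modc_gt0 subr_eq0.
have q0 : 0 < 1 + modc q by rewrite ltr_wpDr// modc_ge0.
(* The denominator [z - v] is at least [m / 2] in modulus, and the numerator has two error terms. *)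
pose e' := e * m / 4; have e'0 : 0 < e' by rewrite divr_gt0// mulr_gt0.
have [d2 d20 H2] := H e' e'0.
exists (Num.min d1 (Num.min d2 (e' / (1 + modc q)))).
  by rewrite !lt_min d10 d20 divr_gt0.
move=> z Qz; rewrite !lt_min => /and3P[z1 z2 z3].
have zm := H1 z z1; have zv := near_neq0 pv zm.
rewrite dquotB// normcM normcV ler_pdivrMr ?modc_gt0 ?subr_eq0//.
apply: (@le_trans _ _ (e * (m / 2))); last by rewrite ler_pM2l.
have -> : e * (m / 2) = e' + e' by rewrite /e'; field.
apply: (le_trans (le_modcB _ _)); apply: lerD; first exact: H2.
rewrite normcM -/q; rewrite ltr_pdivlMr// in z3; apply: le_trans (ltW z3).
by rewrite [leLHS]mulrC ler_wpM2l ?modc_ge0// lerDr.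
Qed.

Lemma dquot_holo phi v l p l' : p != v -> holo_at phi p l' ->
  holo_at (dquot phi v l) p ((l' - dquot phi v l p) / (p - v)).
Proof.
move=> pv H e e0; have [d1 d10 H1] := near_neq pv.
set m := modc (p - v) in H1; set q := dquot phi v l p.
have m0 : 0 < m by rewrite modc_gt0 subr_eq0.
pose e' := e * m / 4; have e'0 : 0 < e' by rewrite divr_gt0// mulr_gt0.
have [d2 d20 H2] := H e' e'0.
pose K := modc ((l' - q) / (p - v)).
have K0 : 0 < 1 + K by rewrite ltr_wpDr// modc_ge0.
exists (Num.min d1 (Num.min d2 (e' / (1 + K)))).
  by rewrite !lt_min d10 d20 divr_gt0.
move=> z Qz; rewrite !lt_min => /and3P[z1 z2 z3].
have zm := H1 z z1; have zv := near_neq0 pv zm.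
rewrite dquotB// -/q.
have -> : (phi z - phi p - q * (z - p)) / (z - v) - (l' - q) / (p - v) * (z - p) =
  (phi z - phi p - l' * (z - p) + (l' - q) / (p - v) * (z - p) * (p - z)) / (z - v).
  by field; rewrite !subr_eq0 zv pv.
rewrite normcM normcV ler_pdivrMr ?modc_gt0 ?subr_eq0//.
rewrite [leRHS]mulrAC; apply: (@le_trans _ _ (e * (m / 2) * modc (z - p))); last first.
  by rewrite ler_wpM2r ?modc_ge0// ler_pM2l.
have -> : e * (m / 2) * modc (z - p) = e' * modc (z - p) + e' * modc (z - p).
  by rewrite /e'; field.
apply: (le_trans (le_normcD _ _)); apply: lerD; first exact: H2.
rewrite normcM [X in X * _]normcM -/K [modc (p - z)]modcB ler_wpM2r ?modc_ge0//.
rewrite ltr_pdivlMr// in z3; apply: le_trans (ltW z3).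
by rewrite [leLHS]mulrC ler_wpM2l ?modc_ge0// lerDr.
Qed.

Lemma cont_scale phi p c : cont_at phi p -> cont_at (fun z => c * phi z) p.
Proof.
move=> H e e0.
have c0 : 0 < 1 + modc c by rewrite ltr_wpDr// modc_ge0.
have [|d d0 Hd] := H (e / (1 + modc c)); first by rewrite divr_gt0.
exists d => // z Qz zd; rewrite -mulrBr normcM.
apply: (@le_trans _ _ ((1 + modc c) * modc (phi z - phi p))).
  by rewrite ler_wpM2r ?modc_ge0// lerDr.
by rewrite mulrC -ler_pdivlMr// Hd.
Qed.

Lemma holo_scale phi p c l : holo_at phi p l -> holo_at (fun z => c * phi z) p (c * l).
Proof.
move=> H e e0.
have c0 : 0 < 1 + modc c by rewrite ltr_wpDr// modc_ge0.
have [|d d0 Hd] := H (e / (1 + modc c)); first by rewrite divr_gt0.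
exists d => // z Qz zd; rewrite -mulrBr -mulrA -mulrBr normcM.
apply: (@le_trans _ _ ((1 + modc c) * modc (phi z - phi p - l * (z - p)))).
  by rewrite ler_wpM2r ?modc_ge0// lerDr.
by rewrite mulrC -ler_pdivlMr// mulrAC Hd.
Qed.

End DividedDifference.

Section WeakMaximum.
Context {R : realType}.
Implicit Types (phi : R[i] -> R[i]) (z p v u q : R[i]).

Lemma inv_conj u : u^-1 = (Re u -i* Im u) * (((modc u) ^+ 2)^-1)%:C.
Proof.
case: u => a b; rewrite sqr_modc /=.
by apply: complex_eq; rewrite ?cReM ?cImM /=; rewrite ?mulr0 ?subr0 ?add0r ?addr0// mulNr.
Qed.

(** Up to a positive factor, [(1 - q) / u] is the conjugate of [u] plus an error of modulus at most
    3/20, less than the 1/2 that decides the sign. *)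
Let side q u : 0 < modc u <= 3 -> modc q <= 20^-1 ->
  [/\ Im u <= - (1/2) -> 0 < Im ((1 - q) / u), 1/2 <= Re u -> 0 < Re ((1 - q) / u),
    1/2 <= Im u -> Im ((1 - q) / u) < 0 & Re u <= - (1/2) -> Re ((1 - q) / u) < 0].
Proof.
move=> /andP[u0 u3] q20.
have n0 : 0 < (modc u ^+ 2)^-1 by rewrite invr_gt0 exprn_gt0.
have ju : modc (Re u -i* Im u) = modc u.
  by apply/eqP; rewrite -(@eqrXn2 _ 2)// ?modc_ge0// !sqr_modc /= sqrrN.
have qu : modc (q * (Re u -i* Im u)) <= 20^-1 * 3.
  by rewrite normcM ju ler_pM ?modc_ge0.
have H1 := le_trans (Re_le_modc _) qu; have H2 := le_trans (Im_le_modc _) qu.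
move: H1 H2; rewrite !ler_norml => /andP[H1 H2] /andP[H3 H4].
have E : (1 - q) / u = (Re u -i* Im u - q * (Re u -i* Im u)) * ((modc u ^+ 2)^-1)%:C.
  by rewrite inv_conj mulrA mulrBl mul1r.
rewrite E !cReM !cImM /= !mulr0 subr0 add0r; split=> h.
- by rewrite pmulr_lgt0// cImD cImN /=; lra.
- by rewrite pmulr_lgt0// cReD cReN /=; lra.
- by rewrite pmulr_llt0// cImD cImN /=; lra.
- by rewrite pmulr_llt0// cReD cReN /=; lra.
Qed.

Definition square_bd z := unit_square z /\ [\/ Re z = -1, Re z = 1, Im z = -1 | Im z = 1].

Lemma dist_square_bd z v : square_bd z -> `|Re v| <= 1/2 -> `|Im v| <= 1/2 -> 1/2 <= modc (z - v).
Proof.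
move=> [_ bd] /ler_normlP[a b] /ler_normlP[c d].
have := Re_le_modc (z - v); have := Im_le_modc (z - v).
rewrite cReD cImD cReN cImN !ler_norml => /andP[h1 h2] /andP[h3 h4].
by case: bd => E; rewrite E in h1 h2 h3 h4; lra.
Qed.

(* A maximum principle up to the factor 20 suffices. If [phi v] were larger, then
   [1 - phi z / phi v] would be close to 1 on the boundary of the square, and
   the integral of [(1 - phi z / phi v) / (z - v)] along it, which vanishes by
   Goursat's theorem, would have a positive imaginary part. *)
Lemma weak_maximum phi (S : seq R[i]) (M : R) v :
  (forall p, unit_square p -> cont_at phi p) ->
  (forall p, unit_square p -> p \notin S -> exists l, holo_at phi p l) ->
  (forall z, square_bd z -> modc (phi z) <= M) ->
  `|Re v| <= 1/2 -> `|Im v| <= 1/2 -> v \notin S -> modc (phi v) <= 20 * M.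
Proof.
move=> cphi hphi bM v1 v2 vS; rewrite leNgt; apply/negP => big.
have M0 : 0 <= M.
  apply: le_trans (modc_ge0 (phi (1 +i* 1))) (bM _ _).
  by split; [split => /=; lra|constructor 2].
have vQ : unit_square v.
  by move: v1 v2; rewrite !ler_norml => /andP[? ?] /andP[? ?]; split; lra.
have c0 : 0 < modc (phi v) by apply: le_lt_trans big; rewrite mulr_ge0.
have cN : phi v != 0 by rewrite -modc_gt0.
have [l hl] := hphi v vQ vS.
(* Off [v] this is [(1 - phi z / phi v) / (z - v)]. *)
pose psi z := - (phi v)^-1 * dquot phi v l z.
have [||H1 [H2 [W1 [W2 [h1 h2 w1 w2 E]]]]] := @goursat R psi (v :: S).
- move=> p Qp; apply: cont_scale.
  have [->|pv] := eqVneq p v; first exact: dquot_cont_at.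
  by apply: dquot_cont => //; exact: cphi.
- move=> p Qp; rewrite inE negb_or => /andP[pv pS].
  have [l' hl'] := hphi p Qp pS.
  by eexists; apply: holo_scale; apply: dquot_holo hl'.
have psiE z : square_bd z -> [/\ Im (z - v) <= - (1/2) -> 0 < Im (psi z),
    1/2 <= Re (z - v) -> 0 < Re (psi z),
    1/2 <= Im (z - v) -> Im (psi z) < 0 & Re (z - v) <= - (1/2) -> Re (psi z) < 0].
  move=> bd; have zv := dist_square_bd bd v1 v2.
  have u0 : 0 < modc (z - v) by lra.
  have zNv : z != v by rewrite -subr_eq0 -modc_gt0.
  have -> : psi z = (1 - phi z / phi v) / (z - v).
    by rewrite /psi /dquot (negbTE zNv); field; rewrite subr_eq0 zNv cN.
  apply: side.
    rewrite u0/=; apply: (le_trans (modc_le_ReIm _)); rewrite cReD cReN cImD cImN.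
    case: bd => -[a b] _.
    have : `|Re z - Re v| <= 3/2 by move: v1; rewrite !ler_norml; lra.
    have : `|Im z - Im v| <= 3/2 by move: v2; rewrite !ler_norml; lra.
    lra.
  rewrite normcM normcV ler_pdivrMr//; have := bM z bd; lra.
move: v1 v2; rewrite !ler_norml => /andP[v1 v1'] /andP[v2 v2'].
have o : (-1 : R) <= 1 by lra.
(* Each side integral is twice the integrand at some point of the side, with the sign given by
   [psiE]: all four sides contribute positively to the imaginary part. *)
have [c1 c1r e1] := @mvt R (Im \o H1) (fun x => Im (psi (x +i* (-1)))) (-1) 1 o (fun x hx => (h1 x hx).2).
have [c2 c2r e2] := @mvt R (Im \o H2) (fun x => Im (psi (x +i* 1))) (-1) 1 o (fun x hx => (h2 x hx).2).
have [d1 d1r f1] := @mvt R (Re \o W1) (fun x => Re (psi ((-1) +i* x))) (-1) 1 o (fun x hx => (w1 x hx).1).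
have [d2 d2r f2] := @mvt R (Re \o W2) (fun x => Re (psi (1 +i* x))) (-1) 1 o (fun x hx => (w2 x hx).1).
have [|A1 _ _ _] := psiE (c1 +i* (-1)); first by split; [split => /=; lra|constructor 3].
have [|_ _ A2 _] := psiE (c2 +i* 1); first by split; [split => /=; lra|constructor 4].
have [|_ _ _ B1] := psiE ((-1) +i* d1); first by split; [split => /=; lra|constructor 1].
have [|_ B2 _ _] := psiE (1 +i* d2); first by split; [split => /=; lra|constructor 2].
have {}A1 : 0 < Im (psi (c1 +i* (-1))) by apply: A1; rewrite cImD cImN /=; lra.
have {}A2 : Im (psi (c2 +i* 1)) < 0 by apply: A2; rewrite cImD cImN /=; lra.
have {}B1 : Re (psi ((-1) +i* d1)) < 0 by apply: B1; rewrite cReD cReN /=; lra.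
have {}B2 : 0 < Re (psi (1 +i* d2)) by apply: B2; rewrite cReD cReN /=; lra.
have := congr1 (@complex.Im R) E.
rewrite !(cImD, cImN, cImM, cReD, cReN) /=; rewrite /= in e1 e2 f1 f2.
clear -e1 e2 f1 f2 A1 A2 B1 B2.
lra.
Qed.

End WeakMaximum.

(* Locked, as [6720] is a unary numeral. *)
Definition taylor_const {R : realType} : R := locked 6720.

Lemma taylor_const_ge0 {R : realType} : 0 <= taylor_const :> R.
Proof. by rewrite /taylor_const -lock; exact: ler0n. Qed.

Section CauchyEstimates.
Context {R : realType}.
Implicit Types (phi : R[i] -> R[i]) (z p v w : R[i]).

Variables (phi : R[i] -> R[i]) (M : R).
Hypothesis hphi : forall p, unit_square p -> exists l, holo_at phi p l.
Hypothesis phiM : forall z, unit_square z -> modc (phi z) <= M.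

Let M0 : 0 <= M.
Proof. by apply: le_trans (modc_ge0 _) (phiM (z := 0) _); split => /=; lra. Qed.

Let Q0 : unit_square (0 : R[i]). Proof. by split => /=; lra. Qed.

Let half w : modc w <= 1/2 -> [/\ `|Re w| <= 1/2, `|Im w| <= 1/2 & unit_square w].
Proof.
move=> h; have h1 := le_trans (Re_le_modc w) h; have h2 := le_trans (Im_le_modc w) h.
by split => //; move: h1 h2; rewrite !ler_norml => /andP[? ?] /andP[? ?]; split; lra.
Qed.

Let cphi p : unit_square p -> cont_at phi p.
Proof. by move=> /hphi[l /holo_cont]. Qed.

(** On the boundary the quotient is at most [2 * M] over 1/2; the maximum principle, with 0 as
    exceptional point, multiplies this by 20. *)
Let dquot_bound l w : holo_at phi 0 l -> modc w <= 1/2 -> w != 0 ->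
  modc (dquot phi 0 l w) <= 80 * M.
Proof.
move=> hl wh w0; have [w1 w2 wQ] := half wh.
have -> : 80 * M = 20 * (4 * M) by ring.
apply: (@weak_maximum R _ [:: 0]) => //.
- move=> p Qp; have [->|p0] := eqVneq p 0; first exact: dquot_cont_at.
  exact/dquot_cont/cphi.
- move=> p Qp; rewrite inE => p0; have [l' hl'] := hphi Qp.
  by eexists; apply: dquot_holo hl'.
- move=> z bd; have := dist_square_bd (v := 0) bd; rewrite /= normr0.
  move=> /(_ ltac:(lra) ltac:(lra)); rewrite subr0 => z2.
  have z0 : 0 < modc z by lra.
  have zN : z != 0 by rewrite -modc_gt0.
  rewrite /dquot (negbTE zN) subr0 normcM normcV ler_pdivrMr//.
  apply: (@le_trans _ _ (2 * M)).
    by apply: (le_trans (le_modcB _ _)); have := phiM bd.1; have := phiM Q0; lra.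
  have : M * (1/2) <= M * modc z by rewrite ler_wpM2l.
  lra.
- by rewrite inE.
Qed.

(** The bound on the divided difference passes to its value at 0, approached along small positive
    reals. *)
Lemma cauchy_deriv l : holo_at phi 0 l -> modc l <= 80 * M.
Proof.
move=> hl; apply/ler_addgt0Pr => e e0; have [d d0 Hd] := dquot_cont_at hl e0.
pose s := Num.min (d / 2) (1/2) : R.
have s0 : 0 < s by rewrite lt_min !divr_gt0.
have sd : s <= d / 2 by rewrite ge_min lexx.
have s1 : s <= 1/2 by rewrite ge_min lexx orbT.
have ms : modc (s%:C) = s by rewrite modc_real gtr0_norm.
have sN : s%:C != 0 by rewrite -modc_gt0 ms.
have := @dquot_bound l s%:C hl; rewrite ms => /(_ s1 sN) H.
have H' : modc (dquot phi 0 l s%:C - l) <= e.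
  rewrite -[X in _ - X](dquot_at phi 0); apply: Hd; last by rewrite subr0 ms; lra.
  by have [] := @half s%:C; rewrite ?ms.
have := le_dist_modc l (dquot phi 0 l s%:C); rewrite modcB; lra.
Qed.

Lemma cauchy_lip w : modc w <= 1/2 -> modc (phi w - phi 0) <= 80 * M * modc w.
Proof.
have [l hl] := hphi Q0; have [->|w0] := eqVneq w 0.
  by move=> _; rewrite subrr normc0 mulr0.
move=> wh; rewrite -(dquotM phi 0 l) subr0 normcM ler_wpM2r ?modc_ge0//.
exact: dquot_bound.
Qed.

(** The remainder is [w ^+ 2] times the value at 0 of the second divided difference [k], taken at 0
    and then at [w]. Since 0 is exceptional, the maximum principle is applied at a nearby real
    point, and continuity of [k] concludes. *)
Lemma cauchy_taylor2 l w : holo_at phi 0 l -> modc w <= 1/2 ->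
  modc (phi w - phi 0 - l * w) <= taylor_const * M * modc w ^+ 2.
Proof.
rewrite /taylor_const -lock.
move=> hl wh; have [->|w0] := eqVneq w 0.
  by rewrite mulr0 !subrr normc0 expr0n mulr0.
have [w1 w2 wQ] := half wh.
pose h := dquot phi 0 l.
have [lw hlw] := hphi wQ.
have hhw : holo_at h w ((lw - h w) / (w - 0)) by apply: dquot_holo hlw.
set lh := _ / _ in hhw.
have hw : modc (h w) <= 80 * M by apply: dquot_bound.
pose k := dquot h w lh.
have ch p : unit_square p -> cont_at h p.
  move=> Qp; have [->|p0] := eqVneq p 0; first exact: dquot_cont_at.
  exact/dquot_cont/cphi.
have ck p : unit_square p -> cont_at k p.
  move=> Qp; have [->|pw] := eqVneq p w; first exact: dquot_cont_at.
  exact/dquot_cont/ch.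
(* On the boundary [h] is at most [4 * M], while [h w] is at most [80 * M]. Division by at least 1/2
   gives [168 * M], and a factor 2 is to spare; the constant 6720 is [20 * 168 * 2]. *)
have kb z : square_bd z -> modc (k z) <= 168 * M * 2.
  move=> bd; have zw := dist_square_bd bd w1 w2.
  have := dist_square_bd (v := 0) bd; rewrite /= normr0.
  move=> /(_ ltac:(lra) ltac:(lra)); rewrite subr0 => z2.
  have z0 : 0 < modc z by lra.
  have zN : z != 0 by rewrite -modc_gt0.
  have zw0 : 0 < modc (z - w) by lra.
  have zwN : z != w by rewrite -subr_eq0 -modc_gt0.
  have hz : modc (h z) <= 4 * M.
    rewrite /h /dquot (negbTE zN) subr0 normcM normcV ler_pdivrMr//.
    apply: (@le_trans _ _ (2 * M)).
      by apply: (le_trans (le_modcB _ _)); have := phiM bd.1; have := phiM Q0; lra.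
    have : M * (1/2) <= M * modc z by rewrite ler_wpM2l.
    lra.
  rewrite /k /dquot (negbTE zwN) normcM normcV ler_pdivrMr//.
  apply: (@le_trans _ _ (84 * M)); first by apply: (le_trans (le_modcB _ _)); lra.
  have : M * (1/2) <= M * modc (z - w) by rewrite ler_wpM2l.
  have := M0; lra.
have k0 : modc (k 0) <= 6720 * M.
  apply/ler_addgt0Pr => e e0; have [d d0 Hd] := ck 0 Q0 e e0.
  pose s0 := Num.min (d / 2) (1/2) : R.
  have s00 : 0 < s0 by rewrite lt_min !divr_gt0.
  have sd : s0 <= d / 2 by rewrite ge_min lexx.
  have s1 : s0 <= 1/2 by rewrite ge_min lexx orbT.
  (* The point must also avoid the other exceptional point: one of [s0] and [s0 / 2] does. *)
  have [s [sp ss sw]] : exists s : R, [/\ 0 < s, s <= s0 & s%:C != w].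
    have [E|] := eqVneq s0%:C w; last by exists s0.
    exists (s0 / 2); split; [lra|lra|rewrite -E].
    by apply/eqP => -[]; lra.
  have ms : modc (s%:C) = s by rewrite modc_real gtr0_norm.
  have sN : s%:C != 0 by rewrite -modc_gt0 ms.
  have [sq1 sq2 sQ] : [/\ `|Re s%:C| <= 1/2, `|Im s%:C| <= 1/2 & unit_square s%:C].
    by apply: half; rewrite ms; lra.
  have : modc (k s%:C) <= 20 * (168 * M * 2).
    apply: (@weak_maximum R _ [:: 0; w]) => //.
      move=> p Qp; rewrite !inE negb_or => /andP[p0 pw].
      have [l' hl'] := hphi Qp.
      by eexists; apply: dquot_holo => //; apply: dquot_holo hl'.
    by rewrite !inE negb_or sN.
  have : modc (k s%:C - k 0) <= e by apply: Hd => //; rewrite subr0 ms; lra.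
  have := le_dist_modc (k 0) (k s%:C); rewrite modcB; lra.
have -> : phi w - phi 0 - l * w = k 0 * (0 - w) * (0 - w).
  have hE := dquotM phi 0 l w; rewrite subr0 in hE.
  by rewrite /k dquotM -hE /h dquot_at; ring.
by rewrite sub0r !normcM normcN -mulrA -expr2 ler_wpM2r// sqr_ge0.
Qed.

End CauchyEstimates.

(** * Holomorphic functions of two variables *)

Section ComplexTopology.
Context {R : realType}.

Lemma normcC (z : R[i]) : `|z| = (modc z)%:C.
Proof. by case: z. Qed.

Lemma ltc_real (x y : R) : (x%:C < y%:C) = (x < y).
Proof. by rewrite ltcE /= eqxx. Qed.

Lemma lec_real (x y : R) : (x%:C <= y%:C) = (x <= y).
Proof. by rewrite lecE /= eqxx. Qed.

Lemma gt0_realC (e : R[i]) : 0 < e -> exists2 r : R, 0 < r & e = r%:C.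
Proof.
case: e => a b; rewrite ltcE /= => /andP[/eqP bE a0].
by exists a => //; rewrite bE.
Qed.

Lemma nbhs_complexP (z : R[i]) (A : set R[i]) : nbhs z A <->
  exists2 d : R, 0 < d & forall w, modc (w - z) < d -> A w.
Proof.
split=> [/nbhs_ballP[e /= e0 H]|[d d0 H]].
  have [r r0 E] := gt0_realC e0; exists r => // w wz; apply: H.
  by rewrite /ball /= E normcC ltc_real modcB.
apply/nbhs_ballP; exists d%:C => /=; first by rewrite ltc_real.
by move=> w; rewrite /ball /= normcC ltc_real modcB; exact: H.
Qed.

Lemma nbhs_complex2P (p : R[i] * R[i]) (A : set (R[i] * R[i])) : nbhs p A <->
  exists2 d : R, 0 < d & forall q, modc (q.1 - p.1) < d -> modc (q.2 - p.2) < d -> A q.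
Proof.
split=> [/nbhs_ballP[e /= e0 H]|[d d0 H]].
  have [r r0 E] := gt0_realC e0; exists r => // w wz wz'; apply: H.
  by split; rewrite /ball /= E normcC ltc_real modcB.
apply/nbhs_ballP; exists d%:C => /=; first by rewrite ltc_real.
move=> w [/= h1 h2]; apply: H; rewrite modcB -ltc_real -normcC; [exact: h1|exact: h2].
Qed.

Implicit Types (f : R[i] * R[i] -> R[i]) (p q : R[i] * R[i]) (a b : R[i]).

Definition cdiff f p a b := forall e : R, 0 < e -> exists2 d : R, 0 < d &
  forall v1 v2, modc v1 + modc v2 < d ->
    modc (f (p.1 + v1, p.2 + v2) - f p - (a * v1 + b * v2)) <= e * (modc v1 + modc v2).

Definition clin2 a b (v : R[i] * R[i]) : R[i] := a * v.1 + b * v.2.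

Lemma clin2_linear a b : linear (clin2 a b).
Proof.
move=> k [u1 u2] [v1 v2]; rewrite /clin2 /=.
rewrite -[X in _ = X + _]/(k * (a * u1 + b * u2)).
rewrite -[k *: u1]/(k * u1) -[k *: u2]/(k * u2); ring.
Qed.

HB.instance Definition _ a b := GRing.isLinear.Build R[i] (R[i] * R[i])%type R[i] *:%R
  (clin2 a b) (clin2_linear a b).

Lemma clin2_cont a b : continuous (clin2 a b).
Proof.
move=> x; apply: cvgD; apply: cvgMr; [exact: cvg_fst|exact: cvg_snd].
Qed.

Lemma norm_pairC (v : R[i] * R[i]) : `|v| = (Num.max (modc v.1) (modc v.2))%:C.
Proof.
by rewrite prod_normE !normcC /Order.max ltc_real; case: ifP.
Qed.

(** [a] and [b] are the values of the differential on the basis vectors. The converse loses a factor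
    2 between the sum of moduli in [cdiff] and the maximum in the product norm. *)
Lemma differentiableC2P f p : differentiable f p <-> exists a b, cdiff f p a b.
Proof.
split=> [df|[a [b H]]].
  have /diff_locallyP [cont /eqaddoP H] := df.
  exists ('d f p (1, 0)), ('d f p (0, 1)) => e e0.
  have e0' : 0 < e%:C by rewrite ltc_real.
  have := H _ e0' => /nbhs_complex2P[d d0 Hd]; exists d => // v1 v2 vd.
  have := Hd (v1, v2) => /=; rewrite !subr0.
  have v1d : modc v1 < d by apply: le_lt_trans vd; rewrite lerDl modc_ge0.
  have v2d : modc v2 < d by apply: le_lt_trans vd; rewrite lerDr modc_ge0.
  move=> /(_ v1d v2d).
  rewrite norm_pairC -[X in `|X|]/(f ((v1, v2) + p) - (f p + 'd f p (v1, v2))).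
  rewrite normcC -rmorphM lec_real => h.
  have -> : 'd f p (1, 0) * v1 + 'd f p (0, 1) * v2 = 'd f p (v1, v2).
    rewrite (_ : (v1, v2) = v1 *: (1, 0) + v2 *: (0, 1)).
      by rewrite linearP linearZ /= -![_ *: _]/(_ * _) mulrC [X in _ + X]mulrC.
    by congr pair; rewrite /= ?scaler0 ?addr0 ?add0r -[_ *: _]/(_ * _) mulr1.
  rewrite -addrA -opprD; apply: (le_trans _ (le_trans h _)).
    by rewrite -[p.1 + v1]/(p.1 + (v1, v2).1) -[p.2 + v2]/(p.2 + (v1, v2).2) [_ + p]addrC.
  by rewrite ler_pM2l// ge_max lerDl lerDr !modc_ge0.
have cl := @clin2_cont a b.
have fo : f \o shift p = cst (f p) + clin2 a b +o_ (0 : R[i] * R[i]) id.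
  apply/eqaddoP => e e0; have [r r0 ->] := gt0_realC e0.
  have [|d d0 Hd] := H (r / 2); first by rewrite divr_gt0.
  apply/nbhs_complex2P; exists (d / 2); first by rewrite divr_gt0.
  move=> [v1 v2] /=; rewrite !subr0 => h1 h2.
  have := Hd v1 v2 (_ : _ < d) => /(_ ltac:(lra)).
  rewrite norm_pairC -[X in `|X|]/(f ((v1, v2) + p) - (f p + clin2 a b (v1, v2))).
  rewrite normcC -rmorphM lec_real => h.
  have -> : f ((v1, v2) + p) = f (p.1 + v1, p.2 + v2).
    by congr f; rewrite addrC; case: (p).
  rewrite opprD addrA; apply: (le_trans h) => /=.
  rewrite -mulrA ler_pM2l// mulrC ler_pdivrMr//.
  by case: (leP (modc v1) (modc v2)); lra.
apply/diff_locallyP; rewrite (diff_unique cl fo).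
by split.
Qed.

End ComplexTopology.

(** * Limits along ultrafilters *)

Section UltraLimits.
Context {R : realType} (I : Type) (G : set_system I).
Implicit Types (u w : I -> R[i]) (l m : R[i]).

(* Limits along an ultrafilter [G] replace extractions of subsequences. *)
Definition flim u l := forall e : R, 0 < e -> G [set i | modc (u i - l) < e].

Lemma flim_le {PG : ProperFilter G} u l (B : R) :
  flim u l -> G [set i | modc (u i) <= B] -> modc l <= B.
Proof.
move=> ul uB; apply/ler_addgt0Pr => e e0.
have [i [/= h1 h2]] := filter_ex (filterI (ul e e0) uB).
by have := le_dist_modc l (u i); rewrite modcB; lra.
Qed.

Lemma flim_add {FG : Filter G} u w l m :
  flim u l -> flim w m -> flim (fun i => u i + w i) (l + m).
Proof.
move=> ul wm e e0; have e2 : 0 < e / 2 by rewrite divr_gt0.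
apply: filterS (filterI (ul _ e2) (wm _ e2)) => i [/= h1 h2].
have -> : u i + w i - (l + m) = (u i - l) + (w i - m) by ring.
by apply: le_lt_trans (le_normcD _ _) _; lra.
Qed.

Lemma flim_scale {FG : Filter G} (a : R[i]) u l :
  flim u l -> flim (fun i => a * u i) (a * l).
Proof.
move=> ul e e0.
have a0 : 0 < 1 + modc a by rewrite ltr_wpDr// modc_ge0.
apply: filterS (ul _ (divr_gt0 e0 a0)) => i /= h.
rewrite -mulrBr normcM; apply: (@le_lt_trans _ _ ((1 + modc a) * modc (u i - l))).
  by rewrite ler_wpM2r ?modc_ge0// lerDr.
by rewrite mulrC -ltr_pdivlMr.
Qed.

Lemma flim_opp {FG : Filter G} u l : flim u l -> flim (fun i => - u i) (- l).
Proof. by move=> ul e /ul; apply: filterS => i /=; rewrite -opprD normcN. Qed.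

Lemma flim_sub {FG : Filter G} u w l m :
  flim u l -> flim w m -> flim (fun i => u i - w i) (l - m).
Proof. by move=> ul wm; apply: flim_add => //; exact: flim_opp. Qed.

(** The limit is the supremum of the levels that [u] reaches on a set of [G]. A level above it is
    not reached on a set of [G], so by the ultrafilter property [u] stays below that level on such a
    set. *)
Lemma ultra_real_lim (u : I -> R) (B : R) : UltraFilter G -> (forall i, `|u i| <= B) ->
  exists l : R, forall e, 0 < e -> G [set i | `|u i - l| < e].
Proof.
move=> UG uB; pose A := [set x | G [set i | x <= u i]]; exists (sup A) => e e0.
have AB : A (- B).
  rewrite /A /= (_ : mkset _ = setT); first exact: filterT.
  by apply/seteqP; split => // i _ /=; have := uB i; rewrite ler_norml => /andP[].
have ubA : ubound A B.
  move=> x /= Ax; have [i xi] := filter_ex Ax; apply: (le_trans xi).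
  by have := uB i; rewrite ler_norml => /andP[].
have h1 : G [set i | sup A - e < u i].
  have [|x Ax lx] := @sup_adherent _ A e e0; first by split; [exists (- B)|exists B].
  by apply: filterS Ax => i /=; exact: lt_le_trans.
have h2 : G [set i | u i < sup A + e].
  have [H|] := @in_ultra_setVsetC _ G [set i | sup A + e <= u i] UG; last first.
    by apply: filterS => i /= /negP; rewrite -ltNge.
  have : sup A + e <= sup A by apply: ub_le_sup; [exists B|exact: H].
  by lra.
apply: filterS (filterI h1 h2) => i [/= a b]; rewrite ltr_norml; lra.
Qed.

Lemma ultra_lim u (B : R) : UltraFilter G -> (forall i, modc (u i) <= B) ->
  exists l, flim u l.
Proof.
move=> UG uB.
have [|a Ha] := @ultra_real_lim (fun i => Re (u i)) B UG.
  by move=> i; apply: le_trans (uB i); exact: Re_le_modc.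
have [|b Hb] := @ultra_real_lim (fun i => Im (u i)) B UG.
  by move=> i; apply: le_trans (uB i); exact: Im_le_modc.
exists (a +i* b) => e e0; have e2 : 0 < e / 2 by rewrite divr_gt0.
apply: filterS (filterI (Ha _ e2) (Hb _ e2)) => i [/= h1 h2].
apply: (le_lt_trans (modc_le_ReIm _)); rewrite cReD cImD cReN cImN /=; lra.
Qed.

End UltraLimits.

Section TwoVariables.
Context {R : realType}.
Implicit Types (f g : R[i] * R[i] -> R[i]) (p q : R[i] * R[i]) (a b : R[i]).

Definition bidisc p (r : R) : set (R[i] * R[i]) :=
  [set q | modc (q.1 - p.1) < r /\ modc (q.2 - p.2) < r].

Definition holo_bounded f p (r M : R) := forall q, bidisc p r q ->
  (exists a b, cdiff f q a b) /\ modc (f q) <= M.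

Lemma bidisc_sub p (r : R) q (s : R) : bidisc p (r - s) q -> bidisc q s `<=` bidisc p r.
Proof.
move=> [h1 h2] t [k1 k2]; split.
  by have := modc_triangle q.1 t.1 p.1; lra.
by have := modc_triangle q.2 t.2 p.2; lra.
Qed.

Lemma slice_holo f p v1 v2 (t : R[i]) a b :
  cdiff f (p.1 + t * v1, p.2 + t * v2) a b ->
  holo_at (fun t => f (p.1 + t * v1, p.2 + t * v2)) t (a * v1 + b * v2).
Proof.
move=> H e e0; set s := modc v1 + modc v2.
have s0 : 0 <= s by rewrite addr_ge0 ?modc_ge0.
have s1 : 0 < 1 + s by rewrite ltr_wpDr.
have [d d0 Hd] := H (e / (1 + s)) (divr_gt0 e0 s1).
exists (d / (1 + s)); first by rewrite divr_gt0.
move=> z _; rewrite ltr_pdivlMr// => zt.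
have E : modc ((z - t) * v1) + modc ((z - t) * v2) = modc (z - t) * s.
  by rewrite !normcM -mulrDr.
have zs : modc (z - t) * s <= modc (z - t) * (1 + s).
  by rewrite ler_wpM2l ?modc_ge0// lerDr.
have := Hd ((z - t) * v1) ((z - t) * v2); rewrite E => /(_ (le_lt_trans zs zt)) /=.
have -> : p.1 + t * v1 + (z - t) * v1 = p.1 + z * v1 by ring.
have -> : p.2 + t * v2 + (z - t) * v2 = p.2 + z * v2 by ring.
have -> : a * ((z - t) * v1) + b * ((z - t) * v2) = (a * v1 + b * v2) * (z - t) by ring.
move=> h; apply: (le_trans h); rewrite -mulrA ler_pM2l// mulrC ler_pdivrMr//.
Qed.

Lemma unit_square_modc (t : R[i]) : unit_square t -> modc t <= 2.
Proof.
move=> [/andP[? ?] /andP[? ?]]; apply: (le_trans (modc_le_ReIm _)).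
have : `|Re t| <= 1 by rewrite ler_norml; lra.
have : `|Im t| <= 1 by rewrite ler_norml; lra.
lra.
Qed.

Section Estimates.
Variables (f : R[i] * R[i] -> R[i]) (p : R[i] * R[i]) (r M : R).
Hypotheses (r0 : 0 < r) (fM : holo_bounded f p r M).

Lemma holo_bounded_ge0 : 0 <= M.
Proof.
have [|_] := fM (q := p); first by split; rewrite subrr normc0.
by apply: le_trans; exact: modc_ge0.
Qed.

Let slice v1 v2 := fun t => f (p.1 + t * v1, p.2 + t * v2).

Let slice_in v1 v2 t : modc v1 + modc v2 <= r / 3 -> unit_square t ->
  bidisc p r (p.1 + t * v1, p.2 + t * v2).
Proof.
move=> vr /unit_square_modc t2; have := modc_ge0 v1; have := modc_ge0 v2 => v20 v10.
split; rewrite /= [X in X - _]addrC addrK normcM.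
  by apply: (@le_lt_trans _ _ (2 * modc v1)); [rewrite ler_wpM2r|have := r0; lra].
by apply: (@le_lt_trans _ _ (2 * modc v2)); [rewrite ler_wpM2r|have := r0; lra].
Qed.

Let slice_diff v1 v2 : modc v1 + modc v2 <= r / 3 ->
  (forall t, unit_square t -> exists l, holo_at (slice v1 v2) t l) /\
  (forall t, unit_square t -> modc (slice v1 v2 t) <= M).
Proof.
move=> vr; split=> t Qt; have [[a [b H]] h] := fM (slice_in vr Qt) => //.
by exists (a * v1 + b * v2); apply: slice_holo.
Qed.

Let slice0 v1 v2 : slice v1 v2 0 = f p.
Proof. by rewrite /slice !mul0r !addr0; case: (p). Qed.

Let holo0 v1 v2 a b : cdiff f p a b -> holo_at (slice v1 v2) 0 (a * v1 + b * v2).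
Proof. by move=> H; apply: slice_holo; rewrite !mul0r !addr0; case: (p) H. Qed.

Section Scaled.
Variables v1 v2 : R[i].
Let s := modc v1 + modc v2.
Hypothesis s0 : 0 < s.
(** The slice in direction [k * v] stays in the bidisc for parameters in the unit square, and the
    increment [v] is reached at the parameter [w = 1 / k], of modulus [3 * s / r]. This turns the
    constants 80 and [taylor_const] into [3 * 80 = 240] and [9 * taylor_const]. *)
Let k : R := r / 3 / s.
Let k0 : 0 < k. Proof. by rewrite !divr_gt0. Qed.
Let w : R[i] := (k^-1)%:C.
Let wE : modc w = 3 * s / r.
Proof.
rewrite modc_real gtr0_norm ?invr_gt0// /k !invfM !invrK; field.
by rewrite !gt_eqF.
Qed.
Let kw (v : R[i]) : w * (k%:C * v) = v.
Proof. by rewrite mulrA -rmorphM mulVf ?gt_eqF// mul1r. Qed.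
Let small : modc (k%:C * v1) + modc (k%:C * v2) <= r / 3.
Proof.
rewrite !normcM modc_real -mulrDr gtr0_norm// -/s /k mulfVK// gt_eqF//.
Qed.
Let slicew : slice (k%:C * v1) (k%:C * v2) w = f (p.1 + v1, p.2 + v2).
Proof. by rewrite /slice !kw. Qed.

Lemma linear_part_scaled a b : cdiff f p a b -> modc (a * v1 + b * v2) <= 240 * M * s / r.
Proof.
move=> H; have [H1 H2] := slice_diff small.
have := cauchy_deriv H1 H2 (holo0 (k%:C * v1) (k%:C * v2) H).
rewrite (_ : a * _ + _ = k%:C * (a * v1 + b * v2)); last by ring.
rewrite normcM modc_real gtr0_norm// mulrC -ler_pdivlMr// => /le_trans; apply.
rewrite le_eqVlt; apply/orP; left; apply/eqP; rewrite /k; field; by rewrite !gt_eqF.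
Qed.

Hypothesis sr : s <= r / 6.
Let w2 : modc w <= 1/2. Proof. by rewrite wE ler_pdivrMr//; have := sr; lra. Qed.

Lemma lip_scaled : modc (f (p.1 + v1, p.2 + v2) - f p) <= 240 * M * s / r.
Proof.
have [H1 H2] := slice_diff small; have := cauchy_lip H1 H2 w2.
rewrite slicew slice0 wE => /le_trans; apply.
by rewrite le_eqVlt; apply/orP; left; apply/eqP; ring.
Qed.

Lemma taylor2_scaled a b : cdiff f p a b ->
  modc (f (p.1 + v1, p.2 + v2) - f p - (a * v1 + b * v2)) <= taylor_const * 9 * M * s ^+ 2 / r ^+ 2.
Proof.
move=> H; have [H1 H2] := slice_diff small.
have := cauchy_taylor2 H1 H2 (holo0 (k%:C * v1) (k%:C * v2) H) w2.
rewrite slicew slice0 wE.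
rewrite (_ : (a * _ + _) * w = a * v1 + b * v2); last first.
  have E (x y t c : R[i]) : (a * (c * x) + b * (c * y)) * t = a * (t * (c * x)) + b * (t * (c * y)).
    by ring.
  by rewrite E !kw.
move=> /le_trans; apply; move: (taylor_const : R) => K.
by rewrite le_eqVlt; apply/orP; left; apply/eqP; rewrite !expr_div_n !exprMn; ring.
Qed.

End Scaled.

Let split0 (v1 v2 : R[i]) : modc v1 + modc v2 = 0 \/ 0 < modc v1 + modc v2.
Proof.
have : 0 <= modc v1 + modc v2 by rewrite addr_ge0 ?modc_ge0.
by rewrite le_eqVlt => /orP[/eqP <-|]; [left|right].
Qed.

Let s_eq0 (v1 v2 : R[i]) : modc v1 + modc v2 = 0 -> v1 = 0 /\ v2 = 0.
Proof.
have := modc_ge0 v1; have := modc_ge0 v2 => h1 h2 h3.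
by split; apply: eq0_normc; lra.
Qed.

Lemma holo_linear_part v1 v2 a b : cdiff f p a b ->
  modc (a * v1 + b * v2) <= 240 * M * (modc v1 + modc v2) / r.
Proof.
move=> H; have [/s_eq0[-> ->]|s0] := split0 v1 v2; last exact: linear_part_scaled.
by rewrite !mulr0 addr0 !normc0 addr0 mulr0 mul0r.
Qed.

Lemma holo_lip v1 v2 : modc v1 + modc v2 <= r / 6 ->
  modc (f (p.1 + v1, p.2 + v2) - f p) <= 240 * M * (modc v1 + modc v2) / r.
Proof.
move=> sr; have [/s_eq0[-> ->]|s0] := split0 v1 v2; last exact: lip_scaled.
by rewrite !addr0 normc0 addr0 mulr0 mul0r; case: (p) => x y; rewrite subrr normc0.
Qed.

Lemma holo_taylor2 v1 v2 a b : cdiff f p a b -> modc v1 + modc v2 <= r / 6 ->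
  modc (f (p.1 + v1, p.2 + v2) - f p - (a * v1 + b * v2)) <=
  taylor_const * 9 * M * (modc v1 + modc v2) ^+ 2 / r ^+ 2.
Proof.
move=> H sr; have [/s_eq0[-> ->]|s0] := split0 v1 v2; last exact: taylor2_scaled.
rewrite !addr0 normc0 addr0 expr0n /= !mulr0 mul0r addr0 subr0.
by case: (p) => x y; rewrite subrr normc0.
Qed.

End Estimates.

Lemma cdiff_taylor f p a b (C r : R) : 0 < r -> 0 <= C ->
  (forall v1 v2, modc v1 + modc v2 <= r ->
     modc (f (p.1 + v1, p.2 + v2) - f p - (a * v1 + b * v2)) <=
     C * (modc v1 + modc v2) ^+ 2) -> cdiff f p a b.
Proof.
move=> r0 C0 H e e0; have C1 : 0 < 1 + C by rewrite ltr_wpDr.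
exists (Num.min r (e / (1 + C))); first by rewrite lt_min r0 divr_gt0.
move=> v1 v2; set s := _ + _; rewrite lt_min => /andP[sr se].
apply: (le_trans (H _ _ (ltW sr))); rewrite -/s expr2 mulrA.
rewrite ler_wpM2r ?addr_ge0 ?modc_ge0//.
rewrite ltr_pdivlMr// mulrC in se; apply: le_trans (ltW se).
by rewrite ler_wpM2r ?addr_ge0 ?modc_ge0// lerDr.
Qed.

(** Cauchy's estimates bound the partial derivatives of the [F i] uniformly, so these have limits
    along [G]. The Taylor estimate, whose constant does not depend on [i], passes to the limit and
    identifies them as the partial derivatives of [f]. *)
Lemma holo_limit (I : Type) (G : set_system I) (F : I -> R[i] * R[i] -> R[i]) f p (r M : R) :
  UltraFilter G -> 0 < r -> (forall i, holo_bounded (F i) p r M) ->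
  (forall q, bidisc p r q -> flim G (F^~ q) (f q)) -> exists a b, cdiff f p a b.
Proof.
move=> UG r0 FM Ff.
have pp : bidisc p r p by split; rewrite subrr normc0.
have [A HA] := @choice _ _ (fun i (ab : R[i] * R[i]) => cdiff (F i) p ab.1 ab.2)
  (fun i => let: ex_intro a (ex_intro b H) := (FM i p pp).1 in ex_intro _ (a, b) H).
have [a Ha] : exists a, flim G (fun i => (A i).1) a.
  apply: (@ultra_lim _ _ _ _ (240 * M / r)) => i.
  have := @holo_linear_part _ _ _ _ r0 (FM i) 1 0 _ _ (HA i).
  by rewrite mulr1 mulr0 normc1 normc0 !addr0 mulr1.
have [b Hb] : exists a, flim G (fun i => (A i).2) a.
  apply: (@ultra_lim _ _ _ _ (240 * M / r)) => i.
  have := @holo_linear_part _ _ _ _ r0 (FM i) 0 1 _ _ (HA i).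
  by rewrite mulr1 mulr0 normc1 normc0 !add0r mulr1.
have [i0 _] := filter_ex (@filterT _ G _).
have M0 := holo_bounded_ge0 r0 (FM i0).
exists a, b; apply: (@cdiff_taylor _ _ _ _ (taylor_const * 9 * M / r ^+ 2) (r / 6)).
- by rewrite divr_gt0.
- by rewrite divr_ge0 ?sqr_ge0// !mulr_ge0// taylor_const_ge0.
move=> v1 v2 vr.
have -> : taylor_const * 9 * M / r ^+ 2 * (modc v1 + modc v2) ^+ 2 =
          taylor_const * 9 * M * (modc v1 + modc v2) ^+ 2 / r ^+ 2 by rewrite mulrAC.
apply: (@flim_le _ _ G _ (fun i => F i (p.1 + v1, p.2 + v2) - F i p - ((A i).1 * v1 + (A i).2 * v2))).
  apply: flim_sub; first apply: flim_sub.
  - apply: Ff; have := modc_ge0 v1; have := modc_ge0 v2.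
    by split; rewrite /= [X in X - _]addrC addrK; lra.
  - exact: Ff.
  - apply: flim_add.
      rewrite mulrC (_ : (fun i => _) = fun i => v1 * (A i).1); first exact: flim_scale.
      by apply/funext => i; rewrite mulrC.
    rewrite mulrC (_ : (fun i => _) = fun i => v2 * (A i).2); first exact: flim_scale.
    by apply/funext => i; rewrite mulrC.
apply: filterS filterT => i _ /=; exact: holo_taylor2.
Qed.

Lemma cdiff_shift f p w1 w2 a b : cdiff f (p.1 + w1, p.2 + w2) a b ->
  cdiff (fun q => f (q.1 + w1, q.2 + w2)) p a b.
Proof.
move=> H e /H[d d0 Hd]; exists d => // v1 v2 /Hd /=.
by rewrite ![_ + w1 + v1]addrAC ![_ + w2 + v2]addrAC.
Qed.

Lemma cdiff_lin f g p c a b a' b' : cdiff f p a b -> cdiff g p a' b' ->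
  cdiff (fun q => c * (f q - g q)) p (c * (a - a')) (c * (b - b')).
Proof.
move=> Hf Hg e e0; have c0 : 0 < 1 + modc c by rewrite ltr_wpDr// modc_ge0.
pose e' := e / (1 + modc c) / 2; have e'0 : 0 < e' by rewrite !divr_gt0.
have [d1 d10 H1] := Hf e' e'0; have [d2 d20 H2] := Hg e' e'0.
exists (Num.min d1 d2); first by rewrite lt_min d10.
move=> v1 v2; rewrite lt_min => /andP[h1 h2].
have {}H1 := H1 _ _ h1; have {}H2 := H2 _ _ h2; set s := modc v1 + modc v2 in H1 H2 *.
set X := (X in modc X <= _) in H1; set Y := (Y in modc Y <= _) in H2.
rewrite (_ : _ - _ - _ = c * (X - Y)); last by rewrite /X /Y /=; ring.
rewrite normcM; apply: (@le_trans _ _ ((1 + modc c) * (e' * s + e' * s))).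
  apply: ler_pM; rewrite ?modc_ge0 ?lerDr//.
  by apply: (le_trans (le_modcB _ _)); apply: lerD.
rewrite le_eqVlt; apply/orP; left; apply/eqP; rewrite /e'; field.
by rewrite gt_eqF.
Qed.

Lemma exists_invn_lt (x : R) : 0 < x -> exists N, forall n, (N <= n)%N -> n.+1%:R^-1 < x.
Proof.
move=> x0; exists (Num.bound x^-1) => n Nn.
rewrite invf_plt ?posrE//; apply: (@lt_le_trans _ _ (Num.bound x^-1)%:R).
  by apply: archi_boundP; rewrite invr_ge0 ltW.
by rewrite ler_nat ltnW.
Qed.

(* The derivative is the limit of difference quotients, which are holomorphic. *)
Lemma holo_deriv f g p (r M : R) : 0 < r -> holo_bounded f p r M ->
  (forall q, bidisc p r q -> exists b, cdiff f q (g q) b) -> exists a b, cdiff g p a b.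
Proof.
move=> r0 fM gD.
have [G [UG subG]] := @ultraFilterLemma nat \oo _.
(* [r / 24] keeps the shifted point within the half radius and the step below the [(r / 2) / 6] that
   [holo_lip] asks for. *)
pose h (n : nat) : R := r / 24 * n.+1%:R^-1.
have h0 n : 0 < h n by rewrite mulr_gt0 ?divr_gt0.
have hr n : h n <= r / 24.
  rewrite /h ler_piMr ?invf_le1 ?ler1n ?ltr0Sn//; have := r0; lra.
pose F n q := (h n)^-1%:C * (f (q.1 + (h n)%:C, q.2 + 0) - f q).
have r20 : 0 < r / 2 by rewrite divr_gt0.
apply: (@holo_limit _ G F g p (r / 2) (480 * M / r)) => //.
  move=> n q qp; have qr : bidisc q (r / 2) `<=` bidisc p r.
    by apply: bidisc_sub; rewrite (_ : r - r / 2 = r / 2)//; lra.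
  have fq : holo_bounded f q (r / 2) M by move=> t /qr; exact: fM.
  have mh : modc (h n)%:C = h n by rewrite modc_real gtr0_norm.
  have := hr n => hrn; split.
    have qq : bidisc q (r / 2) (q.1 + (h n)%:C, q.2 + 0).
      by split; rewrite /= [X in X - _]addrC addrK ?normc0// mh; lra.
    have qq' : bidisc q (r / 2) q by split; rewrite subrr normc0.
    have [[a [b ab]] _] := fq _ qq; have [[a' [b' ab']] _] := fq _ qq'.
    by eexists; eexists; apply: cdiff_lin; [apply: cdiff_shift; exact: ab|exact: ab'].
  rewrite /F normcM modc_real gtr0_norm ?invr_gt0//.
  rewrite mulrC ler_pdivrMr//.
  have := @holo_lip _ _ _ _ r20 fq (h n)%:C 0; rewrite normc0 addr0 mh.
  move=> /(_ ltac:(lra))/le_trans; apply.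
  by rewrite le_eqVlt; apply/orP; left; apply/eqP; field; rewrite gt_eqF.
move=> q [qp1 qp2]; have [|b Hb] := gD q; first by split; lra.
move=> e e0; have e2 : 0 < e / 2 by rewrite divr_gt0.
have [d d0 Hd] := Hb _ e2.
have [|N HN] := @exists_invn_lt (d / (r / 24)); first by rewrite !divr_gt0.
apply: subG; exists N => // n /= Nn.
have mh : modc (h n)%:C = h n by rewrite modc_real gtr0_norm.
have hd : h n < d.
  by rewrite /h mulrC -ltr_pdivlMr ?divr_gt0//; exact: HN.
have := Hd (h n)%:C 0; rewrite normc0 addr0 mh mulr0 !addr0 => /(_ hd) H.
have hN : (h n)%:C != 0 :> R[i] by rewrite -modc_gt0 mh.
rewrite (_ : F n q - g q = (h n)^-1%:C * (f (q.1 + (h n)%:C, q.2) - f q - g q * (h n)%:C)).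
  rewrite normcM modc_real gtr0_norm ?invr_gt0// mulrC ltr_pdivrMr//.
  by apply: (le_lt_trans H); rewrite ltr_pM2r//; lra.
by rewrite /F addr0 fmorphV; field.
Qed.

End TwoVariables.

(** * The algebra *)

Section Geometry.
Context {R : realType}.
Implicit Types (p q : R[i] * R[i]) (z : R[i]).

(** [cos] decreases on [0, pi], so the angular condition becomes a cone condition, linear in
    [modc z] and [Re z] and thus accessible to real arithmetic. *)
Lemma abs_arg_lt z (a : R) : z != 0 -> 0 <= a <= 1 ->
  `|arg z| < a = (cos a * modc z < Re z).
Proof.
rewrite -modc_gt0 => z0 /andP[a0 a1].
have : `|Re z / modc z| <= 1.
  by rewrite normrM normfV [`|modc z|]gtr0_norm// ler_pdivrMr// mul1r Re_le_modc.
rewrite ler_norml => /andP[h1 h2].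
have h : -1 <= Re z / modc z <= 1 by rewrite h1 h2.
have -> : `|arg z| = acos (Re z / modc z).
  by rewrite /arg; case: ifP => _; rewrite ?normrN ger0_norm// acos_ge0.
rewrite -ltr_pdivlMr// -[in RHS](@acosK _ (Re z / modc z)) ?in_itv//=.
rewrite ltr_cos// !in_itv/= ?a0 ?acos_ge0 ?acos_lepi//.
by rewrite (le_trans a1)// (le_trans _ (pi_ge2 R))// ler1n.
Qed.

Lemma arg_cond n p : (0 < n)%N -> 0 < modc p.2 ->
  `|arg p.2| < n%:R^-1 = (cos (n%:R^-1) * modc p.2 < Re p.2).
Proof.
move=> n0; rewrite modc_gt0 => p0; apply: abs_arg_lt => //.
by rewrite invr_ge0 ler0n/= invf_le1 ?ltr0n// ler1n.
Qed.

Lemma cos_norm_le1 (x : R) : `|cos x| <= 1.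
Proof. by rewrite ler_norml cos_le1 andbT; exact: cos_geN1. Qed.

Lemma Oset_open e n (x : R) : Oset e n x ->
  exists2 d, 0 < d & forall y, `|y - x| < d -> Oset e n y.
Proof.
case: e => /= [[xn|xn]|xn|xn].
- exists (- n%:R - x); first by lra.
  by move=> y /ltr_normlP[h1 h2]; left => /=; lra.
- exists (x - n%:R); first by lra.
  by move=> y /ltr_normlP[h1 h2]; right => /=; lra.
- exists (- n%:R - x); first by lra.
  by move=> y /ltr_normlP[h1 h2] => /=; lra.
- exists (x - n%:R); first by lra.
  by move=> y /ltr_normlP[h1 h2] => /=; lra.
Qed.

Lemma Oset_shift e n m (x y : R) : (n < m)%N -> Oset e m x -> `|y - x| <= 1 -> Oset e n y.
Proof.
move=> nm; have {}nm : n%:R + 1 <= m%:R :> R by rewrite natr1 ler_nat.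
move=> xO /ler_normlP[h1 h2].
by case: e xO => /= [[]|/=|/=] => xn; [left|right| |] => /=; lra.
Qed.

Lemma bidisc_modc p q (d : R) : bidisc p d q ->
  [/\ modc p.2 - d < modc q.2, modc q.2 < modc p.2 + d, `|Im q.1 - Im p.1| < d,
      `|Re q.1 - Re p.1| < d & `|Re q.2 - Re p.2| < d].
Proof.
move=> [h1 h2].
have := le_dist_modc q.2 p.2; have := le_dist_modc p.2 q.2; rewrite modcB => a1 a2.
have := Re_le_modc (q.1 - p.1); have := Im_le_modc (q.1 - p.1).
have := Re_le_modc (q.2 - p.2); rewrite !(cReD, cReN, cImD, cImN) => b1 b2 b3.
by split; lra.
Qed.

(** Over [Oset e n.+1], which is contained in [Oset e n], the point is in [Bset]; the conical
    conditions matter only elsewhere. *)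
Lemma Vset_intro e n p : (0 < n)%N -> 0 < modc p.2 < n%:R^-1 ->
  `|Im p.1| < n%:R^-1 ->
  (~ Oset e n.+1 (Re p.1) -> cos (n%:R^-1) * modc p.2 < Re p.2 /\
     `|Im p.1| < n%:R^-1 * modc p.2) -> Vset e n p.
Proof.
move=> n0 /andP[p0 pn] ip H.
have [xO|xO] := pselect (Oset e n.+1 (Re p.1)).
  by right; split => //; [exact: Oset_decr|rewrite p0].
by left; have [h1 h2] := H xO; split; rewrite ?p0// arg_cond.
Qed.

Lemma Vset_open e n p : (0 < n)%N -> Vset e n p ->
  exists2 d : R, 0 < d & bidisc p d `<=` Vset e n.
Proof.
move=> n0.
have i0 : 0 < n%:R^-1 :> R by rewrite invr_gt0 ltr0n.
have i1 : n%:R^-1 <= 1 :> R by rewrite invf_le1 ?ltr0n// ler1n.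
case=> -[xO]; last first.
  move=> /andP[p0 pn] ip; have [d d0 Hd] := Oset_open xO.
  exists (Num.min d (Num.min (modc p.2) (Num.min (n%:R^-1 - modc p.2) (n%:R^-1 - `|Im p.1|)))).
    by rewrite !lt_min d0 p0 !subr_gt0 pn ip.
  move=> q /bidisc_modc; set s := Num.min _ _.
  have s1 : s <= d by rewrite /s ge_min lexx.
  have s2 : s <= modc p.2 by rewrite /s !ge_min lexx ?orbT.
  have s3 : s <= n%:R^-1 - modc p.2 by rewrite /s !ge_min lexx ?orbT.
  have s4 : s <= n%:R^-1 - `|Im p.1| by rewrite /s !ge_min lexx ?orbT.
  move=> [h1 h2 h3 h4 h5]; right; split.
  - by apply: Hd; lra.
  - by apply/andP; split; lra.
  - by have := lerB_dist (Im q.1) (Im p.1); lra.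
move=> ar /andP[p0 pn] ip; rewrite arg_cond// in ar.
set i := n%:R^-1 in i0 i1 ar pn ip *.
set g := cos i in ar; have /ler_normlP[g1 g2] : `|g| <= 1 by exact: cos_norm_le1.
pose s := Num.min (modc p.2) (Num.min ((Re p.2 - g * modc p.2) / 2)
  (Num.min (i - modc p.2) ((i * modc p.2 - `|Im p.1|) / 2))).
exists s; first by rewrite !lt_min p0/=; apply/and3P; split; lra.
move=> q /bidisc_modc.
have s2 : s <= modc p.2 by rewrite /s !ge_min lexx ?orbT.
have s3 : s <= (Re p.2 - g * modc p.2) / 2 by rewrite /s !ge_min lexx ?orbT.
have s4 : s <= i - modc p.2 by rewrite /s !ge_min lexx ?orbT.
have s5 : s <= (i * modc p.2 - `|Im p.1|) / 2 by rewrite /s !ge_min lexx ?orbT.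
move=> [h1 h2 h3 /ltr_normlP[h4 h4'] /ltr_normlP[h5 h5']].
have := lerB_dist (Im q.1) (Im p.1) => h6.
have im : i * modc p.2 <= i by rewrite ler_piMr; lra.
have gm : g * modc q.2 <= g * modc p.2 + s.
  by have [g0|g0] := leP 0 g; nra.
have im2 : i * modc p.2 - s <= i * modc q.2 by nra.
apply: Vset_intro; rewrite -/i //; first (by apply/andP; split; lra); first by nra.
by move=> _; split; rewrite -/g; lra.
Qed.

(** In [Aset] the conditions on [arg zeta] and [Im z] scale with the modulus of [zeta], so the gaps
    between 1/n and 1/m and between their cosines leave a margin proportional to it. In [Bset], a
    shift by at most 1 leads from [Oset e m] into [Oset e n]. *)
Lemma Vset_thick e n m : (0 < n)%N -> (n < m)%N -> exists c : R,
  [/\ 0 < c, c <= 1/4 & forall p, Vset e m p -> bidisc p (c * modc p.2) `<=` Vset e n].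
Proof.
move=> n0 nm; have m0 : (0 < m)%N by exact: leq_ltn_trans nm.
have i0 : 0 < n%:R^-1 :> R by rewrite invr_gt0 ltr0n.
have i1 : n%:R^-1 <= 1 :> R by rewrite invf_le1 ?ltr0n// ler1n.
have j0 : 0 < m%:R^-1 :> R by rewrite invr_gt0 ltr0n.
have ji : m%:R^-1 < n%:R^-1 :> R by rewrite ltf_pV2 ?ltr_nat// posrE ltr0n.
have gg : cos (n%:R^-1) < cos (m%:R^-1) :> R.
  have p2 := pi_ge2 R; rewrite ltr_cos// in_itv/=; lra.
have := @arg_cond n; have := @arg_cond m.
have := @Vset_intro e n.
set i := n%:R^-1 in i0 i1 ji gg *; set j := m%:R^-1 in j0 ji gg *.
set g := cos i in gg *; set h := cos j in gg *.
move=> intro argm argn.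
have /ler_normlP[g1 g2] : `|g| <= 1 by exact: cos_norm_le1.
have /ler_normlP[h1 h2] : `|h| <= 1 by exact: cos_norm_le1.
pose c := Num.min ((i - j) / 4) ((h - g) / 4).
have c1 : c <= (i - j) / 4 by rewrite ge_min lexx.
have c2 : c <= (h - g) / 4 by rewrite ge_min lexx orbT.
have c0 : 0 < c by rewrite lt_min; apply/andP; split; lra.
exists c; split => //; first by lra.
move=> p Vp q /bidisc_modc.
have /andP[p0 pj] : 0 < modc p.2 < j by case: Vp => -[].
set x := modc p.2 in p0 pj *; move=> [q1 q2 q3 q4 q5].
have cx : c * x <= c by rewrite ler_piMr; lra.
have cx0 : 0 < c * x by rewrite mulr_gt0.
have cx4 : c * x <= 1/4 * x by rewrite ler_wpM2r; lra.
have := lerB_dist (Im q.1) (Im p.1) => q6.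
have ix : i * x <= i by rewrite ler_piMr; lra.
case: Vp => -[xO]; last first.
  move=> _; rewrite -/j => ip; right; split; rewrite -/i; [|apply/andP; split|].
  2-4: lra.
  by apply: (Oset_shift nm xO); lra.
rewrite argm// -/x -/j => ar _ ip.
have jx : j * x <= j by rewrite ler_piMr; lra.
have gm : g * modc q.2 <= g * x + c * x.
  by have [g0|g0] := leP 0 g; nra.
have im2 : i * x - c * x <= i * modc q.2 by nra.
apply: intro => //; first (by apply/andP; split; nra); first by lra.
move=> _; split; last by nra.
move/ltr_normlP: q5 => [q5 q5']; nra.
Qed.

End Geometry.

Section HspaceTheory.
Context {R : realType} (e : ends).
Implicit Types (p q : R[i] * R[i]) (n : nat).

Lemma cdiff_local (f g : R[i] * R[i] -> R[i]) p a b (d : R) : 0 < d ->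
  (forall q, bidisc p d q -> f q = g q) -> cdiff f p a b -> cdiff g p a b.
Proof.
move=> d0 fg H r /H[d1 d10 H1]; exists (Num.min d d1); first by rewrite lt_min d0.
move=> v1 v2; rewrite lt_min => /andP[h1 h2].
rewrite -!fg; first exact: H1.
- by split; rewrite subrr normc0.
- have := modc_ge0 v1; have := modc_ge0 v2.
  by split; rewrite /= [X in X - _]addrC addrK; lra.
Qed.

Lemma Vset_modc n p : Vset e n p -> 0 < modc p.2 < n%:R^-1.
Proof. by case=> -[]. Qed.

Lemma Vset_modc_lt1 n p : (0 < n)%N -> Vset e n p -> 0 < modc p.2 < 1.
Proof.
move=> n0 /Vset_modc /andP[-> h]; apply: lt_le_trans h _.
by rewrite invf_le1 ?ltr0n// ler1n.
Qed.

Lemma Hspace_cdiff n phi (h : Hspace e n phi) p : Vset e n p ->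
  exists a b, cdiff h p a b.
Proof.
by move=> Vp; apply/differentiableC2P; case: h => h /= /asboolP[H _ _]; exact: H.
Qed.

Lemma Hspace_le n phi (h : Hspace e n phi) p : Vset e n p ->
  modc (h p) <= Hnorm h * phi (Re p.1) / modc p.2 ^+ n.
Proof.
move=> Vp; have /andP[p0 _] := Vset_modc Vp.
have := Hnorm_ge h Vp; rewrite ler_pdivrMr ?weight_gt0// mulrC.
by rewrite -ler_pdivlMr ?exprn_gt0.
Qed.

Lemma Hnorm_le_val n (phi : weight R) (h : Hspace e n phi) (c : R) : 0 <= c ->
  (forall p, Vset e n p -> modc (h p) <= c * phi (Re p.1) / modc p.2 ^+ n) ->
  Hnorm h <= c.
Proof.
move=> c0 H; apply: Hnorm_le => // p Vp; have /andP[p0 _] := Vset_modc Vp.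
rewrite ler_pdivrMr ?weight_gt0// mulrC -ler_pdivlMr ?exprn_gt0//; exact: H.
Qed.

(** [g] is replaced by 0 off [Vset], as [Hpred] demands; differentiability survives because [Vset]
    is open. *)
Lemma Hspace_ex n (phi : weight R) (g : R[i] * R[i] -> R[i]) (c : R) : (0 < n)%N ->
  (forall p, Vset e n p -> exists a b, cdiff g p a b) ->
  (forall p, Vset e n p -> modc (g p) <= c * phi (Re p.1) / modc p.2 ^+ n) ->
  exists h : Hspace e n phi, forall p, Vset e n p -> h p = g p.
Proof.
move=> n0 dg bg; pose g' p := if pselect (Vset e n p) is left _ then g p else 0.
have gE p : Vset e n p -> g' p = g p by rewrite /g'; case: pselect.
suff Hg : g' \in Hpred e n phi by exists (HspaceOf Hg).
apply/asboolP; split.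
- move=> p Vp; apply/differentiableC2P.
  have [d d0 Hd] := Vset_open n0 Vp; have [a [b ab]] := dg p Vp.
  exists a, b; apply: cdiff_local d0 _ ab => q /Hd Vq.
  by rewrite gE.
- exists (1 + `|c|); first by rewrite ltr_pwDl.
  move=> p Vp; rewrite gE//; apply: (le_trans (bg p Vp)).
  have /andP[p0 _] := Vset_modc Vp.
  rewrite ler_wpM2r ?invr_ge0 ?exprn_ge0 ?(ltW p0)// ler_wpM2r ?(ltW (weight_gt0 _ _))//.
  by have := ler_norm c; lra.
- by move=> p nVp; rewrite /g'; case: pselect.
Qed.

Lemma Hspace_eq n phi (g h : Hspace e n phi) :
  (forall p, Vset e n p -> g p = h p) -> g = h.
Proof.
move=> gh; apply/val_inj/funext => p /=.
have [Vp|nVp] := pselect (Vset e n p); first exact: gh.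
case: g h {gh} => g /= /asboolP[_ _ g0] [h /= /asboolP[_ _ h0]].
by rewrite g0// h0.
Qed.

Lemma Hspace_addE n phi (g h : Hspace e n phi) p : (g + h) p = g p + h p.
Proof. by []. Qed.

Lemma Hspace_subE n phi (g h : Hspace e n phi) p : (g - h) p = g p - h p.
Proof. by []. Qed.

Lemma Hspace_scaleE n phi (a : R[i]) (h : Hspace e n phi) p : (a *: h) p = a * h p.
Proof. by []. Qed.

Lemma nbhs_HspaceP n phi (h : Hspace e n phi) (A : set (Hspace e n phi)) :
  nbhs h A <-> exists2 d : R, 0 < d & forall g, Hnorm (g - h) < d -> A g.
Proof.
have distE (g : Hspace e n phi) : `|h - g| = (Hnorm (g - h))%:C by rewrite distrC.
split=> [/nbhs_ballP[r /= r0 H]|[d d0 H]].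
  have [d d0 E] := gt0_realC r0; exists d => // g gd; apply: H.
  by rewrite -ball_normE /ball_ /= distE E ltc_real.
apply/nbhs_ballP; exists d%:C => /=; first by rewrite ltc_real.
by move=> g; rewrite -ball_normE /ball_ /= distE ltc_real; exact: H.
Qed.

Lemma Hspace_bounded_cont n phi m psi (T : Hspace e n phi -> Hspace e m psi) (C : R) :
  0 <= C -> (forall g h, Hnorm (T g - T h) <= C * Hnorm (g - h)) -> continuous T.
Proof.
move=> C0 HT h A /nbhs_HspaceP[d d0 HA].
have C1 : 0 < 1 + C by rewrite ltr_wpDr.
apply/nbhs_HspaceP; exists (d / (1 + C)); first by rewrite divr_gt0.
move=> g; rewrite ltr_pdivlMr// mulrC => gd; apply: HA.
apply: le_lt_trans (HT _ _) _; apply: le_lt_trans gd.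
by rewrite ler_wpM2r ?Hnorm_ge0// lerDr.
Qed.

End HspaceTheory.

Section PowerWeight.
Context {R : realType}.

Lemma pow_weight_cont n : continuous (fun x : R => (1 + x ^+ 2) ^+ n).
Proof.
move=> x; apply: (@continuous_comp _ _ _ (fun x : R => 1 + x ^+ 2) (fun y => y ^+ n)).
  by apply: cvgD; [exact: cvg_cst|exact: exprn_continuous].
exact: exprn_continuous.
Qed.

Lemma pow_weight_gt0 n (x : R) : 0 < (1 + x ^+ 2) ^+ n.
Proof. by rewrite exprn_gt0// ltr_wpDr// sqr_ge0. Qed.

Definition pow_weight n : weight R := Weight (@pow_weight_cont n) (@pow_weight_gt0 n).

Lemma pow_weight_ge1 n (x : R) : 1 <= pow_weight n x.
Proof. by rewrite /= exprn_ege1// lerDl sqr_ge0. Qed.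

Lemma pow_weight_double n (x : R) : pow_weight n.*2 x = pow_weight n x * pow_weight n x.
Proof. by rewrite /= -addnn exprD. Qed.

Lemma pow_weight_near n (x y : R) : `|y - x| <= 1 -> pow_weight n y <= 3 ^+ n * pow_weight n x.
Proof.
move=> /ler_normlP[h1 h2]; rewrite /= -exprMn; apply: lerXn2r.
- by rewrite nnegrE addr_ge0// sqr_ge0.
- by rewrite nnegrE mulr_ge0// addr_ge0// sqr_ge0.
(* [3 * (1 + x ^+ 2) - (1 + y ^+ 2)] equals [2 * (1 - (y - x) ^+ 2) + (2 * x - y) ^+ 2 + x ^+ 2]. *)
- have t1 : 0 <= 1 - (y - x) by lra.
  have t2 : 0 <= 1 + (y - x) by lra.
  have := mulr_ge0 t1 t2; have := sqr_ge0 (2 * x - y); have := sqr_ge0 x.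
  rewrite !expr2; lra.
Qed.

Lemma le_pow_weight n (x : R) : (0 < n)%N -> `|x| <= pow_weight n x.
Proof.
move=> n0; apply: (@le_trans _ _ (1 + x ^+ 2)).
  by have [h|h] := ler0P x; nra.
by rewrite /= -[leLHS]expr1 ler_weXn2l// lerDl sqr_ge0.
Qed.

End PowerWeight.

Section Steps.
Context {R : realType} (e : ends).
Implicit Types (p q : R[i] * R[i]) (n : nat).

Definition step n := Hspace e n (pow_weight n : weight R).

(** Within the bidisc the weight grows by at most [3 ^+ n], and the modulus of [zeta] at most
    halves, which costs [2 ^+ n]. *)
Lemma step_holo n (h : step n) p (r : R) : 0 < modc p.2 -> r <= modc p.2 / 2 -> r <= 1 ->
  bidisc p r `<=` Vset e n ->
  holo_bounded h p r (Hnorm h * (6 ^+ n * pow_weight n (Re p.1) / modc p.2 ^+ n)).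
Proof.
move=> p0 r2 r1 sub q qr; have Vq := sub q qr; split; first exact: Hspace_cdiff.
have [h1 h2 h3 h4 h5] := bidisc_modc qr.
have q0 : 0 < modc q.2 by lra.
apply: (le_trans (Hspace_le h Vq)); rewrite -mulrA ler_wpM2l ?Hnorm_ge0//.
rewrite ler_pdivrMr ?exprn_gt0// mulrAC ler_pdivlMr ?exprn_gt0//.
have w : pow_weight n (Re q.1) <= 3 ^+ n * pow_weight n (Re p.1).
  by apply: pow_weight_near; lra.
have x : modc p.2 ^+ n <= 2 ^+ n * modc q.2 ^+ n.
  by rewrite -exprMn; apply: lerXn2r; rewrite ?nnegrE ?mulr_ge0 ?modc_ge0//; lra.
have w0 := ltW (weight_gt0 (pow_weight n) (Re q.1)).
apply: (le_trans (ler_pM w0 _ w x)); first by rewrite exprn_ge0 ?modc_ge0.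
rewrite le_eqVlt; apply/orP; left; apply/eqP.
have -> : 6 ^+ n = 3 ^+ n * 2 ^+ n :> R by rewrite -exprMn; congr (_ ^+ n); ring.
by ring.
Qed.

Lemma partial_xE (f : R[i] * R[i] -> R[i]) p a b : cdiff f p a b -> partial_x f p = a.
Proof.
move=> H; rewrite /partial_x /cderive.
have E (F : R[i] -> R) : (forall z w, F (z - w) = F z - F w) ->
    (forall z, `|F z| <= modc z) -> (forall z (t : R), F (z * t%:C) = F z * t) ->
    derive1 (F \o (fun x : R => f (x +i* Im p.1, p.2))) (Re p.1) = F a.
  move=> FB FL FM; rewrite derive1E; apply: derive_val; apply/is_derive_epsP => r r0.
  have [d d0 Hd] := H r r0; exists d => // h hd.
  have := Hd h%:C 0; rewrite normc0 !addr0 modc_real => /(_ hd).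
  rewrite mulr0 addr0 => /(le_trans (FL _)).
  rewrite !FB FM (_ : (p.1 + h%:C, p.2) = ((Re p.1 + h) +i* Im p.1, p.2)).
    by rewrite /=; case: (p) => -[].
  by congr pair; apply: complex_eq; rewrite ?cReD ?cImD /= ?addr0.
apply: complex_eq => /=; [apply: (E (@complex.Re _))|apply: (E (@complex.Im _))].
- by move=> z w; rewrite cReD cReN.
- exact: Re_le_modc.
- by move=> z t; rewrite cReM /= mulr0 subr0.
- by move=> z w; rewrite cImD cImN.
- exact: Im_le_modc.
- by move=> z t; rewrite cImM /= mulr0 add0r.
Qed.

Lemma cdiffM (f g : R[i] * R[i] -> R[i]) p a b a' b' : cdiff f p a b -> cdiff g p a' b' ->
  exists a b, cdiff (fun q => f q * g q) p a b.
Proof.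
move=> Hf Hg; apply/differentiableC2P; apply: differentiableM; apply/differentiableC2P.
  by exists a, b.
by exists a', b'.
Qed.

Lemma Vset_double n p : (0 < n)%N -> Vset e n.*2 p -> Vset e n p.
Proof. by move=> n0; apply: Vset_decr => //; rewrite -addnn leq_addr. Qed.

(** The two bounds multiply: weight and power of the modulus are both squared, and [n.*2] doubles
    both exponents. *)
Lemma step_mul n : (0 < n)%N -> exists2 m : step n * step n -> step n.*2,
  continuous m & forall f g p, Vset e n.*2 p -> m (f, g) p = f p * g p.
Proof.
move=> n0; have dn0 : (0 < n.*2)%N by rewrite double_gt0.
have bound (x y a b : R) p : Vset e n p -> 0 <= x -> 0 <= y -> 0 <= a -> 0 <= b ->
    x <= a * pow_weight n (Re p.1) / modc p.2 ^+ n ->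
    y <= b * pow_weight n (Re p.1) / modc p.2 ^+ n ->
    x * y <= a * b * pow_weight n.*2 (Re p.1) / modc p.2 ^+ n.*2.
  move=> /Vset_modc /andP[p0 _] x0 y0 a0 b0 hx hy.
  apply: (le_trans (ler_pM x0 y0 hx hy)); rewrite pow_weight_double -addnn exprD.
  rewrite le_eqVlt; apply/orP; left; apply/eqP; field.
  by rewrite expf_neq0 ?gt_eqF.
have [|m Hm] := @choice _ _ (fun (fg : step n * step n) (h : step n.*2) =>
    forall p, Vset e n.*2 p -> h p = fg.1 p * fg.2 p).
  move=> [f g] /=.
  apply: (@Hspace_ex _ _ _ _ _ (Hnorm f * Hnorm g) dn0) => p Vp; have Vp' := Vset_double n0 Vp.
    have [a [b ab]] := Hspace_cdiff f Vp'; have [a' [b' ab']] := Hspace_cdiff g Vp'.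
    exact: cdiffM ab ab'.
  by rewrite normcM; apply: bound => //; rewrite ?modc_ge0 ?Hnorm_ge0//; exact: Hspace_le.
exists m; last by move=> f g p /Hm ->.
move=> [f0 g0] A /nbhs_HspaceP[d d0 HA].
pose K := 1 + Hnorm f0 + Hnorm g0.
have K1 : 1 <= K by rewrite /K -addrA lerDl addr_ge0 ?Hnorm_ge0.
(* [s <= 1] gives [Hnorm g <= 1 + Hnorm g0], so the two terms of [f * g - f0 * g0] add up to at most
   [s * K <= d / 2]. *)
pose s := Num.min 1 (d / (2 * K)).
have s0 : 0 < s by rewrite lt_min ltr01/= divr_gt0// mulr_gt0//; lra.
have s1 : s <= 1 by rewrite ge_min lexx.
have s2 : s <= d / (2 * K) by rewrite ge_min lexx orbT.
exists ([set f | Hnorm (f - f0) < s], [set g | Hnorm (g - g0) < s]).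
  by split; apply/nbhs_HspaceP; exists s.
move=> [f g] [/= fs gs]; apply: HA.
apply: (@le_lt_trans _ _ (Hnorm (f - f0) * Hnorm g + Hnorm f0 * Hnorm (g - g0))).
  apply: Hnorm_le_val => [|p Vp]; first by rewrite addr_ge0// mulr_ge0// Hnorm_ge0.
  have Vp' := Vset_double n0 Vp.
  rewrite Hspace_subE !Hm//=.
  have -> : f p * g p - f0 p * g0 p = (f - f0) p * g p + f0 p * (g - g0) p.
    by rewrite !Hspace_subE; ring.
  apply: (le_trans (le_normcD _ _)); rewrite !normcM !mulrDl; apply: lerD;
    by apply: bound => //; rewrite ?modc_ge0 ?Hnorm_ge0//; exact: Hspace_le.
have gg : Hnorm g <= 1 + Hnorm g0.
  have := Hnorm_triangle (g - g0) g0; rewrite subrK; lra.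
have a1 : Hnorm (f - f0) * Hnorm g <= s * (1 + Hnorm g0).
  by apply: ler_pM; rewrite ?Hnorm_ge0//; exact: ltW.
have a2 : Hnorm f0 * Hnorm (g - g0) <= Hnorm f0 * s.
  by rewrite ler_wpM2l ?Hnorm_ge0//; exact: ltW.
have sK : s * K <= d / 2.
  apply: (le_trans (ler_wpM2r _ s2)); first by lra.
  rewrite le_eqVlt; apply/orP; left; apply/eqP; field; apply/eqP; lra.
have : s * K = s * (1 + Hnorm g0) + Hnorm f0 * s by rewrite /K; ring.
lra.
Qed.

Lemma Vset_double_thick n : (0 < n)%N -> exists c : R,
  [/\ 0 < c, c <= 1/4 & forall p, Vset e n.*2 p -> bidisc p (c * modc p.2) `<=` Vset e n].
Proof.
by move=> n0; apply: Vset_thick => //; rewrite -addnn -{1}[n]addn0 ltn_add2l.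
Qed.

(** Cauchy's estimate at radius [c * modc p.2] costs one more power of the modulus, which is
    affordable since [n.+1 <= n.*2]. *)
Lemma step_der n : (0 < n)%N -> exists2 d : step n -> step n.*2,
  continuous d & forall f p, Vset e n.*2 p -> d f p = partial_x f p.
Proof.
move=> n0; have dn0 : (0 < n.*2)%N by rewrite double_gt0.
have [c [c0 c4 thick]] := Vset_double_thick n0.
pose K : R := 240 * 6 ^+ n / c.
have K0 : 0 <= K by rewrite divr_ge0 ?mulr_ge0 ?exprn_ge0// ltW.
have bound (f : step n) p : Vset e n.*2 p ->
    modc (partial_x f p) <= K * Hnorm f * pow_weight n.*2 (Re p.1) / modc p.2 ^+ n.*2.
  move=> Vp; have /andP[p0 p1] := Vset_modc_lt1 dn0 Vp.
  have [a [b ab]] := Hspace_cdiff f (Vset_double n0 Vp).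
  rewrite (partial_xE ab).
  have r0 : 0 < c * modc p.2 by rewrite mulr_gt0.
  have hb : holo_bounded f p (c * modc p.2)
      (Hnorm f * (6 ^+ n * pow_weight n (Re p.1) / modc p.2 ^+ n)).
    by apply: step_holo => //; [nra|nra|exact: thick].
  have := holo_linear_part r0 hb 1 0 ab; rewrite mulr1 mulr0 normc1 normc0 !addr0 mulr1.
  move=> /le_trans; apply.
  have -> : 240 * (Hnorm f * (6 ^+ n * pow_weight n (Re p.1) / modc p.2 ^+ n)) / (c * modc p.2) =
      K * Hnorm f * (pow_weight n (Re p.1) / modc p.2 ^+ n.+1).
    rewrite /K exprS; field.
    by rewrite ?expf_neq0 ?gt_eqF.
  rewrite -[leRHS]mulrA ler_wpM2l ?(mulr_ge0 K0) ?Hnorm_ge0//.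
  have w0 := ltW (weight_gt0 (pow_weight n) (Re p.1)).
  apply: (ler_pM w0); first by rewrite invr_ge0 exprn_ge0// modc_ge0.
    by rewrite pow_weight_double ler_peMr// pow_weight_ge1.
  rewrite lef_pV2 ?posrE ?exprn_gt0// ler_wiXn2l ?modc_ge0 ?ltW//.
  by rewrite -addnn -addn1 leq_add2l.
have [|d Hd] := @choice _ _ (fun (f : step n) (h : step n.*2) =>
    forall p, Vset e n.*2 p -> h p = partial_x f p).
  move=> f.
  apply: (@Hspace_ex _ _ _ _ _ (K * Hnorm f) dn0) => p Vp; last exact: bound.
  have /andP[p0 p1] := Vset_modc_lt1 dn0 Vp.
  have r0 : 0 < c * modc p.2 by rewrite mulr_gt0.
  have hb : holo_bounded f p (c * modc p.2)
      (Hnorm f * (6 ^+ n * pow_weight n (Re p.1) / modc p.2 ^+ n)).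
    by apply: step_holo => //; [nra|nra|exact: thick].
  apply: (holo_deriv r0 hb) => q /(thick p Vp) Vq.
  have [a [b ab]] := Hspace_cdiff f Vq.
  by exists b; rewrite (partial_xE ab).
exists d => //; apply: (Hspace_bounded_cont K0) => g h.
apply: Hnorm_le_val => [|p Vp]; first by rewrite mulr_ge0 ?Hnorm_ge0.
rewrite Hspace_subE !Hd//.
have -> : partial_x g p - partial_x h p = partial_x (g - h) p; last exact: bound.
have [a [b ab]] := Hspace_cdiff g (Vset_double n0 Vp).
have [a' [b' ab']] := Hspace_cdiff h (Vset_double n0 Vp).
have := cdiff_lin 1 ab ab'; rewrite !mul1r => ab2.
rewrite (partial_xE ab) (partial_xE ab'); apply/esym/(@partial_xE _ _ _ (b - b')).
by move=> r /ab2[s s0 Hs]; exists s => // v1 v2 /Hs; rewrite !mul1r.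
Qed.

End Steps.

(** * Montel's theorem and the compact inclusions *)

Section Compactness.
Context {R : realType} (e : ends).
Implicit Types (p q : R[i] * R[i]) (n : nat).

Lemma weight_ge0 (phi : weight R) (x : R) : 0 <= phi x.
Proof. exact/ltW/weight_gt0. Qed.

Lemma compact_bidisc (B : R) :
  compact [set q : R[i] * R[i] | modc q.1 <= B /\ modc q.2 <= B].
Proof.
set K := [set q | _]; rewrite compact_ultra /= => F UF FK.
have [B0|B0] := leP 0 B; last first.
  by have [q [/= h _]] := filter_ex FK; have := modc_ge0 q.1; lra.
(* Truncated to 0 off [K], as [ultra_lim] asks for a bound at every point. *)
pose u (q : R[i] * R[i]) := if pselect (K q) is left _ then q.1 else 0.
pose w (q : R[i] * R[i]) := if pselect (K q) is left _ then q.2 else 0.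
have uB q : modc (u q) <= B by rewrite /u; case: pselect => [[]|_]//; rewrite normc0.
have wB q : modc (w q) <= B by rewrite /w; case: pselect => [[]|_]//; rewrite normc0.
have [l1 Hl1] := ultra_lim UF uB; have [l2 Hl2] := ultra_lim UF wB.
exists (l1, l2); split.
  by split; [apply: (flim_le Hl1)|apply: (flim_le Hl2)]; apply: filterS filterT => q _ /=.
move=> A /nbhs_complex2P[d d0 HA].
apply: filterS (filterI FK (filterI (Hl1 _ d0) (Hl2 _ d0))) => q [Kq [/= h1 h2]].
by apply: HA => /=; [move: h1; rewrite /u|move: h2; rewrite /w]; case: pselect.
Qed.

Lemma step_incl_ex n : (0 < n)%N -> exists i : @step R e n -> @step R e n.*2,
  (forall f p, Vset e n.*2 p -> i f p = f p) /\ linear i.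
Proof.
move=> n0; have dn0 : (0 < n.*2)%N by rewrite double_gt0.
have [|i Hi] := @choice _ _ (fun (f : @step R e n) (h : @step R e n.*2) =>
    forall p, Vset e n.*2 p -> h p = f p).
  move=> f; apply: (@Hspace_ex _ _ _ _ _ (Hnorm f) dn0) => p Vp.
    exact/Hspace_cdiff/Vset_double.
  have Vp' := Vset_double n0 Vp; apply: (le_trans (Hspace_le f Vp')).
  have /andP[p0 p1] := Vset_modc_lt1 dn0 Vp.
  rewrite -!mulrA ler_wpM2l ?Hnorm_ge0//.
  have w0 := ltW (weight_gt0 (pow_weight n) (Re p.1)).
  apply: (ler_pM w0); first by rewrite invr_ge0 exprn_ge0// modc_ge0.
    by rewrite pow_weight_double ler_peMr// pow_weight_ge1.
  rewrite lef_pV2 ?posrE ?exprn_gt0// ler_wiXn2l ?modc_ge0 ?ltW//.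
  by rewrite -addnn leq_addr.
exists i; split=> // a f g; apply: Hspace_eq => p Vp.
by rewrite Hspace_addE Hspace_scaleE !Hi// Hspace_addE Hspace_scaleE.
Qed.

Section Montel.
Variables (n : nat) (n0 : (0 < n)%N) (C : R) (C0 : 0 <= C).
Variables (I : Type) (G : set_system I) (UG : UltraFilter G) (f : I -> @step R e n).
Hypothesis fC : forall i, Hnorm (f i) <= C.

Let dn0 : (0 < n.*2)%N. Proof. by rewrite double_gt0. Qed.

Let bound p := C * (6 ^+ n * pow_weight n (Re p.1) / modc p.2 ^+ n).

Let holo_bound (h : @step R e n) p (r : R) : Hnorm h <= C -> 0 < modc p.2 -> r <= modc p.2 / 2 -> r <= 1 ->
  bidisc p r `<=` Vset e n -> holo_bounded h p r (bound p).
Proof.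
move=> hC p0 r2 r1 sub q qr; have [d le] := step_holo h p0 r2 r1 sub qr.
split => //; apply: (le_trans le); rewrite ler_wpM2r//.
by rewrite divr_ge0 ?(mulr_ge0 _ (weight_ge0 _ _)) ?exprn_ge0 ?modc_ge0.
Qed.

(** Bounded norms bound each value, so pointwise limits along [G] exist; the bound is uniform on
    small bidiscs, where [holo_limit] applies. *)
Lemma montel_pointwise : exists2 l : @step R e n, Hnorm l <= C &
  forall p, Vset e n p -> flim G (fun i => f i p) (l p).
Proof.
have [|L HL] := @choice _ _ (fun p z => Vset e n p -> flim G (fun i => f i p) z).
  move=> p; have [Vp|] := pselect (Vset e n p); last by exists 0.
  have [i|z Hz] := @ultra_lim _ _ G (fun i => f i p) (C * pow_weight n (Re p.1) / modc p.2 ^+ n) UG.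
    apply: (le_trans (Hspace_le _ Vp)).
    by rewrite -!mulrA ler_wpM2r ?fC// (divr_ge0 (weight_ge0 _ _))// exprn_ge0 ?modc_ge0.
  by exists z.
have [|p Vp|l Hl] := @Hspace_ex _ e n (pow_weight n) L C n0.
- move=> p Vp; have [d d0 Hd] := Vset_open n0 Vp.
  have /andP[p0 p1] := Vset_modc_lt1 n0 Vp.
  pose r := Num.min d (modc p.2 / 2).
  have r0 : 0 < r by rewrite lt_min d0 divr_gt0.
  have rd : r <= d by rewrite ge_min lexx.
  have rp : r <= modc p.2 / 2 by rewrite ge_min lexx orbT.
  have sub : bidisc p r `<=` Vset e n.
    by move=> q [q1 q2]; apply: Hd; split; apply: lt_le_trans rd.
  apply: (@holo_limit _ _ G (fun i => f i) L p r (bound p) UG r0) => [i|q /sub].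
    by apply: holo_bound => //; lra.
  exact: HL.
- apply: (flim_le (HL p Vp)); apply: filterS filterT => i _ /=.
  apply: (le_trans (Hspace_le _ Vp)).
  by rewrite -!mulrA ler_wpM2r ?fC// (divr_ge0 (weight_ge0 _ _))// exprn_ge0 ?modc_ge0.
exists l => [|p Vp]; last by rewrite Hl//; exact: HL.
apply: Hnorm_le_val => // p Vp; rewrite Hl//.
apply: (flim_le (HL p Vp)); apply: filterS filterT => i _ /=.
apply: (le_trans (Hspace_le _ Vp)).
by rewrite -!mulrA ler_wpM2r ?fC// (divr_ge0 (weight_ge0 _ _))// exprn_ge0 ?modc_ge0.
Qed.

Variables (l : @step R e n) (lC : Hnorm l <= C).
Hypothesis fl : forall p, Vset e n p -> flim G (fun i => f i p) (l p).

(** By equicontinuity, [f i] and [l] vary by at most [eps / 3] near [q0], so convergence at a single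
    nearby point suffices. *)
Lemma montel_local q0 (s eps : R) : 0 < s -> 0 < eps ->
  \forall q \near q0 & i \near G, Vset e n.*2 q -> s < modc q.2 ->
    modc (f i q - l q) <= eps.
Proof.
move=> s0 eps0; have [c [c0 c4 thick]] := @Vset_double_thick R e n n0.
pose r := Num.min (c * s) 1.
have r0 : 0 < r by rewrite lt_min mulr_gt0/=.
have rcs : r <= c * s by rewrite ge_min lexx.
have r1 : r <= 1 by rewrite ge_min lexx orbT.
pose M := C * (6 ^+ n * (3 ^+ n * pow_weight n (Re q0.1)) / s ^+ n).
have M0 : 0 <= M.
  apply: mulr_ge0 => //; apply: divr_ge0; last by rewrite exprn_ge0// ltW.
  apply: mulr_ge0; first exact: exprn_ge0.
  by apply: mulr_ge0; [exact: exprn_ge0|exact: weight_ge0].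
(* The increments from [p] to [q] sum to less than [4 * eta]: this is at most [r / 6], and
   [240 * M * (4 * eta) / r] is at most [eps / 3]. *)
pose eta := Num.min (r / 24) (eps * r / (12 * 240 * (M + 1))).
have M1 : 0 < 12 * 240 * (M + 1) by rewrite mulr_gt0// ltr_wpDl.
have eta0 : 0 < eta by rewrite lt_min !divr_gt0// mulr_gt0.
have eta1 : eta <= r / 24 by rewrite ge_min lexx.
have eta2 : eta * (12 * 240 * (M + 1)) <= eps * r by rewrite -ler_pdivlMr// ge_min lexx orbT.
(* [q0] ranges over a compact set not contained in the domain, so the reference point [p] is any
   admissible point near it; without one, nothing is to be shown. *)
have [[p [pq Vp sp]]|none] := pselect (exists p, [/\ bidisc q0 eta p, Vset e n.*2 p & s < modc p.2]);
  last first.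
  exists (bidisc q0 eta, setT).
    by split; [apply/nbhs_complex2P; exists eta|exact: filterT].
  by move=> [q i] [/= h _] Vq sq; exfalso; apply: none; exists q.
have Vp' := Vset_double n0 Vp.
have e3 : 0 < eps / 3 by rewrite divr_gt0.
exists (bidisc q0 eta, [set i | modc (f i p - l p) < eps / 3]).
  by split; [apply/nbhs_complex2P; exists eta|exact: fl].
move=> [q i] [/= qq near] Vq sq.
have [p1 p2] := pq; have [q1 q2] := qq.
have v1 : modc (q.1 - p.1) < 2 * eta.
  by have := modc_triangle q0.1 q.1 p.1; rewrite [modc (q0.1 - _)]modcB; lra.
have v2 : modc (q.2 - p.2) < 2 * eta.
  by have := modc_triangle q0.2 q.2 p.2; rewrite [modc (q0.2 - _)]modcB; lra.
have qE : q = (p.1 + (q.1 - p.1), p.2 + (q.2 - p.2)).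
  by rewrite ![_ + (_ - _)]addrC !subrK; case: (q).
have cs : c * s <= c * modc p.2 by rewrite ler_wpM2l// ltW.
have cp : c * modc p.2 <= 1/4 * modc p.2 by rewrite ler_wpM2r ?modc_ge0.
have sub : bidisc p r `<=` Vset e n.
  by move=> t [t1 t2]; apply: (thick p Vp); split; lra.
have bM : bound p <= M.
  rewrite /bound /M ler_wpM2l// -!mulrA ler_wpM2l ?exprn_ge0//.
  rewrite mulrA; have w0 := ltW (weight_gt0 (pow_weight n) (Re p.1)).
  apply: (ler_pM w0); first by rewrite invr_ge0 exprn_ge0 ?modc_ge0.
    apply: pow_weight_near; have := Re_le_modc (p.1 - q0.1); rewrite cReD cReN; lra.
  by rewrite lef_pV2 ?posrE ?exprn_gt0// ?(lt_trans s0)// lerXn2r ?nnegrE ?modc_ge0 ?ltW.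
have lip (h : @step R e n) : Hnorm h <= C -> modc (h q - h p) <= eps / 3.
  move=> hC; have hb : holo_bounded h p r M.
    move=> t tr; have [|||d le] := @holo_bound h p r hC _ _ _ sub t tr; [lra|lra|lra|].
    by split => //; exact: le_trans bM.
  have := @holo_lip _ h p r M r0 hb (q.1 - p.1) (q.2 - p.2); rewrite -qE.
  move=> H; apply: (le_trans (H _)); first by lra.
  rewrite ler_pdivrMr//.
  have : M * (modc (q.1 - p.1) + modc (q.2 - p.2)) <= M * (4 * eta).
    by rewrite ler_wpM2l//; lra.
  lra.
have A1 := lip _ (fC i); have A2 := lip l lC.
have -> : f i q - l q = (f i q - f i p) + (f i p - l p) - (l q - l p) by ring.
apply: (le_trans (le_modcB _ _)); have := le_normcD (f i q - f i p) (f i p - l p).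
lra.
Qed.

Lemma montel (d : R) (i2 : @step R e n -> @step R e n.*2) : 0 < d ->
  (forall f p, Vset e n.*2 p -> i2 f p = f p) ->
  G [set i | Hnorm (i2 (f i) - i2 l) <= d].
Proof.
move=> d0 Hi2; pose D := 2 * C + 1; have D0 : 0 < D by rewrite /D; have := C0; lra.
pose s := Num.min 1 (d / D).
have s0 : 0 < s by rewrite lt_min ltr01 divr_gt0.
have s1 : s <= 1 by rewrite ge_min lexx.
have sd : s * D <= d by rewrite -ler_pdivlMr// ge_min lexx orbT.
(* [D / d] bounds [Re p.1] in the compact region; the 2 leaves room for the imaginary part. *)
pose B := D / d + 2.
have B0 : 0 < D / d by rewrite divr_gt0.
have near : \near G, [set q : R[i] * R[i] | modc q.1 <= B /\ modc q.2 <= B] `<=`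
    (fun q => Vset e n.*2 q -> s < modc q.2 -> modc (f G q - l q) <= d).
  have /compact_near_coveringP cov := @compact_bidisc B.
  by apply: cov => x _; exact: montel_local.
apply: filterS near => i Hi; apply: Hnorm_le_val; first exact: ltW.
move=> p Vp; rewrite Hspace_subE !Hi2//.
have /andP[p0 p1] := Vset_modc_lt1 dn0 Vp; have Vp' := Vset_double n0 Vp.
have x0 : 0 < modc p.2 ^+ n by rewrite exprn_gt0.
have x1 : modc p.2 ^+ n <= 1 by rewrite exprn_ile1 ?modc_ge0 ?ltW.
have xp : modc p.2 ^+ n <= modc p.2.
  by rewrite -[leRHS]expr1 ler_wiXn2l ?modc_ge0 ?ltW.
have w1 := pow_weight_ge1 n (Re p.1).
have wx := le_pow_weight (Re p.1) n0.
rewrite pow_weight_double -addnn exprD.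
set x := modc p.2 ^+ n in x0 x1 xp *; set w := pow_weight n (Re p.1) in w1 wx *.
have -> : d * (w * w) / (x * x) = d * (w / x) * (w / x) by field; rewrite gt_eqF.
have wx1 : 1 <= w / x by rewrite ler_pdivlMr// mul1r; lra.
(* The crude bound contains [w / x] once, the target twice; the spare factor exceeds [D / d] where
   the modulus is small or [Re p.1] is large. *)
have triv : modc (f i p - l p) <= D * (w / x).
  apply: (le_trans (le_modcB _ _)).
  have h1 := Hspace_le (f i) Vp'; have h2 := Hspace_le l Vp'.
  rewrite -/x -/w -mulrA in h1; rewrite -/x -/w -mulrA in h2.
  have h3 : Hnorm (f i) * (w / x) <= C * (w / x) by rewrite ler_wpM2r ?fC//; lra.
  have h4 : Hnorm l * (w / x) <= C * (w / x) by rewrite ler_wpM2r//; lra.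
  rewrite /D; lra.
have [sm|sm] := leP (modc p.2) s.
  apply: (le_trans triv); rewrite ler_wpM2r//; first by lra.
  rewrite mulrA ler_pdivlMr//; apply: (@le_trans _ _ (D * s)).
    by rewrite ler_wpM2l; lra.
  by rewrite mulrC; apply: (le_trans sd); rewrite ler_peMr// ltW.
have [xB|xB] := leP `|Re p.1| (D / d).
  have ip : `|Im p.1| < 1.
    have i1 : n.*2%:R^-1 <= 1 :> R by rewrite invf_le1 ?ltr0n// ler1n.
    case: Vp => -[_]; last by move=> _ h; exact: lt_le_trans i1.
    move=> _ _ h; apply: (lt_le_trans h); apply: (@le_trans _ _ (1 * modc p.2)); last by lra.
    by rewrite ler_wpM2r ?modc_ge0.
  have /(_ Vp sm) : Vset e n.*2 p -> s < modc p.2 -> modc (f i p - l p) <= d.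
    apply: Hi; split; last by rewrite /B; lra.
    by apply: (le_trans (modc_le_ReIm _)); rewrite /B; lra.
  move=> h; apply: (le_trans h); rewrite -mulrA ler_peMr//; first exact: ltW.
  exact: mulr_ege1.
apply: (le_trans triv); rewrite ler_wpM2r//; first by lra.
have Dw : D <= d * w.
  by rewrite mulrC -ler_pdivrMr//; lra.
apply: (le_trans Dw); rewrite ler_wpM2l//; first exact: ltW.
by rewrite ler_pdivlMr// ler_piMr//; lra.
Qed.

End Montel.

(** A bounded set lies in a closed ball, whose image is compact: an ultrafilter on the image is
    lifted by choosing preimages in the ball, which converge pointwise and, by [montel], in norm
    after inclusion. *)
Lemma step_incl n : (0 < n)%N -> exists2 i : @step R e n -> @step R e n.*2,
  compact_operator i & forall f p, Vset e n.*2 p -> i f p = f p.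
Proof.
move=> n0; have [i [Hi li]] := step_incl_ex n0; exists i => //; split => // B bB.
have [C C0 BC] : exists2 C : R, 0 <= C & forall f, B f -> Hnorm f <= C.
  have [/= M [Mr HM]] := bB.
  have [c cM] : exists c : R, M < c%:C.
    exists (Re M + 1); rewrite ltcE /= ltrDl ltr01 andbT eq_sym.
    by have /eqP := RIm_real Mr; rewrite eq_complex /= => /andP[].
  exists `|c| => // f Bf; apply: (le_trans _ (ler_norm c)).
  by have := HM _ cM f Bf; rewrite /= lec_real.
pose K : set (@step R e n.*2) := [set v | exists2 f, Hnorm f <= C & v = i f].
apply: (@precompact_subset _ _ K); first by move=> _ [f Bf <-]; exists f => //; exact: BC.
have cK : compact K.
  rewrite compact_ultra /= => F UF FK.
  have [|ph Hph] := @choice _ _ (fun v (f : @step R e n) => Hnorm f <= C /\ (K v -> v = i f)).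
    move=> v; have [[f fC vE]|nK] := pselect (K v); first by exists f.
    exists 0; split => //; apply: Hnorm_le => // p Vp.
    by rewrite (_ : (0 : @step R e n) p = 0)// normc0 mulr0 mul0r.
  have [l lC Hl] := montel_pointwise n0 C0 UF (fun v => (Hph v).1).
  exists (i l); split; first by exists l.
  move=> A /nbhs_HspaceP[d d0 HA].
  have d20 : 0 < d / 2 by rewrite divr_gt0.
  have := montel n0 C0 UF (fun v => (Hph v).1) lC Hl d20 Hi => M.
  apply: filterS (filterI FK M) => v [Kv /= h]; apply: HA.
  rewrite [v in v - _]((Hph v).2 Kv); lra.
rewrite precompact_closed//; apply: compact_closed => //; exact: norm_hausdorff.
Qed.

End Compactness.

Section AlgebraData.
Context {R : realType} (e : ends).

(** Defined by doubling instead of as [2 ^ k], so that [pow2 k.+1] is convertible to [(pow2 k).*2]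
    and the types of the one-step maps agree. *)
Fixpoint pow2 k := if k is k'.+1 then (pow2 k').*2 else 1%N.

Lemma pow2_gt0 k : (0 < pow2 k)%N.
Proof. by elim: k => // k IH; rewrite double_gt0. Qed.

Lemma pow2E k : pow2 k = (2 ^ k)%N.
Proof. by elim: k => // k IH; rewrite expnS mul2n -IH. Qed.

Lemma pow2_le k : (pow2 k <= pow2 k.+1)%N.
Proof. by rewrite /= -addnn leq_addr. Qed.

Definition pow2_weight k : weight R := pow_weight (pow2 k).

Lemma germ_lift k l (h : @step R e (pow2 k)) : (k <= l)%N ->
  exists h' : @step R e (pow2 l), germ_of e h = germ_of e h'.
Proof.
move=> /subnK <-; elim: (l - k)%N => [|d [h' E]]; first by exists h.
have [i _ Hi] := @step_incl R e _ (pow2_gt0 (d + k)).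
exists (i h'); rewrite E; apply/germ_of_eq; exists (pow2 (d + k).+1); first exact: pow2_gt0.
by move=> p Vp; rewrite Hi.
Qed.

Lemma Apred_lift (u v : germ R e) : u \in Apred pow2 pow2_weight -> v \in Apred pow2 pow2_weight ->
  exists k (f g : @step R e (pow2 k)), u = germ_of e f /\ v = germ_of e g.
Proof.
move=> /asboolP[k [f ->]] /asboolP[l [g ->]].
have [f' Ef] := germ_lift f (leq_maxl k l); have [g' Eg] := germ_lift g (leq_maxr k l).
by exists (maxn k l), f', g'.
Qed.

Lemma pow2_subalg_closed : GRing.subalg_closed (@Apred R e pow2 pow2_weight).
Proof.
split.
- have [p Vp|p Vp|h Hh] := @Hspace_ex R e 1 (pow_weight 1) (fun=> 1) 1 isT.
  + exists 0, 0 => r r0; exists 1 => // v1 v2 _.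
    by rewrite subrr !mul0r addr0 subr0 normc0 mulr_ge0 ?addr_ge0 ?modc_ge0 ?ltW.
  + have /andP[p0 p1] := Vset_modc_lt1 (ltn0Sn 0) Vp.
    rewrite normc1 mul1r expr1 ler_pdivlMr// mul1r.
    by apply: le_trans (ltW p1) _; exact: pow_weight_ge1.
  apply/asboolP; exists 0%N, h; rewrite -germ_of1; apply/germ_of_eq.
  by exists 1%N => // p /Hh ->.
- move=> a u v /Apred_lift uS /uS[k [f [g [-> ->]]]]; apply/asboolP.
  by exists k, (a *: f + g); rewrite -germ_ofZ -germ_ofD.
- move=> u v /Apred_lift uS /uS[k [f [g [-> ->]]]]; apply/asboolP.
  have [m _ Hm] := @step_mul R e _ (pow2_gt0 k).
  exists k.+1, (m (f, g)); rewrite -germ_ofM; apply/germ_of_eq.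
  by exists (pow2 k.+1) => [|p Vp]; [exact: pow2_gt0|rewrite Hm].
Qed.

Definition pow2_algebra : algebra_data R e := @AlgebraData R e pow2 pow2_weight
  pow2_gt0 pow2_le (fun k => @step_mul R e _ (pow2_gt0 k)) (fun k => @step_der R e _ (pow2_gt0 k))
  (fun k => @step_incl R e _ (pow2_gt0 k)) pow2_subalg_closed.

End AlgebraData.

(** * Smooth functions and their seminorms *)

Section SmoothReal.
Context {R : realType}.
Implicit Types (u v w : R -> R).

Record rsmooth u : Prop := Rsmooth { rsmooth_derivable1n : forall k x, derivable (derive1n k u) x 1 }.

(* Coinduction: it suffices to find a set of functions stable under derivation. *)
Lemma rsmooth_coind (S : set (R -> R)) :
  (forall u, S u -> (forall x, derivable u x 1) /\ S (derive1 u)) ->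
  forall u, S u -> rsmooth u.
Proof.
move=> H u Su; apply: Rsmooth => k; suff : S (derive1n k u) by move=> /H[].
by elim: k => [//|k IH]; rewrite derive1nS; have [] := H _ IH.
Qed.

Lemma rsmooth_derivable u x : rsmooth u -> derivable u x 1.
Proof. by move=> /rsmooth_derivable1n/(_ 0%N x). Qed.

Lemma rsmooth_is_derive u x : rsmooth u -> is_derive x (1 : R) u (derive1 u x).
Proof. by move=> su; rewrite derive1E; apply: derivableP; exact: rsmooth_derivable. Qed.
Arguments rsmooth_is_derive {u} x _.

Lemma rsmooth_derive1 u : rsmooth u -> rsmooth (derive1 u).
Proof. by move=> su; apply: Rsmooth => k x; rewrite -derive1Sn; exact: rsmooth_derivable1n. Qed.

Lemma is_derive_derive1 u du : (forall x, is_derive x (1 : R) u (du x)) -> derive1 u = du.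
Proof. by move=> H; apply/funext => x; rewrite derive1E; have [] := H x. Qed.

Lemma rsmooth_cst (a : R) : rsmooth (fun=> a).
Proof.
apply: (@rsmooth_coind [set u | exists a : R, u = fun=> a]); last by exists a.
move=> _ [b ->]; split=> [x|]; first exact: derivable_cst.
by exists 0; apply: is_derive_derive1 => x; exact: is_derive_cst.
Qed.

Lemma rsmooth_id : rsmooth id.
Proof.
apply: (@rsmooth_coind [set u | u = id \/ exists a : R, u = fun=> a]); last by left.
move=> _ [->|[b ->]]; split=> [x|].
- exact: derivable_id.
- by right; exists 1; apply: is_derive_derive1 => x; exact: is_derive_id.
- exact: derivable_cst.
- by right; exists 0; apply: is_derive_derive1 => x; exact: is_derive_cst.
Qed.

(** Products of smooth functions are not visibly stable under derivation; by Leibniz's rule sums of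
    products are, as [rsmooth_coind] requires. *)
Inductive psum : (R -> R) -> Prop :=
| psum_mul u v : rsmooth u -> rsmooth v -> psum (fun x => u x * v x)
| psum_add u v : psum u -> psum v -> psum (fun x => u x + v x).

Let psum_derive u : psum u -> exists2 du, psum du & forall x, is_derive x (1 : R) u (du x).
Proof.
elim=> [{}u v su sv|{}u v _ [du pu Hu] _ [dv pv Hv]].
  exists (fun x => u x * derive1 v x + derive1 u x * v x).
    apply: (@psum_add (fun x => u x * derive1 v x) (fun x => derive1 u x * v x)); apply: psum_mul => //;
    exact: rsmooth_derive1.
  move=> x; have hu := rsmooth_is_derive x su; have hv := rsmooth_is_derive x sv.
  by apply: is_derive_eq; rewrite -![_ *: _]/(_ * _) [v x * _]mulrC.
exists (fun x => du x + dv x); first exact: psum_add.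
by move=> x; have hu := Hu x; have hv := Hv x; exact: is_deriveD.
Qed.

Let psum_rsmooth u : psum u -> rsmooth u.
Proof.
apply: (rsmooth_coind (S := psum)) => {}u /psum_derive[du pu Hu]; split.
  by move=> x; have [] := Hu x.
by rewrite (is_derive_derive1 Hu).
Qed.

Lemma rsmoothM u v : rsmooth u -> rsmooth v -> rsmooth (fun x => u x * v x).
Proof. by move=> su sv; apply: psum_rsmooth; exact: psum_mul. Qed.

Lemma rsmoothD u v : rsmooth u -> rsmooth v -> rsmooth (fun x => u x + v x).
Proof.
move=> su sv; rewrite (_ : (fun x => _) = fun x => 1 * u x + 1 * v x); last first.
  by apply/funext => x; rewrite !mul1r.
apply: psum_rsmooth; apply: (@psum_add (fun x => 1 * u x) (fun x => 1 * v x));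
  apply: psum_mul => //; exact: rsmooth_cst.
Qed.

Lemma rsmoothN u : rsmooth u -> rsmooth (fun x => - u x).
Proof.
move=> su; rewrite (_ : (fun x => _) = fun x => -1 * u x).
  by apply: rsmoothM => //; exact: rsmooth_cst.
by apply/funext => x; rewrite mulN1r.
Qed.

Lemma rsmoothB u v : rsmooth u -> rsmooth v -> rsmooth (fun x => u x - v x).
Proof. by move=> su sv; apply: rsmoothD => //; exact: rsmoothN. Qed.

Lemma is_derive_affine u (a b x du : R) : is_derive (a * x + b) (1 : R) u du ->
  is_derive x (1 : R) (fun x => u (a * x + b)) (a * du).
Proof.
move=> /is_derive_epsP H; apply/is_derive_epsP => e e0.
have a1 : 0 < 1 + `|a| by rewrite ltr_wpDr.
have [d d0 Hd] := H (e / (1 + `|a|)) (divr_gt0 e0 a1).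
exists (d / (1 + `|a|)); first by rewrite divr_gt0.
move=> h; rewrite ltr_pdivlMr// mulrC => hd.
have ah : `|a * h| <= (1 + `|a|) * `|h| by rewrite normrM ler_wpM2r// lerDr.
have := Hd (a * h) (le_lt_trans ah hd).
rewrite (_ : a * x + b + a * h = a * (x + h) + b); last by ring.
rewrite (_ : du * (a * h) = a * du * h); last by ring.
by move=> /le_trans; apply; rewrite mulrAC ler_pdivrMr// -mulrA ler_pM2l// [leRHS]mulrC.
Qed.

Lemma rsmooth_affine u (a b : R) : rsmooth u -> rsmooth (fun x => u (a * x + b)).
Proof.
move=> su; apply: (@rsmooth_coind [set w | exists2 u, rsmooth u & exists c : R, w = fun x => c * u (a * x + b)]).
  move=> _ [{su}u su [c ->]].
  have D x : is_derive x (1 : R) (fun x => c * u (a * x + b)) (c * a * derive1 u (a * x + b)).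
    have := is_derive_affine (rsmooth_is_derive (a * x + b) su).
    move=> /(@is_deriveZ _ _ _ _ c) h; apply: is_derive_eq h _.
    by rewrite -[_ *: _]/(_ * _) mulrA.
  split; first by move=> x; have [] := D x.
  rewrite (is_derive_derive1 D); exists (derive1 u); first exact: rsmooth_derive1.
  by exists (c * a).
by exists u => //; exists 1; apply/funext => x; rewrite mul1r.
Qed.

Lemma is_derive_inv u (x du : R) : u x != 0 -> is_derive x (1 : R) u du ->
  is_derive x (1 : R) (fun x => (u x)^-1) (- du / (u x * u x)).
Proof.
move=> u0 H; have := @is_deriveV _ u x du 1 u0 H.
move=> h; apply: is_derive_eq h _.
rewrite -[_ *: _]/(_ * _); field; exact: u0.
Qed.

(** The quotients [u / v ^+ m] with [u] smooth form a set stable under derivation. *)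
Lemma rsmoothV v : rsmooth v -> (forall x, v x != 0) -> rsmooth (fun x => (v x)^-1).
Proof.
move=> sv v0.
apply: (@rsmooth_coind [set w | exists2 u, rsmooth u & exists m, w = fun x => u x * (v x)^-1 ^+ m]).
  move=> _ [u su [m ->]].
  pose du x := derive1 u x * v x - m%:R * (u x * derive1 v x).
  have D x : is_derive x (1 : R) (fun x => u x * (v x)^-1 ^+ m) (du x * (v x)^-1 ^+ m.+1).
    have hu := rsmooth_is_derive x su; have hv := is_derive_inv (v0 x) (rsmooth_is_derive x sv).
    have hvm : is_derive x (1 : R) (fun x => (v x)^-1 ^+ m)
       (- m%:R * derive1 v x * (v x)^-1 ^+ m.+1).
      elim: m {du} => [|m IH].
        by rewrite mulr0n oppr0 !mul0r; exact: is_derive_cst.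
      rewrite (_ : (fun x => _) = (fun x => (v x)^-1 ^+ m * (v x)^-1)); last first.
        by apply/funext => y; rewrite exprSr.
      apply: is_derive_eq; rewrite -![_ *: _]/(_ * _) -natr1 !exprSr.
      by field; exact: v0.
    apply: is_derive_eq; rewrite -![_ *: _]/(_ * _) /du !exprSr.
    by field; exact: v0.
  split; first by move=> x; have [] := D x.
  rewrite (is_derive_derive1 D); exists du; last by exists m.+1.
  apply: rsmoothB; first by apply: rsmoothM => //; exact: rsmooth_derive1.
  apply: rsmoothM; first exact: rsmooth_cst.
  by apply: rsmoothM => //; exact: rsmooth_derive1.
exists (fun=> 1); first exact: rsmooth_cst.
by exists 1%N; apply/funext => x; rewrite mul1r expr1.
Qed.

End SmoothReal.

(** * A flat function and smooth steps *)

Section FlatFunction.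
Context {R : realType}.

Definition flat (m : nat) (x : R) : R := if 0 < x then x^-1 ^+ m * expR (- x^-1) else 0.

Lemma flat_le m (x : R) : 0 < x -> x^-1 ^+ m * expR (- x^-1) <= m.+1`!%:R * x.
Proof.
move=> x0; have y0 : 0 < x^-1 by rewrite invr_gt0.
have := expR_ge0 (- x^-1); rewrite expRN => e0.
have E0 := expR_gt0 x^-1.
rewrite ler_pdivrMr// mulrAC -ler_pdivrMr//.
have : (x^-1) ^+ m.+1 / m.+1`!%:R <= expR x^-1 by have := @expR_ge1Dxn R x^-1 m (ltW y0); lra.
by move=> H; rewrite -exprSr [leRHS]mulrC -ler_pdivrMr ?ltr0n ?fact_gt0.
Qed.

(** Away from 0 this is calculus. At 0 the derivative is 0 because the function is [O(h ^+ 2)]: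
    [expR h^-1] dominates [h^-1 ^+ m.+2] divided by the factorial of [m.+2]. *)
Lemma flat_derive m (x : R) : is_derive x (1 : R) (flat m) (flat m.+2 x - m%:R * flat m.+1 x).
Proof.
have local (l : R) (f : R -> R) : (exists2 d : R, 0 < d & forall y, `|y - x| < d -> flat m y = f y) ->
    is_derive x (1 : R) f l -> is_derive x (1 : R) (flat m) l.
  move=> [d d0 Hd] /is_derive_epsP H; apply/is_derive_epsP => e e0.
  have [d1 d10 H1] := H e e0; exists (Num.min d d1); first by rewrite lt_min d0.
  move=> h; rewrite lt_min => /andP[h1 h2].
  rewrite !Hd ?subrr ?normr0//; first exact: H1.
  by rewrite addrC addKr.
have [x0|x0|x0] := ltgtP x 0.
- have F k : flat k x = 0 by rewrite /flat ltNge (ltW x0).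
  rewrite !F mulr0 subr0; apply: (local _ (fun=> 0)).
  exists (- x); first by rewrite oppr_gt0.
  move=> y /ltr_normlP[_ h]; rewrite /flat ifN// -leNgt; lra.
- have xN : x != 0 by rewrite gt_eqF.
  rewrite /flat x0; apply: (local _ (fun x => x^-1 ^+ m * expR (- x^-1))).
    exists x => // y /ltr_normlP[h _]; rewrite /flat ifT//; lra.
  have hi : is_derive x (1 : R) (fun x => x^-1) (- 1 / (x * x)).
    by apply: (@is_derive_inv R id x 1 xN).
  have hp : is_derive x (1 : R) (fun x => x^-1 ^+ m) (- m%:R * x^-1 ^+ m.+1).
    elim: m {local} => [|m IH]; first by rewrite mulr0n oppr0 mul0r; exact: is_derive_cst.
    rewrite (_ : (fun x => _) = (fun x => x^-1 ^+ m * x^-1)); last first.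
      by apply/funext => y; rewrite exprSr.
    apply: is_derive_eq; rewrite -![_ *: _]/(_ * _) -natr1 !exprSr.
    by field; exact: xN.
  have he : is_derive x (1 : R) (fun x => expR (- x^-1)) ((x * x)^-1 * expR (- x^-1)).
    have hn : is_derive x (1 : R) (fun x => - x^-1) ((x * x)^-1).
      by apply: is_derive_eq; rewrite mulN1r opprK.
    have := @is_derive1_comp R expR (fun x => - x^-1) x _ _ (is_derive_expR (- x^-1)) hn.
    by move=> h; apply: is_derive_eq h _; rewrite mulrC.
  apply: is_derive_eq; rewrite -![_ *: _]/(_ * _) !exprSr.
  by field; exact: xN.
have F k : flat k x = 0 by rewrite /flat x0 ltxx.
rewrite !F mulr0 subr0.
apply/is_derive_epsP => e e0.
have f0 : 0 < (m.+2)`!%:R :> R by rewrite ltr0n fact_gt0.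
exists (e / (m.+2)`!%:R); first by rewrite divr_gt0.
move=> h; rewrite ltr_pdivlMr// => hd; rewrite F subr0 mul0r subr0 x0 add0r /flat.
case: ifPn => h0; last by rewrite normr0 mulr_ge0// ltW.
rewrite gtr0_norm// in hd *.
rewrite ger0_norm ?mulr_ge0 ?exprn_ge0 ?invr_ge0 ?(ltW h0) ?expR_ge0//.
have := flat_le m.+1 h0; rewrite exprS -mulrA ler_pdivrMl// => H.
apply: (le_trans H); rewrite [leLHS]mulrC mulrAC.
by rewrite ler_pM2r// mulrC ltW.
Qed.

Lemma flat_smooth : rsmooth (flat 0).
Proof.
apply: (@rsmooth_coind R [set w | exists s : seq (R * nat), w = fun x => \sum_(p <- s) p.1 * flat p.2 x]);
  last by exists [:: (1, 0%N)]; apply/funext => x; rewrite big_seq1 mul1r.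
move=> _ [s ->].
have [s' D] : exists s' : seq (R * nat), forall x,
    is_derive x (1 : R) (fun x => \sum_(p <- s) p.1 * flat p.2 x) (\sum_(p <- s') p.1 * flat p.2 x).
  elim: s => [|[c m] s [s' IH]].
    exists [::] => x; rewrite big_nil (_ : (fun x => _) = fun=> 0); first exact: is_derive_cst.
    by apply/funext => y; rewrite big_nil.
  exists [:: (c, m.+2), (- (c * m%:R), m.+1) & s'] => x.
  rewrite (_ : (fun x => _) = fun x => c * flat m x + \sum_(p <- s) p.1 * flat p.2 x); last first.
    by apply/funext => y; rewrite big_cons.
  rewrite !big_cons /= addrA; apply: is_deriveD.
  have hf := flat_derive m x.
  by apply: is_derive_eq; rewrite -![_ *: _]/(_ * _); ring.
split; first by move=> x; have [] := D x.
by rewrite (is_derive_derive1 D); exists s'.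
Qed.

(** With [f] the flat function, [f (x - a)] divided by [f (x - a) + f (b - x)], which is positive
    since [a < b]. *)
Lemma smooth_step (a b : R) : a < b -> exists s : R -> R, [/\ rsmooth s, forall x, 0 <= s x <= 1,
  forall x, x <= a -> s x = 0 & forall x, b <= x -> s x = 1].
Proof.
move=> ab; pose f := flat 0.
have f0 x : 0 <= f x by rewrite /f /flat expr0 mul1r; case: ifP; rewrite ?expR_ge0.
have fp x : 0 < x -> 0 < f x by rewrite /f /flat expr0 mul1r => ->; rewrite expR_gt0.
have fn x : x <= 0 -> f x = 0 by rewrite /f /flat ltNge => ->.
pose d x := f (1 * x + (- a)) + f (-1 * x + b).
have dp x : 0 < d x.
  have [xa|xa] := leP x a.
    by rewrite /d ltr_wpDl// fp//; lra.
  by rewrite /d ltr_pwDl// fp//; lra.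
exists (fun x => f (1 * x + (- a)) * (d x)^-1); split.
- apply: rsmoothM; first by apply: rsmooth_affine; exact: flat_smooth.
  apply: rsmoothV => [|x]; last by rewrite gt_eqF.
  by apply: rsmoothD; apply: rsmooth_affine; exact: flat_smooth.
- by move=> x; rewrite divr_ge0 ?(ltW (dp x))//= ler_pdivrMr// [leRHS]mul1r /d lerDl.
- by move=> x xa; rewrite fn ?mul0r//; lra.
- move=> x xb; have : d x != 0 by rewrite gt_eqF.
  by rewrite /d (fn (-1 * x + b)) ?addr0; [exact: divff|lra].
Qed.

End FlatFunction.

Section SmoothComplex.
Context {R : realType}.
Implicit Types (g h : R -> R[i]) (x : R) (k : nat).

Definition csmooth g := rsmooth (Re \o g) /\ rsmooth (Im \o g).

Lemma csmoothP g : csmooth g <-> g \in smooth.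
Proof.
split=> [[[H1] [H2]]|/asboolP H]; first by apply/asboolP => k x; split.
by split; apply: Rsmooth => k x; have [] := H k x.
Qed.

Definition cinfty_of g (gs : csmooth g) : Cinfty R := CinftyOf ((csmoothP g).1 gs).

Lemma Cinfty_csmooth (t : Cinfty R) : csmooth t.
Proof. by apply/csmoothP; case: t. Qed.

Definition is_cderive g x (l : R[i]) :=
  is_derive x (1 : R) (Re \o g) (Re l) /\ is_derive x (1 : R) (Im \o g) (Im l).

Lemma csmooth_is_cderive g x : csmooth g -> is_cderive g x (cderive 1 g x).
Proof. by move=> [H1 H2]; split; exact: rsmooth_is_derive. Qed.

Lemma is_cderive_cderive g (dg : R -> R[i]) : (forall x, is_cderive g x (dg x)) -> cderive 1 g = dg.
Proof.
move=> H; apply/funext => x; apply: complex_eq; rewrite /cderive /=.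
  by rewrite (is_derive_derive1 (fun x => (H x).1)).
by rewrite (is_derive_derive1 (fun x => (H x).2)).
Qed.

Lemma cderive0 g : cderive 0 g = g.
Proof. by apply/funext => x; apply: complex_eq. Qed.

Lemma cderiveS k g : cderive k.+1 g = cderive k (cderive 1 g).
Proof. by apply/funext => x; apply: complex_eq; rewrite /cderive !derive1Sn. Qed.

Lemma cderiveSr k g : cderive k.+1 g = cderive 1 (cderive k g).
Proof. by []. Qed.

Lemma csmooth_cderive1 g : csmooth g -> csmooth (cderive 1 g).
Proof. by move=> [H1 H2]; split; exact: rsmooth_derive1. Qed.

Lemma csmooth_cderive k g : csmooth g -> csmooth (cderive k g).
Proof.
by elim: k g => [|k IH] g gs; [rewrite cderive0|rewrite cderiveS; exact/IH/csmooth_cderive1].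
Qed.

Lemma csmoothD g h : csmooth g -> csmooth h -> csmooth (fun x => g x + h x).
Proof.
move=> [g1 g2] [h1 h2]; split.
  rewrite (_ : _ \o _ = fun x => (Re \o g) x + (Re \o h) x); first exact: rsmoothD.
  by apply/funext => x /=; rewrite cReD.
rewrite (_ : _ \o _ = fun x => (Im \o g) x + (Im \o h) x); first exact: rsmoothD.
by apply/funext => x /=; rewrite cImD.
Qed.

Lemma csmoothM g h : csmooth g -> csmooth h -> csmooth (fun x => g x * h x).
Proof.
move=> [g1 g2] [h1 h2]; split.
  rewrite (_ : _ \o _ = fun x => (Re \o g) x * (Re \o h) x - (Im \o g) x * (Im \o h) x).
    by apply: rsmoothB; apply: rsmoothM.
  by apply/funext => x /=; rewrite cReM.
rewrite (_ : _ \o _ = fun x => (Re \o g) x * (Im \o h) x + (Im \o g) x * (Re \o h) x).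
  by apply: rsmoothD; apply: rsmoothM.
by apply/funext => x /=; rewrite cImM.
Qed.

Lemma csmooth_real (u : R -> R) : rsmooth u -> csmooth (fun x => (u x)%:C).
Proof. by move=> su; split => //; exact: rsmooth_cst. Qed.

Lemma csmooth_cst (a : R[i]) : csmooth (fun=> a).
Proof. by split; exact: rsmooth_cst. Qed.

Lemma csmoothZ (a : R[i]) g : csmooth g -> csmooth (fun x => a * g x).
Proof. by apply: csmoothM; exact: csmooth_cst. Qed.

Lemma csmoothN g : csmooth g -> csmooth (fun x => - g x).
Proof.
move=> gs; rewrite (_ : (fun x => _) = fun x => -1 * g x); first exact: csmoothZ.
by apply/funext => x; rewrite mulN1r.
Qed.

Lemma csmoothB g h : csmooth g -> csmooth h -> csmooth (fun x => g x - h x).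
Proof. by move=> gs hs; apply: csmoothD => //; exact: csmoothN. Qed.

Lemma csmoothV g : csmooth g -> (forall x, g x != 0) -> csmooth (fun x => (g x)^-1).
Proof.
move=> [g1 g2] g0.
pose n x := (Re \o g) x * (Re \o g) x + (Im \o g) x * (Im \o g) x.
have nE x : n x = modc (g x) ^+ 2 by rewrite sqr_modc !expr2.
have n0 x : n x != 0 by rewrite nE expf_neq0// modc_eq0.
have sn : rsmooth (fun x => (n x)^-1) by apply: rsmoothV => //; apply: rsmoothD; exact: rsmoothM.
have invE x : (g x)^-1 = (Re (g x) -i* Im (g x)) * ((n x)^-1)%:C.
  rewrite nE; case: (g x) => a b; rewrite sqr_modc /=.
  by apply: complex_eq; rewrite ?cReM ?cImM /=; rewrite ?mulr0 ?subr0 ?add0r ?addr0// mulNr.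
split.
  rewrite (_ : _ \o _ = fun x => (Re \o g) x * (n x)^-1); first exact: rsmoothM.
  by apply/funext => x /=; rewrite invE cReM /= mulr0 subr0.
rewrite (_ : _ \o _ = fun x => (- (Im \o g) x) * (n x)^-1).
  by apply: rsmoothM => //; exact: rsmoothN.
by apply/funext => x /=; rewrite invE cImM /= mulr0 add0r.
Qed.

Lemma is_cderiveD g h x a b : is_cderive g x a -> is_cderive h x b -> is_cderive (fun x => g x + h x) x (a + b).
Proof.
move=> [g1 g2] [h1 h2]; split.
  rewrite (_ : _ \o _ = fun x => (Re \o g) x + (Re \o h) x).
    by rewrite cReD; exact: is_deriveD.
  by apply/funext => y /=; rewrite cReD.
rewrite (_ : _ \o _ = fun x => (Im \o g) x + (Im \o h) x).
  by rewrite cImD; exact: is_deriveD.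
by apply/funext => y /=; rewrite cImD.
Qed.

Lemma is_cderiveM g h x a b : is_cderive g x a -> is_cderive h x b ->
  is_cderive (fun x => g x * h x) x (a * h x + g x * b).
Proof.
move=> [g1 g2] [h1 h2]; split.
  rewrite (_ : _ \o _ = fun x => (Re \o g) x * (Re \o h) x - (Im \o g) x * (Im \o h) x).
    apply: is_derive_eq; rewrite -![_ *: _]/(_ * _) cReD !cReM /=; ring.
  by apply/funext => y /=; rewrite cReM.
rewrite (_ : _ \o _ = fun x => (Re \o g) x * (Im \o h) x + (Im \o g) x * (Re \o h) x).
  apply: is_derive_eq; rewrite -![_ *: _]/(_ * _) cImD !cImM /=; ring.
by apply/funext => y /=; rewrite cImM.
Qed.

Lemma is_cderive_cst x (a : R[i]) : is_cderive (fun=> a) x 0.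
Proof. by split; exact: is_derive_cst. Qed.

Lemma cderive1M g h : csmooth g -> csmooth h ->
  cderive 1 (fun x => g x * h x) = fun x => cderive 1 g x * h x + g x * cderive 1 h x.
Proof. by move=> gs hs; apply: is_cderive_cderive => x; apply: is_cderiveM; exact: csmooth_is_cderive. Qed.

Lemma cderiveD k g h : csmooth g -> csmooth h ->
  cderive k (fun x => g x + h x) = fun x => cderive k g x + cderive k h x.
Proof.
elim: k g h => [|k IH] g h gs hs; first by rewrite (cderive0 g) (cderive0 h); exact: cderive0.
rewrite (cderiveS k g) (cderiveS k h) cderiveS (is_cderive_cderive (dg := fun x => cderive 1 g x + cderive 1 h x)).
  by apply: IH; exact: csmooth_cderive1.
by move=> x; apply: is_cderiveD; exact: csmooth_is_cderive.
Qed.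

Lemma cderiveZ k (a : R[i]) g : csmooth g ->
  cderive k (fun x => a * g x) = fun x => a * cderive k g x.
Proof.
elim: k g => [|k IH] g gs; first by rewrite (cderive0 g); exact: cderive0.
rewrite (cderiveS k g) cderiveS (is_cderive_cderive (dg := fun x => a * cderive 1 g x)).
  by apply: IH; exact: csmooth_cderive1.
move=> x; have := is_cderiveM (is_cderive_cst x a) (csmooth_is_cderive x gs); rewrite mul0r add0r; exact.
Qed.

Lemma cderive1V g : csmooth g -> (forall x, g x != 0) ->
  cderive 1 (fun x => (g x)^-1) = fun x => - cderive 1 g x * ((g x)^-1 * (g x)^-1).
Proof.
move=> gs g0; have vs := csmoothV gs g0.
have := cderive1M gs vs.
rewrite (_ : (fun x => g x * _) = fun=> 1); last first.
  by apply/funext => x; rewrite divff.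
rewrite (is_cderive_cderive (fun x => is_cderive_cst x 1)) => E; apply/funext => x.
have /eqP := congr1 (fun f => f x) E; rewrite eq_sym addrC addr_eq0 => /eqP h.
by apply: (mulfI (g0 x)); rewrite h; field; exact: g0.
Qed.

Definition jet_le k g x (A : R) := forall j, (j <= k)%N -> modc (cderive j g x) <= A.

Lemma jet_leW k k' g x A B : (k' <= k)%N -> A <= B -> jet_le k g x A -> jet_le k' g x B.
Proof. by move=> kk AB H j jk; apply: le_trans AB; apply: H; exact: leq_trans kk. Qed.

Lemma jet_leS k g x A : jet_le k.+1 g x A -> jet_le k (cderive 1 g) x A.
Proof. by move=> H j jk; rewrite -cderiveS; exact: H. Qed.

Lemma jet_le_ge0 k g x A : jet_le k g x A -> 0 <= A.
Proof. by move=> /(_ 0%N isT); apply: le_trans; exact: modc_ge0. Qed.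

(** Each derivation of a product doubles the number of terms. The induction is on the order of one
    derivative, with the two factors varying. *)
Lemma jet_leM k g h x A B : csmooth g -> csmooth h -> jet_le k g x A -> jet_le k h x B ->
  jet_le k (fun x => g x * h x) x (2 ^+ k * (A * B)).
Proof.
move=> gs hs gA hB; have A0 := jet_le_ge0 gA; have B0 := jet_le_ge0 hB.
suff H j g' h' : csmooth g' -> csmooth h' -> jet_le j g' x A -> jet_le j h' x B ->
    modc (cderive j (fun x => g' x * h' x) x) <= 2 ^+ j * (A * B).
  move=> j jk; apply: (@le_trans _ _ (2 ^+ j * (A * B))).
    by apply: H => //; apply: jet_leW (lexx _) _; eassumption.
  by rewrite ler_wpM2r ?mulr_ge0// ler_weXn2l// ler1n.
elim: j g' h' => [|j IH] g' h' gs' hs' gA' hB'.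
  rewrite cderive0 expr0 mul1r normcM ler_pM ?modc_ge0//.
    by have := gA' 0%N isT; rewrite cderive0.
  by have := hB' 0%N isT; rewrite cderive0.
have dg := csmooth_cderive1 gs'; have dh := csmooth_cderive1 hs'.
rewrite cderiveS cderive1M// cderiveD; [|exact: csmoothM|exact: csmoothM].
apply: (le_trans (le_normcD _ _)).
have -> : 2 ^+ j.+1 * (A * B) = 2 ^+ j * (A * B) + 2 ^+ j * (A * B).
  by rewrite exprS; ring.
by apply: lerD; apply: IH => //; try exact: jet_leS; apply: jet_leW (lexx _) _; try eassumption.
Qed.

Lemma jet_leD k g h x A B : csmooth g -> csmooth h -> jet_le k g x A -> jet_le k h x B ->
  jet_le k (fun x => g x + h x) x (A + B).
Proof.
move=> gs hs gA hB j jk; rewrite cderiveD//.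
by apply: (le_trans (le_normcD _ _)); apply: lerD; [exact: gA|exact: hB].
Qed.

Lemma jet_leZ k (a : R[i]) g x A : csmooth g -> jet_le k g x A ->
  jet_le k (fun x => a * g x) x (modc a * A).
Proof.
by move=> gs gA j jk; rewrite cderiveZ// normcM ler_wpM2l ?modc_ge0//; exact: gA.
Qed.

Lemma csmooth_cont_bound g (a b : R) : csmooth g -> exists A, forall x, a <= x <= b -> modc (g x) <= A.
Proof.
move=> [g1 g2]; have [ab|ba] := leP a b; last first.
  by exists 0 => x /andP[h1 h2]; have := le_lt_trans (le_trans h1 h2) ba; rewrite ltxx.
have cont (u : R -> R) : rsmooth u -> {within `[a, b], continuous u}.
  move=> su; apply: derivable_within_continuous => x _; exact: rsmooth_derivable.
have bnd (u : R -> R) : rsmooth u -> exists A, forall x, a <= x <= b -> `|u x| <= A.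
  move=> su; have [c _ Hc] := EVT_max ab (cont u su).
  have [d _ Hd] := EVT_min ab (cont u su).
  exists (`|u c| + `|u d|) => x xab.
  have xi : x \in `[a, b] by rewrite in_itv.
  have h1 := Hc x xi; have h2 := Hd x xi.
  rewrite ler_norml; have := ler_norm (u c); have := normr_ge0 (u c).
  have := lerNnormlW (lexx `|u d|); have := normr_ge0 (u d).
  by move=> *; apply/andP; split; lra.
have [A HA] := bnd _ g1; have [B HB] := bnd _ g2.
exists (A + B) => x xab; apply: (le_trans (modc_le_ReIm _)).
by apply: lerD; [exact: HA|exact: HB].
Qed.

Lemma csmooth_jet_bound k g (a b : R) : csmooth g -> exists A, forall x, a <= x <= b -> jet_le k g x A.
Proof.
move=> gs; elim: k => [|k [A HA]].
  have [A HA] := csmooth_cont_bound a b gs.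
  by exists A => x xab j; rewrite leqn0 => /eqP ->; rewrite cderive0; exact: HA.
have [B HB] := csmooth_cont_bound a b (csmooth_cderive k.+1 gs).
exists (Num.max A B) => x xab j; rewrite leq_eqVlt => /orP[/eqP ->|jk].
  by rewrite le_max HB// orbT.
by rewrite le_max HA.
Qed.

End SmoothComplex.

Section Seminorms.
Context {R : realType}.
Implicit Types (t s : Cinfty R) (k : nat).

Definition pk k t : R := sup [set modc (cderive jx.1 t jx.2) | jx in
  [set jx : nat * R | (jx.1 <= k)%N /\ - k%:R <= jx.2 <= k%:R]].

Lemma pk_ge k t j x : (j <= k)%N -> - k%:R <= x <= k%:R -> modc (cderive j t x) <= pk k t.
Proof.
move=> jk xk; apply: ub_le_sup; last by exists (j, x).
have [A HA] := @csmooth_jet_bound R k t (- k%:R) k%:R (Cinfty_csmooth t).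
by exists A => _ [[i y] [/= ik yk] <-]; exact: HA.
Qed.

Lemma pk_jet_le k t x : - k%:R <= x <= k%:R -> jet_le k t x (pk k t).
Proof. by move=> xk j jk; exact: pk_ge. Qed.

Lemma pk_le k t A : (forall x, - k%:R <= x <= k%:R -> jet_le k t x A) -> pk k t <= A.
Proof.
move=> H; apply: ge_sup.
  exists (modc (cderive 0 t 0)); exists (0%N, 0) => //=; split => //.
  by rewrite oppr_le0 !ler0n.
by move=> _ [[j x] [/= jk xk] <-]; exact: H.
Qed.

Lemma pk_ge0 k t : 0 <= pk k t.
Proof.
apply: (le_trans (modc_ge0 (cderive 0 t 0))); apply: pk_ge => //.
by rewrite oppr_le0 !ler0n.
Qed.

Lemma pkD k s t : pk k (s + t) <= pk k s + pk k t.
Proof.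
apply: pk_le => x xk; rewrite (_ : Cinfty_fun (s + t) = fun x => s x + t x)//.
by apply: jet_leD; try exact: Cinfty_csmooth; exact: pk_jet_le.
Qed.

Lemma pkZ_le k (a : R[i]) t : pk k (a *: t) <= modc a * pk k t.
Proof.
apply: pk_le => x xk; rewrite (_ : Cinfty_fun (a *: t) = fun x => a * t x)//.
by apply: jet_leZ; [exact: Cinfty_csmooth|exact: pk_jet_le].
Qed.

Lemma pkZ k (a : R[i]) t : pk k (a *: t) = modc a * pk k t.
Proof.
apply/eqP; rewrite eq_le pkZ_le /=.
have [->|a0] := eqVneq a 0; first by rewrite normc0 mul0r pk_ge0.
have ma : 0 < modc a by rewrite modc_gt0.
rewrite -ler_pdivlMl// -normcV; have := pkZ_le k a^-1 (a *: t).
by rewrite scalerA mulVf// scale1r.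
Qed.

Lemma pk_mono k l t : (k <= l)%N -> pk k t <= pk l t.
Proof.
move=> kl; have kl' : k%:R <= l%:R :> R by rewrite ler_nat.
apply: pk_le => x /andP[h1 h2]; apply: jet_leW kl (lexx _) (pk_jet_le t _).
by apply/andP; split; lra.
Qed.

End Seminorms.

Section CinftyTopology.
Context {R : realType}.
Implicit Types (t s : Cinfty R) (k : nat).

Lemma entourage_complex (E : set (R[i] * R[i])) : entourage E ->
  exists2 d : R, 0 < d & forall z w, modc (w - z) < d -> E (z, w).
Proof.
rewrite -entourage_ballE => -[e /= e0 H].
have [d d0 dE] := gt0_realC e0; exists d => // z w zw.
by apply: H => /=; rewrite /ball /= normcC dE ltc_real modcB.
Qed.

Lemma entourage_modc (d : R) : 0 < d ->
  entourage [set zw : R[i] * R[i] | modc (zw.2 - zw.1) < d].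
Proof.
move=> d0; rewrite -entourage_ballE; exists d%:C => /=; first by rewrite ltc_real.
by move=> [z w] /=; rewrite /ball /= normcC ltc_real modcB.
Qed.

Lemma compact_in_itv (A : set R) : compact A -> exists k, forall x, A x -> - k%:R <= x <= k%:R.
Proof.
move=> /compact_bounded[M [_ HM]].
have [k Hk] : exists k : nat, M + 1 <= k%:R.
  exists (Num.bound `|M + 1|); apply: le_trans (ler_norm _) (ltW (archi_boundP _)).
  exact: normr_ge0.
exists k => x Ax; have := HM (M + 1) _ x Ax; rewrite ltrDl ltr01 => /(_ isT) h.
by rewrite -ler_norml; apply: le_trans h Hk.
Qed.

Lemma jet0 k : jet (0 : Cinfty R) k = fun=> 0.
Proof.
apply/funext => x; have [t0|//] := eqVneq (jet (0 : Cinfty R) k x) 0; first by rewrite t0.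
have := cderiveZ k (0 : R[i]) (@Cinfty_csmooth R 0).
rewrite (_ : (fun x => 0 * _) = (0 : Cinfty R) :> (R -> R[i])).
  by move=> /(congr1 (fun f => f x)); rewrite mul0r /jet => ->; rewrite eqxx.
by apply/funext => y; rewrite mul0r.
Qed.

(** The image under [jet] of the filter of seminorm balls converges to [jet 0]. As the topology is
    initial for [jet], this filter contains all neighborhoods of 0. *)
Lemma nbhs0_pk (U : set (Cinfty R)) : nbhs (0 : Cinfty R) U ->
  exists k, exists2 e : R, 0 < e & forall t, pk k t < e -> U t.
Proof.
pose G : set_system (Cinfty R) := filter_from [set ke : nat * R | 0 < ke.2]
  (fun ke => [set t | pk ke.1 t < ke.2]).
suff : forall U, nbhs (0 : Cinfty R) U -> G U.
  by move=> H /H[[k e] /= e0 He]; exists k, e.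
have FG : Filter G.
  apply: filter_from_filter; first by exists (0%N, 1) => /=; exact: ltr01.
  move=> [k d] [l e] /= d0 e0; exists (maxn k l, Num.min d e) => /=; first by rewrite lt_min d0.
  move=> t /=; rewrite lt_min => /andP[h1 h2]; split.
    by apply: le_lt_trans h1; apply: pk_mono; exact: leq_maxl.
  by apply: le_lt_trans h2; apply: pk_mono; exact: leq_maxr.
have cv : jet @ G --> jet (0 : Cinfty R).
  apply/pointwise_cvgP => j; rewrite -fam_cvgE; apply/fam_cvgP => A cA P.
  move=> /uniform_nbhs[E [/entourage_complex[d d0 Hd] EP]].
  have [k Hk] := compact_in_itv cA.
  exists (maxn j k, d) => //= t /= td; apply: EP => x Ax; apply: Hd.
  rewrite jet0 subr0; apply: le_lt_trans td; apply: pk_ge; first exact: leq_maxl.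
  have /andP[h1 h2] := Hk x Ax; have : k%:R <= (maxn j k)%:R :> R by rewrite ler_nat leq_maxr.
  by move=> h3; apply/andP; split; lra.
move=> {}U [Q [[/= B oB <-] B0 sub]]; apply: filterS sub _; apply: cv.
exact: open_nbhs_nbhs.
Qed.

Lemma pk_nbhs k t0 (e : R) : 0 < e -> nbhs t0 [set t | pk k (t - t0) < e].
Proof.
move=> e0; have e20 : 0 < e / 2 by rewrite divr_gt0.
have near j : nbhs t0 [set t | forall x, - k%:R <= x <= k%:R ->
    modc (cderive j t x - cderive j t0 x) < e / 2].
  have cj : {for t0, continuous (fun t => jet t j : {family compact, R -> R[i]})}.
    apply: (@continuous_comp _ _ _ (jet : Cinfty R -> {ptws nat -> {family compact, R -> R[i]}})
      (fun f => f j)); first exact: initial_continuous.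
    exact: (@proj_continuous nat (fun=> {family compact, R -> R[i]}) j).
  apply: (cj _ (@fam_nbhs R R[i] compact `[- k%:R, k%:R]%classic
    [set zw : R[i] * R[i] | modc (zw.2 - zw.1) < e / 2] _ _ _)).
    exact: entourage_modc.
  exact: segment_compact.
have near_le m : nbhs t0 [set t | forall j, (j <= m)%N -> forall x, - k%:R <= x <= k%:R ->
    modc (cderive j t x - cderive j t0 x) < e / 2].
  elim: m => [|m IH].
    by apply: filterS (near 0%N) => t Ht j; rewrite leqn0 => /eqP ->.
  apply: filterS (filterI IH (near m.+1)) => t [H1 H2] j.
  by rewrite leq_eqVlt => /orP[/eqP ->//|jm]; exact: H1.
apply: filterS (near_le k) => t Nt /=; apply: le_lt_trans (_ : e / 2 < e); last by lra.
apply: pk_le => x xk j jk.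
have -> : cderive j (t - t0) x = cderive j t x - cderive j t0 x.
  have := cderiveD j (Cinfty_csmooth t) (csmoothZ (-1) (Cinfty_csmooth t0)).
  rewrite cderiveZ; last exact: Cinfty_csmooth.
  rewrite (_ : (fun x => _ + _) = Cinfty_fun (t - t0)).
    by move=> ->; rewrite mulN1r.
  by apply/funext => y; rewrite mulN1r.
by apply: ltW; exact: Nt.
Qed.

End CinftyTopology.

Section Dual.
Context {R : realType}.
Implicit Types (t s : Cinfty R) (f g : dual R) (k : nat).

Lemma dual_linear f : linear f.
Proof. by case: f => f /= /asboolP[]. Qed.

Lemma dualD f s t : f (s + t) = f s + f t.
Proof. by have := dual_linear f 1 s t; rewrite !scale1r. Qed.

Lemma dual0 f : f 0 = 0.
Proof. by apply: (addrI (f 0)); rewrite -dualD !addr0. Qed.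

Lemma dualZ f (a : R[i]) t : f (a *: t) = a * f t.
Proof. by have := dual_linear f a t 0; rewrite addr0 dual0 addr0. Qed.

Lemma dualB f s t : f (s - t) = f s - f t.
Proof. by rewrite -scaleN1r dualD dualZ mulN1r. Qed.

Lemma dual_ext f g : (forall t, f t = g t) -> f = g.
Proof. by move=> fg; apply/val_inj/funext. Qed.

(** Some seminorm ball is mapped into the unit disc, and homogeneity turns this into a bound. *)
Lemma dual_bounded f : exists k, exists2 C : R, 0 < C & forall t, modc (f t) <= C * pk k t.
Proof.
have cf : continuous f by case: f => f /= /asboolP[].
have [k [e e0 He]] : exists k, exists2 e : R, 0 < e & forall t, pk k t < e -> modc (f t) < 1.
  apply: (nbhs0_pk (U := [set t | modc (f t) < 1])); apply: (cf 0 [set z : R[i] | modc z < 1]).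
  by apply/nbhs_complexP; exists 1 => // w; rewrite dual0 subr0.
exists k, (2 / e); first by rewrite divr_gt0.
move=> t; have [p0|p0] := eqVneq (pk k t) 0.
  (* All multiples of [t] are in the ball, which forces [f t] to be 0. *)
  rewrite p0 mulr0; apply/ler_addgt0Pr => d d0; rewrite add0r.
  have := He ((d^-1)%:C *: t); rewrite pkZ p0 mulr0 => /(_ e0).
  rewrite dualZ normcM modc_real gtr0_norm ?invr_gt0// ltr_pdivrMl// mulr1.
  exact: ltW.
have {}p0 : 0 < pk k t by rewrite lt_neqAle eq_sym p0 pk_ge0.
pose c := e / (2 * pk k t); have c0 : 0 < c by rewrite divr_gt0// mulr_gt0.
have := He (c%:C *: t); rewrite pkZ dualZ normcM modc_real gtr0_norm//.
have -> : c * pk k t = e / 2 by rewrite /c; field; rewrite gt_eqF.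
have e2 : e / 2 < e by lra.
move=> /(_ e2); rewrite -ltr_pdivlMl// mulr1 => /ltW /le_trans; apply.
by rewrite /c invf_div le_eqVlt; apply/orP; left; apply/eqP; ring.
Qed.

Lemma dual_of_linear (F : Cinfty R -> R[i]) k (C : R) : linear F ->
  (forall t, modc (F t) <= C * pk k t) -> F \in dual_pred.
Proof.
move=> lF FC; apply/asboolP; split => // t0 A /nbhs_complexP[d d0 HA].
have C1 : 0 < 1 + `|C| by rewrite ltr_wpDr.
apply: filterS (pk_nbhs k t0 (divr_gt0 d0 C1)) => t /= h; apply: HA.
have -> : F t - F t0 = F (t - t0).
  by rewrite [t - t0]addrC -[- t0]scaleN1r lF -[_ *: _]/(-1 * F t0) mulN1r addrC.
apply: le_lt_trans (FC _) _; rewrite ltr_pdivlMr// mulrC in h; apply: le_lt_trans h.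
by rewrite ler_wpM2r ?pk_ge0//; have := ler_norm C; lra.
Qed.

(** A set on which every [pk] is bounded is absorbed by all neighborhoods of 0, so it is among the
    sets of uniform convergence that define the strong topology. *)
Lemma dual_nbhs (B : set (Cinfty R)) f0 : (forall k, exists M : R, forall t, B t -> pk k t <= M) ->
  nbhs f0 [set f | forall t, B t -> modc (f t - f0 t) < 1].
Proof.
move=> bB.
have vB : @vN_bounded R[i] (Cinfty R) B.
  move=> U /nbhs0_pk[k [e e0 He]]; have [M HM] := bB k.
  have r0 : 0 < (1 + `|M|) / e by rewrite divr_gt0// ltr_wpDr.
  exists ((1 + `|M|) / e)%:C; first by rewrite ltc_real.
  move=> c; rewrite normcC lec_real => rc t Bt.
  have c0 : 0 < modc c by apply: lt_le_trans rc.
  have cN : c != 0 by rewrite -modc_gt0.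
  exists (c^-1 *: t); last by rewrite scalerA divff// scale1r.
  apply: He; rewrite pkZ normcV mulrC ltr_pdivrMr//.
  rewrite ler_pdivrMr// mulrC in rc; apply: lt_le_trans rc.
  by apply: (le_lt_trans (HM t Bt)); have := ler_norm M; lra.
have ct : {for f0, continuous (dual_fun : dual R -> {family @vN_bounded R[i] (Cinfty R), Cinfty R -> R[i]})}.
  exact: initial_continuous.
apply: (ct _ (@fam_nbhs (Cinfty R) R[i] (@vN_bounded R[i] (Cinfty R)) B
  [set zw : R[i] * R[i] | modc (zw.2 - zw.1) < 1] _ _ vB)).
exact: entourage_modc.
Qed.

End Dual.

(** * Distributions and their supports *)

Section Locality.
Context {R : realType}.
Implicit Types (t s : Cinfty R) (f : dual R) (k : nat).

Lemma cderive_near0 (g : R -> R[i]) (x d : R) j : 0 < d -> (forall y, `|y - x| < d -> g y = 0) ->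
  cderive j g x = 0.
Proof.
move=> d0 gx.
have [e e0 H] : exists2 e : R, 0 < e & forall y, `|y - x| < e -> cderive j g y = 0.
  elim: j => [|j [e e0 IH]]; first by exists d => // y yx; rewrite cderive0 gx.
  exists (e / 2); first by rewrite divr_gt0.
  move=> y yx; have near0 z : `|z - y| < e / 2 -> cderive j g z = 0.
    by move=> zy; apply: IH; have := ler_distD y z x; lra.
  have y0 : cderive j g y = 0 by apply: near0; rewrite subrr normr0 divr_gt0.
  have D (F : R[i] -> R) : F 0 = 0 -> is_derive y (1 : R) (F \o cderive j g) 0.
    move=> F0; apply/is_derive_epsP => r r0; exists (e / 2); first by rewrite divr_gt0.
    move=> h hd; rewrite /= near0 ?y0 ?F0 ?mul0r ?subr0 ?normr0 ?mulr_ge0// ?ltW//.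
    by rewrite addrC addKr.
  rewrite cderiveSr /cderive; apply: complex_eq.
    by rewrite /= derive1E; have [_ ->] := D (@complex.Re R) erefl.
  by rewrite /= derive1E; have [_ ->] := D (@complex.Im R) erefl.
by apply: H; rewrite subrr normr0.
Qed.

Lemma dual_eq0_near f k (C : R) t : (forall t, modc (f t) <= C * pk k t) ->
  (forall x, - k%:R <= x <= k%:R -> exists2 d : R, 0 < d & forall y, `|y - x| < d -> t y = 0) ->
  f t = 0.
Proof.
move=> fC H; have p0 : pk k t = 0.
  apply/eqP; rewrite eq_le pk_ge0 andbT; apply: pk_le => x /H[d d0 Hd] j _.
  by rewrite (cderive_near0 j d0 Hd) normc0.
by apply: eq0_normc; apply/eqP; rewrite eq_le modc_ge0 andbT; have := fC t; rewrite p0 mulr0.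
Qed.

Definition cmul t (g : R -> R[i]) (gs : csmooth g) : Cinfty R :=
  cinfty_of (csmoothM (Cinfty_csmooth t) gs).

Lemma dist_support_itv f k (C : R) : (forall t, modc (f t) <= C * pk k t) ->
  forall x, dist_support f x -> - k%:R <= x <= k%:R.
Proof.
move=> fC x sx; apply: contrapT => xk; apply: sx.
exists (~` `[- k%:R, k%:R]%classic); last by rewrite /= in_itv.
split.
  by rewrite openC; exact: itv_closed.
move=> t _ tU; apply: (dual_eq0_near fC) => y yk.
have : open (~` closure [set x | t x != 0]) by rewrite openC; exact: closed_closure.
rewrite openE => /(_ y)[].
  by move=> /tU /=; rewrite in_itv /= yk.
move=> d /= d0 Hd; exists d => // z zy; apply: contrapT => /eqP tz.
apply: (Hd z); first by rewrite /= distrC.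
exact: subset_closure.
Qed.

(** A sweep along the line replaces a partition of unity. [Z a] says that [f] kills every product of
    [t] with a smooth factor vanishing from some point before [a] on. It holds at [-k], and it
    extends across any point: near a point of the support [t] vanishes, and near any other point [f]
    does. *)
Lemma dual_local f t (U : set R) : open U -> dist_support f `<=` U ->
  (forall x, U x -> t x = 0) -> f t = 0.
Proof.
move=> oU sU tU; have [k [C C0 fC]] := dual_bounded f.
pose Z a := forall (g : R -> R[i]) (gs : csmooth g),
  (exists2 b, b < a & forall x, b <= x -> g x = 0) -> f (cmul t gs) = 0.
have step_split (g : R -> R[i]) (gs : csmooth g) (a b : R) : a < b ->
    exists (g1 g2 : R -> R[i]) (s1 : csmooth g1) (s2 : csmooth g2),
    [/\ forall s, f (cmul s gs) = f (cmul s s1) + f (cmul s s2),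
      forall x, b <= x -> g1 x = 0, forall x, x <= a -> g2 x = 0 &
      forall x, g x = 0 -> g1 x = 0 /\ g2 x = 0].
  move=> ab; have [s [ss _ s0 s1]] := smooth_step ab.
  have sr := csmooth_real ss.
  have h1 : csmooth (fun x => g x * (1 - (s x)%:C)).
    by apply: csmoothM => //; apply: csmoothB => //; exact: (csmooth_cst 1).
  have h2 : csmooth (fun x => g x * (s x)%:C) by apply: csmoothM.
  exists _, _, h1, h2; split.
  - move=> r; rewrite -dualD; congr (f _); apply/val_inj/funext => x.
    rewrite /= -[RHS]/(r x * (g x * (1 - (s x)%:C)) + r x * (g x * (s x)%:C)); ring.
  - by move=> x /s1 ->; rewrite subrr mulr0.
  - by move=> x /s0 ->; rewrite mulr0.
  - by move=> x ->; rewrite !mul0r.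
have Zk : Z (- k%:R).
  move=> g gs [b bk gb]; apply: (dual_eq0_near fC) => x /andP[kx _].
  exists (x - b); first by lra.
  by move=> y /ltr_normlP[h1 h2]; rewrite /= gb ?mulr0//; lra.
(* What remains of [t] beyond the cut vanishes near [[-k, k]], so [f] does not see it. *)
have Zend a : k%:R < a -> Z a -> f t = 0.
  move=> ka Za; have c1 := csmooth_cst (1 : R[i]).
  have [|g1 [g2 [s1 [s2 [E h1 h2 _]]]]] := step_split _ c1 (k%:R + (a - k%:R) / 3) (k%:R + (a - k%:R) / 2).
    by lra.
  have -> : t = cmul t c1 by apply/val_inj/funext => x /=; rewrite mulr1.
  rewrite E Za; last first.
    by exists (k%:R + (a - k%:R) / 2); first lra.
  rewrite add0r; apply: (dual_eq0_near fC) => x /andP[_ xk].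
  exists ((a - k%:R) / 3); first by lra.
  by move=> y /ltr_normlP[h3 h4]; rewrite /= h2 ?mulr0//; lra.
have [[a [ka Za]]|none] := pselect (exists a, k%:R < a /\ Z a); first exact: (Zend a).
have Zub a : Z a -> a <= k%:R.
  by move=> Za; rewrite leNgt; apply/negP => ka; apply: none; exists a.
pose m := sup Z.
have hsZ : has_sup Z by split; [exists (- k%:R)|exists k%:R => a; exact: Zub].
have mub a : Z a -> a <= m by move=> Za; apply: ub_le_sup => //; exact: hsZ.2.
have [d d0 Hd] : exists2 d : R, 0 < d & forall (g : R -> R[i]) (gs : csmooth g) (a b : R),
    m - d < a -> b < m + d -> (forall x, x <= a -> g x = 0) -> (forall x, b <= x -> g x = 0) ->
    f (cmul t gs) = 0.
  have [mf|mf] := pselect (dist_support f m).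
    have := oU; rewrite openE => /(_ m (sU m mf))[d /= d0 Hd]; exists d => //.
    move=> g gs a b ma bm ga gb; rewrite (_ : cmul t gs = 0) ?dual0//.
    apply/val_inj/funext => x; rewrite /= -[RHS]/(0 : R[i]).
    have [xa|xa] := leP x a; first by rewrite ga ?mulr0.
    have [xb|xb] := leP b x; first by rewrite gb ?mulr0.
    rewrite tU ?mul0r//; apply: Hd => /=; rewrite ltr_norml; apply/andP; split; lra.
  have [W [oW HW] Wm] : exists2 W, open W /\ forall t : Cinfty R,
      compact (closure [set x | t x != 0]) -> closure [set x | t x != 0] `<=` W -> f t = 0 & W m.
    by apply: contrapT => H; apply: mf => -[W [oW HW] Wm]; apply: H; exists W.
  have := oW; rewrite openE => /(_ m Wm)[d /= d0 Hd]; exists d => //.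
  move=> g gs a b ma bm ga gb.
  have sub : closure [set x | cmul t gs x != 0] `<=` `[a, b]%classic.
    rewrite closureE; apply: smallest_sub; first exact: itv_closed.
    move=> x /=; apply: contraNT; rewrite in_itv /= negb_and -!ltNge => /orP[] h.
      by rewrite ga ?mulr0// ltW.
    by rewrite gb ?mulr0// ltW.
  apply: HW; first by apply: subclosed_compact sub; [exact: closed_closure|exact: segment_compact].
  move=> x /sub; rewrite /= in_itv /= => /andP[ax xb]; apply: Hd => /=.
  by rewrite ltr_norml; apply/andP; split; lra.
have [a Za am] : exists2 a, Z a & m - d / 2 < a.
  by have [|a] := @sup_adherent _ Z (d / 2) _ hsZ; [rewrite divr_gt0|exists a].
(* Cutting the factor between [m - 3 / 4 * d] and [m - d / 2] leaves a part covered by [Z a] and a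
   part supported within [d] of [m], so [Z] would pass beyond its supremum. *)
have : Z (m + d / 2); last by move=> /mub h; exfalso; lra.
move=> g gs [b bm gb].
have [|g1 [g2 [s1 [s2 [E h1 h2 h3]]]]] := step_split g gs (m - 3 / 4 * d) (m - d / 2); first by lra.
rewrite E Za; last by exists (m - d / 2).
rewrite add0r; apply: (Hd _ _ (m - 3 / 4 * d) b) => //; try lra.
by move=> x /gb/h3[].
Qed.

End Locality.

(** * The Cauchy kernel *)

Section CauchyKernel.
Context {R : realType}.
Implicit Types (k L : nat) (w v : R[i]) (f : dual R).

Lemma cutoff_id L : exists tau : R -> R, [/\ rsmooth tau,
  forall x, `|x| <= L%:R + 1/2 -> tau x = x & forall x, `|tau x| <= L%:R + 1].
Proof.
have [|s [ss s01 s0 s1]] := @smooth_step R (L%:R + 1/2) (L%:R + 1); first by lra.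
have hm : rsmooth (fun x => s (-1 * x + 0)) by exact: rsmooth_affine.
exists (fun x => x * ((1 - s x) * (1 - s (-1 * x + 0)))); split.
- apply: rsmoothM; first exact: rsmooth_id.
  by apply: rsmoothM; apply: rsmoothB => //; exact: rsmooth_cst.
- by move=> x /ler_normlP[h1 h2]; rewrite !s0 ?subr0 ?mulr1//; lra.
move=> x; have [xL|xL] := leP `|x| (L%:R + 1).
  have /andP[a1 a2] := s01 x; have /andP[b1 b2] := s01 (-1 * x + 0).
  rewrite normrM; apply: le_trans xL; rewrite ler_piMr//.
  rewrite ger0_norm ?mulr_ge0 ?subr_ge0// mulr_ile1 ?subr_ge0//; lra.
have L0 : 0 <= L%:R :> R by rewrite ler0n.
have [x0|x0] := leP 0 x.
  rewrite ger0_norm// in xL; rewrite (s1 x) ?(ltW xL)//.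
  by rewrite subrr mul0r mulr0 normr0; lra.
rewrite ltr0_norm// in xL; rewrite (s1 (-1 * x + 0)); last by lra.
by rewrite subrr !mulr0 normr0; lra.
Qed.

(* A bounded smooth function that is the identity near [-L, L], so that
   [(w - tau L x)^-1] is smooth on the whole line as soon as [w] is [far]. *)
Definition tau L : R -> R := sval (cid (cutoff_id L)).

Lemma tau_rsmooth L : rsmooth (tau L).
Proof. by rewrite /tau; case: cid => ? []. Qed.

Lemma tau_id L x : `|x| <= L%:R + 1/2 -> tau L x = x.
Proof. by rewrite /tau; case: cid => ? [] /= _ H _; exact: H. Qed.

Lemma tau_bound L x : `|tau L x| <= L%:R + 1.
Proof. by rewrite /tau; case: cid => ? []. Qed.

(** All values of [tau L] lie in this interval, so [d] bounds the denominator of [kap] from below on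
    the whole line. *)
Definition far L w (d : R) := forall y : R, `|y| <= L%:R + 1 -> d <= modc (w - y%:C).

Definition kap L w (x : R) : R[i] := (w - (tau L x)%:C)^-1.

Lemma far_neq0 L w d x : 0 < d -> far L w d -> w - (tau L x)%:C != 0.
Proof. by move=> d0 fw; rewrite -modc_gt0; apply: lt_le_trans d0 (fw _ (tau_bound _ _)). Qed.

Lemma csmooth_kap L w d : 0 < d -> far L w d -> csmooth (kap L w).
Proof.
move=> d0 fw; apply: csmoothV => [|x]; last exact: far_neq0 fw.
by apply: csmoothB; [exact: csmooth_cst|apply: csmooth_real; exact: tau_rsmooth].
Qed.

Lemma kap_modc L w d x : 0 < d -> far L w d -> modc (kap L w x) <= d^-1.
Proof.
move=> d0 fw; have h := fw _ (tau_bound L x).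
by rewrite normcV lef_pV2 ?posrE//; apply: lt_le_trans h.
Qed.

Lemma cderive1_kap L w d : 0 < d -> far L w d -> cderive 1 (kap L w) =
  fun x => (derive1 (tau L) x)%:C * (kap L w x * kap L w x).
Proof.
move=> d0 fw; have s1 := csmooth_cst w; have s2 := csmooth_real (tau_rsmooth L).
rewrite cderive1V; [|exact: csmoothB|by move=> x; exact: far_neq0 fw].
apply/funext => x; congr (_ * _).
have h1 := is_cderive_cst x w; have h2 := is_cderiveM (is_cderive_cst x (-1)) (csmooth_is_cderive x s2).
have := is_cderiveD h1 h2; rewrite add0r mul0r add0r mulN1r.
rewrite (_ : (fun x => _ + _) = fun x => w - (tau L x)%:C); last first.
  by apply/funext => y; rewrite mulN1r.
move=> [h3 h4]; rewrite -[RHS]opprK; congr (- _); apply: complex_eq.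
  rewrite /cderive /= derive1E; have [_ ->] := h3.
  by rewrite cReN /cderive /=.
rewrite /cderive /= derive1E; have [_ ->] := h4.
rewrite cImN /cderive /= (_ : _ \o _ = fun=> 0)// ?oppr0.
by rewrite (is_derive_derive1 (fun x => is_derive_cst 0 x 1)) oppr0.
Qed.

(** The derivative of [kap] is that of [tau] times the square of [kap], so each order squares the
    previous power of [A]. The exponent [2 ^ k] is far from optimal, but any power of the inverse
    distance will do. *)
Lemma kap_jet_le k L : exists2 C : R, 0 < C & forall w d A, 0 < d -> far L w d ->
  1 <= A -> d^-1 <= A -> forall x, - k%:R <= x <= k%:R -> jet_le k (kap L w) x (C * A ^+ (2 ^ k)).
Proof.
have sd : csmooth (fun x => (derive1 (tau L) x)%:C) by apply: csmooth_real; apply: rsmooth_derive1; exact: tau_rsmooth.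
have [T HT] := csmooth_jet_bound k (- k%:R) k%:R sd.
suff : forall m, (m <= k)%N -> exists2 C : R, 0 < C & forall w d A, 0 < d -> far L w d ->
  1 <= A -> d^-1 <= A -> forall x, - k%:R <= x <= k%:R -> jet_le m (kap L w) x (C * A ^+ (2 ^ m)).
  by move=> /(_ k (leqnn k)).
elim=> [_|m IH mk].
  exists 1; first exact: ltr01.
  move=> w d A d0 fw A1 dA x _ j; rewrite leqn0 => /eqP ->.
  by rewrite cderive0 mul1r; apply: le_trans (kap_modc x d0 fw) dA.
have [C C0 HC] := IH (ltnW mk).
pose D := 2 ^+ m * (`|T| * (2 ^+ m * (C * C))).
have D0 : 0 <= D by rewrite !mulr_ge0 ?exprn_ge0// ltW.
exists (C + D); first by rewrite ltr_pwDl.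
move=> w d A d0 fw A1 dA x xk j; rewrite leq_eqVlt => /orP[/eqP ->|jm].
  have sk := csmooth_kap d0 fw.
  rewrite cderiveS (cderive1_kap d0 fw).
  have hk := HC w d A d0 fw A1 dA x xk.
  have hT : jet_le m (fun x => (derive1 (tau L) x)%:C) x `|T|.
    by apply: jet_leW (ltnW mk) (ler_norm T) (HT x xk).
  have := jet_leM sd (csmoothM sk sk) hT (jet_leM sk sk hk hk) (leqnn m).
  move=> /le_trans; apply.
  rewrite (_ : _ * _ = D * A ^+ (2 ^ m.+1)); last first.
    by rewrite /D expnS mul2n -addnn exprD; ring.
  by apply: ler_wpM2r; [rewrite exprn_ge0//; lra|rewrite lerDr ltW].
apply: (le_trans (HC w d A d0 fw A1 dA x xk j jm)).
apply: ler_pM; [exact: ltW|rewrite exprn_ge0//; lra|by rewrite lerDl|].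
by apply: ler_weXn2l => //; rewrite leq_exp2l.
Qed.

(* 0 (a junk value) unless the kernel is smooth, see [KapE]. *)
Definition Kap L w : Cinfty R :=
  if pselect (csmooth (kap L w)) is left ks then cinfty_of ks else 0.

Lemma KapE L w d : 0 < d -> far L w d -> Kap L w = kap L w :> (R -> R[i]).
Proof. by move=> d0 fw; rewrite /Kap; case: pselect => // -[]; exact: csmooth_kap fw. Qed.

Lemma pk_Kap k L : exists2 C : R, 0 < C & forall w d A, 0 < d -> far L w d ->
  1 <= A -> d^-1 <= A -> pk k (Kap L w) <= C * A ^+ (2 ^ k).
Proof.
have [C C0 H] := kap_jet_le k L; exists C => // w d A d0 fw A1 dA.
by apply: pk_le => x xk; rewrite (KapE d0 fw); exact: (H w d).
Qed.

(** Second-order resolvent identity: [kap (w + v) - kap w + v * kap w ^+ 2] equals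
    [v ^+ 2 * kap w ^+ 2 * kap (w + v)]. So [D] is minus the value of [f] at [kap w ^+ 2]. *)
Lemma cauchy_transform_taylor f k L (C d : R) : 0 < d -> 0 <= C ->
  (forall t, modc (f t) <= C * pk k t) ->
  exists2 M : R, 0 <= M & forall w, far L w d -> exists D : R[i], forall v, far L (w + v) d ->
    modc (f (Kap L (w + v)) - f (Kap L w) - v * D) <= M * modc v ^+ 2.
Proof.
move=> d0 C0 fC; have [B0 B00 HB0] := kap_jet_le k L.
pose A := Num.max 1 d^-1; pose B := B0 * A ^+ (2 ^ k).
have A1 : 1 <= A by rewrite le_max lexx.
have dA : d^-1 <= A by rewrite le_max lexx orbT.
have HB w : far L w d -> forall x, - k%:R <= x <= k%:R -> jet_le k (kap L w) x B.
  by move=> fw; exact: (HB0 w d).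
have B_ge0 : 0 <= B by apply: mulr_ge0; [exact: ltW|rewrite exprn_ge0//; lra].
pose M := C * (2 ^+ k * (2 ^+ k * (B * B) * B)).
have k0 : 0 <= 2 ^+ k :> R by exact: exprn_ge0.
exists M; first by do ! (apply: mulr_ge0 => //).
move=> w fw; have s := csmooth_kap d0 fw; have s2 := csmoothM s s.
exists (- f (cinfty_of s2)) => v fv; have sv := csmooth_kap d0 fv.
have sE : Kap L (w + v) - Kap L w + v *: cinfty_of s2 = (v ^+ 2) *: cinfty_of (csmoothM s2 sv).
  apply/val_inj/funext => x.
  rewrite -[LHS]/(Kap L (w + v) x - Kap L w x + v * (kap L w x * kap L w x)).
  rewrite -[RHS]/(v ^+ 2 * (kap L w x * kap L w x * kap L (w + v) x)).
  rewrite (KapE d0 fw) (KapE d0 fv) /kap.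
  have n1 := far_neq0 x d0 fw; have n2 := far_neq0 x d0 fv.
  set y := (tau L x)%:C in n1 n2 *; field.
  by rewrite n1 n2.
have -> : f (Kap L (w + v)) - f (Kap L w) - v * - f (cinfty_of s2) =
   v ^+ 2 * f (cinfty_of (csmoothM s2 sv)).
  by rewrite -dualZ -sE dualD dualB dualZ mulrN opprK.
rewrite normcM modcX mulrC ler_wpM2r ?sqr_ge0//.
apply: (le_trans (fC _)); rewrite ler_wpM2l//; apply: pk_le => x xk.
have hw := HB w fw x xk; have hv := HB _ fv x xk.
exact: (jet_leM s2 sv (jet_leM s s hw hw) hv).
Qed.

End CauchyKernel.

Section Embedding.
Context {R : realType} (e : ends).
Implicit Types (k n : nat) (p q : R[i] * R[i]) (f : dual R).

(* The constant of the partial fraction decomposition [rho_kernel]. *)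
Definition cauchy_cst : R[i] := (2 * (pi : R)%:C * 'i%C)^-1.
Definition wminus p : R[i] := p.1 - 'i%C * p.2.
Definition wplus p : R[i] := p.1 + 'i%C * p.2.

Lemma imul_i : 'i%C * 'i%C = -1 :> R[i].
Proof. by apply: complex_eq; rewrite /=; ring. Qed.

Lemma pi_neq0C : (pi : R)%:C != 0 :> R[i].
Proof. by rewrite -modc_gt0 modc_real normr_gt0 gt_eqF// pi_gt0. Qed.

Lemma i_neq0 : ('i%C : R[i]) != 0.
Proof. by rewrite -modc_gt0 modci ltr01. Qed.

Lemma two_neq0 : (2 : R[i]) != 0.
Proof. by rewrite pnatr_eq0. Qed.

Lemma rho_kernel (z zeta y : R[i]) : zeta != 0 -> z - 'i%C * zeta - y != 0 ->
  z + 'i%C * zeta - y != 0 ->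
  rho_ zeta (z - y) = cauchy_cst * ((z - 'i%C * zeta - y)^-1 - (z + 'i%C * zeta - y)^-1).
Proof.
move=> z0 a0 b0; rewrite /rho_ /rho /cauchy_cst.
have i2 := imul_i; have P0 := pi_neq0C; have I0 := i_neq0; have T0 := two_neq0.
move: P0; move: (pi : R)%:C => P P0.
have E : 1 + ((z - y) / zeta) ^+ 2 = (z - 'i%C * zeta - y) * (z + 'i%C * zeta - y) / zeta ^+ 2.
  rewrite (_ : (z - 'i%C * zeta - y) * _ = (z - y) ^+ 2 - 'i%C * 'i%C * zeta ^+ 2); last by ring.
  by rewrite i2; field.
rewrite E; move: 'i%C i2 I0 a0 b0 {E} => I i2 I0 a0 b0.
by field; rewrite ?P0 ?I0 ?z0 ?a0 ?b0 ?T0.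
Qed.

Lemma cos_ge1B (x : R) : 0 <= x -> 1 - x <= cos x.
Proof.
move=> x0; have [c _ E] := @mvt R cos (fun t => - sin t) 0 x x0 (fun t _ => is_derive_cos t).
rewrite cos0 subr0 in E; have := sin_le1 c => s1.
have : sin c * x <= 1 * x by rewrite ler_wpM2r.
lra.
Qed.

(** In [Aset], [Re zeta] is at least 3/4 of the modulus of [zeta] and [Im z] at most 1/4 of it in
    absolute value, so the imaginary parts of both points are at least half of it in absolute value.
    In [Bset], [Re z] is beyond [k + 2] on one side and [zeta] is smaller than 1/4. *)
Lemma Vset_far n k p : (4 <= n)%N -> (k + 2 <= n)%N -> Vset e n p ->
  far k (wminus p) (modc p.2 / 2) /\ far k (wplus p) (modc p.2 / 2).
Proof.
move=> n4 nk Vp; have n0 : (0 < n)%N by exact: leq_trans n4.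
have i4 : n%:R^-1 <= 4^-1 :> R by rewrite lef_pV2 ?posrE ?ltr0n ?ler_nat.
have i0 : 0 <= n%:R^-1 :> R by rewrite invr_ge0 ler0n.
have nk' : k%:R + 2 <= n%:R :> R by rewrite -natrD ler_nat.
have /andP[p0 pn] := Vset_modc Vp.
have key (s : R) (y : R) : s = 1 \/ s = -1 -> `|y| <= k%:R + 1 ->
    modc p.2 / 2 <= modc (p.1 + s%:C * ('i%C * p.2) - y%:C).
  move=> s1 /ler_normlP[y1 y2].
  have h1 := Re_le_modc (p.1 + s%:C * ('i%C * p.2) - y%:C).
  have h2 := Im_le_modc (p.1 + s%:C * ('i%C * p.2) - y%:C).
  rewrite !(cReD, cReN, cImD, cImN, cReM, cImM) /= in h1 h2.
  have /ler_normlP[a1 a2] := Re_le_modc p.2; have /ler_normlP[b1 b2] := Im_le_modc p.2.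
  move: h1 h2; rewrite !ler_norml => /andP[h1 h1'] /andP[h2 h2'].
  case: Vp => -[xO].
    move=> ar _ /ltr_normlP[ip ip'].
    rewrite (arg_cond n0 p0) in ar; have c1 := cos_ge1B i0.
    have c2 : (1 - n%:R^-1) * modc p.2 <= cos n%:R^-1 * modc p.2 by rewrite ler_wpM2r// ltW.
    have c3 : n%:R^-1 * modc p.2 <= 4^-1 * modc p.2 by rewrite ler_wpM2r// ltW.
    by case: s1 => ?; subst s; lra.
  move=> _ _; have : n%:R < Re p.1 \/ Re p.1 < - n%:R.
    by case: (e) xO => /=; [case; [right|left]|right|left].
  by case=> hx; case: s1 => ?; subst s; lra.
split=> y yk.
  by have := key (-1) y (or_intror erefl) yk; rewrite rmorphN1 mulN1r.
by have := key 1 y (or_introl erefl) yk; rewrite rmorph1 mul1r.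
Qed.

Section Regularize.
Variables (f : dual R) (k : nat) (C : R).
Hypothesis fC : forall t, modc (f t) <= C * pk k t.
Variables (n : nat) (n4 : (4 <= n)%N) (nk : (k + 2 <= n)%N).

Definition reg_kernel p : Cinfty R := cauchy_cst *: (Kap k (wminus p) - Kap k (wplus p)).

Lemma reg_extends p : Vset e n p -> extends_near (dist_support f)
  (fun lambda : R => rho_ p.2 (p.1 - lambda%:C)) (reg_kernel p).
Proof.
move=> Vp; have [fm fp] := Vset_far n4 nk Vp; have /andP[p0 _] := Vset_modc Vp.
have d0 : 0 < modc p.2 / 2 by rewrite divr_gt0.
have Lr : 0 <= k%:R :> R by rewrite ler0n.
exists `]- k%:R - 1/2, k%:R + 1/2[%classic.
  split; first exact: itv_open.
  by move=> x /(dist_support_itv fC); rewrite /= in_itv /=; lra.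
move=> x; rewrite /= in_itv /= => xk.
have xk' : `|x| <= k%:R + 1/2 by rewrite ler_norml; lra.
have tx := tau_id xk'.
have n1 := far_neq0 x d0 fm; have n2 := far_neq0 x d0 fp; rewrite tx in n1 n2.
rewrite rho_kernel -?modc_gt0//; last 2 first.
- by rewrite modc_gt0.
- by rewrite modc_gt0.
rewrite -[LHS]/(cauchy_cst * (Kap k (wminus p) x - Kap k (wplus p) x)).
by rewrite (KapE d0 fm) (KapE d0 fp) /kap tx.
Qed.

(** [pairing] selects an unspecified extension; it agrees with [reg_kernel p] near the support, so
    [dual_local] gives the same value. *)
Lemma regularizeE p : Vset e n p ->
  regularize f p = cauchy_cst * (f (Kap k (wminus p)) - f (Kap k (wplus p))).
Proof.
move=> Vp; have ext := reg_extends Vp.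
have [U [oU sU] HU] := ext.
rewrite -dualB -dualZ /regularize /pairing; case: xgetP => [y _|]; last first.
  by move=> /(_ (f (reg_kernel p))); case; exists (reg_kernel p).
move=> [t [W [oW sW] HW] <-]; apply/eqP; rewrite -subr_eq0 -dualB; apply/eqP.
apply: (dual_local (openI oU oW)) => [x sx|x [Ux Wx]]; first by split; [exact: sU|exact: sW].
by rewrite -[LHS]/(t x - reg_kernel p x) HU// HW// subrr.
Qed.

Lemma regularize_defined_Vset p : Vset e n p -> regularize_defined f p.
Proof. by move=> Vp; exists (reg_kernel p); exact: reg_extends. Qed.

End Regularize.

(** The index [2 ^ k.+2] is at least 4 and [k + 2], as [Vset_far] requires, and at least the
    exponent [2 ^ k] of the kernel bound. [A] is chosen before [f], which continuity will need. *)
Lemma regularize_step k : exists2 A : R, 0 < A & forall f (C : R), 0 <= C ->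
  (forall t, modc (f t) <= C * pk k t) ->
  exists2 h : @step R e (pow2 k.+2), Hnorm h <= A * C &
    forall p, Vset e (pow2 k.+2) p -> h p = regularize f p.
Proof.
have [B B0 HB] := @pk_Kap R k k.
have N0 := pow2_gt0 k.+2.
have N4 : (4 <= pow2 k.+2)%N.
  by rewrite pow2E -[4%N]/(2 ^ 2)%N leq_exp2l.
have Nk : (k + 2 <= pow2 k.+2)%N by rewrite pow2E addn2 ltnW// ltn_expl.
pose A := modc cauchy_cst * (2 * (B * 2 ^+ (2 ^ k))) + 1.
have A0 : 0 < A.
  by rewrite ltr_wpDl// !mulr_ge0 ?modc_ge0 ?exprn_ge0// ltW.
exists A => // f C C0 fC.
pose F p := cauchy_cst * (f (Kap k (wminus p)) - f (Kap k (wplus p))).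
have bound w p : Vset e (pow2 k.+2) p -> far k w (modc p.2 / 2) ->
    modc (f (Kap k w)) <= C * (B * 2 ^+ (2 ^ k)) / modc p.2 ^+ (2 ^ k).
  move=> Vp fw; have /andP[p0 p1] := Vset_modc_lt1 N0 Vp.
  have d0 : 0 < modc p.2 / 2 by rewrite divr_gt0.
  apply: (le_trans (fC _)); rewrite -!mulrA ler_wpM2l// mulrA.
  have a1 : 1 <= 2 / modc p.2 by rewrite ler_pdivlMr//; lra.
  have := HB w _ _ d0 fw a1; rewrite invf_div => /(_ (lexx _))/le_trans; apply.
  by rewrite expr_div_n mulrA.
have bF p : Vset e (pow2 k.+2) p ->
    modc (F p) <= A * C * pow_weight (pow2 k.+2) (Re p.1) / modc p.2 ^+ pow2 k.+2.
  move=> Vp; have [fm fp] := Vset_far N4 Nk Vp; have /andP[p0 p1] := Vset_modc_lt1 N0 Vp.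
  have bm := bound _ _ Vp fm; have bp := bound _ _ Vp fp.
  rewrite /F normcM; apply: (@le_trans _ _ (A * C / modc p.2 ^+ (2 ^ k))).
    apply: (@le_trans _ _ (modc cauchy_cst * (2 * (C * (B * 2 ^+ (2 ^ k)) / modc p.2 ^+ (2 ^ k))))).
      by rewrite ler_wpM2l ?modc_ge0//; apply: (le_trans (le_modcB _ _)); lra.
    have -> : modc cauchy_cst * (2 * (C * (B * 2 ^+ (2 ^ k)) / modc p.2 ^+ (2 ^ k))) =
      (A - 1) * C / modc p.2 ^+ (2 ^ k) by rewrite /A; ring.
    rewrite ler_wpM2r ?invr_ge0 ?exprn_ge0 ?modc_ge0// ler_wpM2r//; lra.
  rewrite -[leRHS]mulrA ler_wpM2l ?mulr_ge0 ?(ltW A0)//.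
  rewrite -[leLHS]mul1r; apply: ler_pM => //.
  - by rewrite invr_ge0 exprn_ge0// modc_ge0.
  - exact: pow_weight_ge1.
  - rewrite lef_pV2 ?posrE ?exprn_gt0// ler_wiXn2l ?modc_ge0 ?(ltW p1)//.
    by rewrite pow2E leq_exp2l// -addn2 leq_addr.
have dF p : Vset e (pow2 k.+2) p -> exists a b, cdiff F p a b.
  move=> Vp; have [fm fp] := Vset_far N4 Nk Vp; have /andP[p0 p1] := Vset_modc_lt1 N0 Vp.
  have d0 : 0 < modc p.2 / 4 by rewrite divr_gt0.
  have [M M0 HM] := @cauchy_transform_taylor R f k k C _ d0 C0 fC.
  (* Half of the margin of [Vset_far] is given up, so that one Taylor constant serves for all small
     increments. *)
  have far4 w v : far k w (modc p.2 / 2) -> modc v <= modc p.2 / 4 -> far k (w + v) (modc p.2 / 4).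
    move=> fw vp y yk; have := fw y yk; have := le_dist_modc (w - y%:C) (- v).
    by rewrite normcN opprK (_ : w - y%:C + v = w + v - y%:C); [lra|ring].
  have [|Dm HDm] := HM (wminus p).
    by rewrite -[wminus p]addr0; apply: far4 => //; rewrite normc0 ltW.
  have [|Dp HDp] := HM (wplus p).
    by rewrite -[wplus p]addr0; apply: far4 => //; rewrite normc0 ltW.
  exists (cauchy_cst * (Dm - Dp)), (cauchy_cst * (- 'i%C * Dm - 'i%C * Dp)).
  apply: (@cdiff_taylor _ _ _ _ _ (modc cauchy_cst * (M + M)) (modc p.2 / 4)) => //.
    by rewrite mulr_ge0 ?modc_ge0// addr_ge0.
  move=> v1 v2 vd; set s := modc v1 + modc v2 in vd *.
  have vm : modc (v1 - 'i%C * v2) <= s.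
    by apply: (le_trans (le_modcB _ _)); rewrite normcM modci mul1r.
  have vp : modc (v1 + 'i%C * v2) <= s.
    by apply: (le_trans (le_normcD _ _)); rewrite normcM modci mul1r.
  have Em : wminus (p.1 + v1, p.2 + v2) = wminus p + (v1 - 'i%C * v2) by rewrite /wminus /=; ring.
  have Ep : wplus (p.1 + v1, p.2 + v2) = wplus p + (v1 + 'i%C * v2) by rewrite /wplus /=; ring.
  have := HDm _ (far4 _ _ fm (le_trans vm vd)); have := HDp _ (far4 _ _ fp (le_trans vp vd)).
  rewrite /F Em Ep.
  set X := _ - _ - _; set Y := _ - _ - _ => hX hY.
  rewrite (_ : _ - _ - _ = cauchy_cst * (Y - X)); last by rewrite /X /Y; ring.
  rewrite normcM -mulrA ler_wpM2l ?modc_ge0//; apply: (le_trans (le_modcB _ _)).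
  have s2 z : modc z <= s -> M * modc z ^+ 2 <= M * s ^+ 2.
    by move=> zs; rewrite ler_wpM2l// lerXn2r ?nnegrE ?modc_ge0 ?addr_ge0 ?modc_ge0.
  by have := s2 _ vm; have := s2 _ vp; lra.
have [h Hh] := Hspace_ex N0 dF bF.
exists h; last by move=> p Vp; rewrite Hh// (regularizeE fC N4 Nk).
apply: Hnorm_le_val => [|p Vp]; first by rewrite mulr_ge0// ltW.
by rewrite Hh//; exact: bF.
Qed.

End Embedding.

(** * Injectivity *)

Section Weierstrass.
Context {R : realType}.
Implicit Types (u P : R -> R).

Definition polysum (s : seq (R * nat)) (x : R) : R := \sum_(p <- s) p.1 * x ^+ p.2.

Definition polyf P := exists s, P = polysum s.

Lemma polyf_cst (a : R) : polyf (fun=> a).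
Proof.
by exists [:: (a, 0%N)]; apply/funext => x; rewrite /polysum big_seq1 expr0 mulr1.
Qed.

Lemma polyfD P Q : polyf P -> polyf Q -> polyf (fun x => P x + Q x).
Proof.
by move=> [s ->] [t ->]; exists (s ++ t); apply/funext => x; rewrite /polysum big_cat.
Qed.

Lemma polyf_affine P (a b : R) : polyf P -> polyf (fun x => (a * x + b) * P x).
Proof.
move=> [s ->]; exists ([seq (a * p.1, p.2.+1) | p <- s] ++ [seq (b * p.1, p.2) | p <- s]).
apply/funext => x; rewrite /polysum big_cat !big_map /= mulrDl !mulr_sumr.
by congr (_ + _); apply: eq_bigr => p _; rewrite ?exprS; ring.
Qed.

Lemma is_derive_monomial (c : R) n (x : R) :
  is_derive x (1 : R) (fun x => c / n.+1%:R * x ^+ n.+1) (c * x ^+ n).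
Proof.
have hx : is_derive x (1 : R) (fun x => x ^+ n.+1) (n.+1%:R * x ^+ n).
  elim: n => [|n IH].
    rewrite expr0 mulr1 (_ : (fun x => _) = id); first exact: is_derive_id.
    by apply/funext => y; rewrite expr1.
  rewrite (_ : (fun x => _) = (fun x => x ^+ n.+1 * id x)); last first.
    by apply/funext => y; rewrite exprSr.
  apply: is_derive_eq; rewrite -![_ *: _]/(_ * _) /= -(natr1 n.+1) exprSr; ring.
apply: is_derive_eq; rewrite -![_ *: _]/(_ * _); field.
by rewrite ?natr1 ?nat1r pnatr_eq0.
Qed.

Lemma polyf_prim P : polyf P -> exists2 Q, polyf Q & forall x, is_derive x (1 : R) Q (P x).
Proof.
move=> [s ->]; exists (polysum [seq (p.1 / p.2.+1%:R, p.2.+1) | p <- s]).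
  by eexists.
move=> x; elim: s => [|[c n] s IH].
  have -> : polysum [::] x = 0 by rewrite /polysum big_nil.
  rewrite (_ : polysum _ = fun=> 0); first exact: is_derive_cst.
  by apply/funext => y; rewrite /polysum big_nil.
have -> : polysum [seq (p.1 / p.2.+1%:R, p.2.+1) | p <- (c, n) :: s] =
  fun x => c / n.+1%:R * x ^+ n.+1 + polysum [seq (p.1 / p.2.+1%:R, p.2.+1) | p <- s] x.
  by apply/funext => y; rewrite /polysum /= big_cons.
have -> : polysum ((c, n) :: s) x = c * x ^+ n + polysum s x by rewrite /polysum big_cons.
apply: is_deriveD; exact: is_derive_monomial.
Qed.

Lemma polyf_rsmooth P : polyf P -> rsmooth P.
Proof.
move=> [s ->]; elim: s => [|[c n] s IH].
  rewrite (_ : polysum _ = fun=> 0); first exact: rsmooth_cst.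
  by apply/funext => y; rewrite /polysum big_nil.
have -> : polysum ((c, n) :: s) = fun x => c * x ^+ n + polysum s x.
  by apply/funext => y; rewrite /polysum /= big_cons.
apply: rsmoothD => //; apply: rsmoothM; first exact: rsmooth_cst.
elim: n => [|n IHn]; first exact: (rsmooth_cst 1).
rewrite (_ : (fun x => _) = fun x => id x * x ^+ n); first by apply: rsmoothM => //; exact: rsmooth_id.
by apply/funext => x; rewrite exprS.
Qed.

(* Expectation of [g] under the binomial law with parameters [n] and [x]. *)
Fixpoint binom_mean (x : R) (n : nat) (g : nat -> R) : R :=
  if n is m.+1 then x * binom_mean x m (fun i => g i.+1) + (1 - x) * binom_mean x m g else g 0%N.

Lemma binom_mean_le x n (g h : nat -> R) : 0 <= x <= 1 ->
  (forall i, (i <= n)%N -> g i <= h i) -> binom_mean x n g <= binom_mean x n h.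
Proof.
move=> /andP[x0 x1]; elim: n g h => [|n IH] g h gh /=; first exact: gh.
apply: lerD; apply: ler_wpM2l; rewrite ?subr_ge0//; apply: IH => i ni; apply: gh => //.
exact: leqW.
Qed.

Lemma binom_meanD x n (g h : nat -> R) :
  binom_mean x n (fun i => g i + h i) = binom_mean x n g + binom_mean x n h.
Proof.
elim: n g h => //= n IH g h; rewrite (IH (fun i => g i.+1)) IH; ring.
Qed.

Lemma binom_meanZ x n (c : R) (g : nat -> R) :
  binom_mean x n (fun i => c * g i) = c * binom_mean x n g.
Proof. elim: n g => //= n IH g; rewrite (IH (fun i => g i.+1)) IH; ring. Qed.

Lemma binom_mean_cst x n (c : R) : binom_mean x n (fun=> c) = c.
Proof. elim: n => //= n ->; ring. Qed.

Lemma binom_mean_var x n (c : R) :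
  binom_mean x n (fun i => (i%:R - c) ^+ 2) = n%:R * x * (1 - x) + (n%:R * x - c) ^+ 2.
Proof.
elim: n c => [|n IH] c /=; first ring.
rewrite (_ : (fun i => (i.+1%:R - c) ^+ 2) = fun i => (i%:R - (c - 1)) ^+ 2).
  by rewrite !IH -natr1; ring.
by apply/funext => i; rewrite -natr1; congr (_ ^+ 2); ring.
Qed.

Lemma polyf_binom_mean (a b : R) n (g : nat -> R) : polyf (fun x => binom_mean (a * x + b) n g).
Proof.
elim: n g => [|n IH] g /=; first exact: polyf_cst.
apply: polyfD; first exact: polyf_affine.
rewrite (_ : (fun x => _) = fun x => (- a * x + (1 - b)) * binom_mean (a * x + b) n g).
  exact: polyf_affine.
by apply/funext => x; congr (_ * _); ring.
Qed.

Lemma lipschitz_rsmooth u (a : R) : rsmooth u -> exists2 K : R, 0 <= K &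
  forall x y, - a <= x <= a -> - a <= y <= a -> `|u x - u y| <= K * `|x - y|.
Proof.
move=> su; have sdu := rsmooth_derive1 su.
have [a0|a0] := leP (- a) a; last first.
  by exists 0 => // x y /andP[h1 h2]; have := le_trans h1 h2; lra.
have cdu : {within `[- a, a], continuous (derive1 u)}.
  by apply: derivable_within_continuous => x _; exact: rsmooth_derivable.
have [c _ Hc] := EVT_max a0 cdu; have [d _ Hd] := EVT_min a0 cdu.
exists (`|derive1 u c| + `|derive1 u d|); first by rewrite addr_ge0.
move=> x y; wlog xy : x y / x <= y.
  move=> H xa ya; have [xy|xy] := leP x y; first exact: H.
  by rewrite distrC [`|x - y|]distrC; apply: H => //; exact: ltW.
move=> /andP[xa _] /andP[_ ya].
have [t /andP[xt ty] E] := mvt xy (fun t _ => rsmooth_is_derive t su).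
rewrite distrC E normrM [`|x - y|]distrC ler_wpM2r//.
have ti : t \in `[- a, a] by rewrite in_itv /=; apply/andP; split; lra.
have h1 := Hc t ti; have h2 := Hd t ti.
rewrite ler_norml; have := ler_norm (derive1 u c); have := normr_ge0 (derive1 u c).
have := lerNnormlW (lexx `|derive1 u d|); have := normr_ge0 (derive1 u d).
by move=> *; apply/andP; split; lra.
Qed.

(** Bernstein's proof: the binomial mean of [u] over equidistant nodes of [[-a, a]] is a polynomial,
    and the Lipschitz bound reduces the error to the mean distance from [x] to the nodes, which the
    variance controls. *)
Lemma weierstrass u (a e : R) : rsmooth u -> 0 < a -> 0 < e ->
  exists2 P, polyf P & forall x, - a <= x <= a -> `|u x - P x| <= e.
Proof.
move=> su a0 e0; have [K K0 HK] := lipschitz_rsmooth a su.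
pose K' := 2 * a * K + 1; have K'0 : 0 < K' by rewrite ltr_wpDl// !mulr_ge0// ltW.
(* The final error is [2 * a * K * (h + h)], at most [K' * (h + h) = e]. *)
pose h := e / (2 * K'); have h0 : 0 < h by rewrite divr_gt0// mulr_gt0.
pose n := (Num.bound (h ^- 2)).+1.
have n0 : 0 < n%:R :> R by rewrite ltr0n.
have nh : h ^- 2 <= n%:R.
  have h20 : 0 <= h ^- 2 by rewrite invr_ge0 exprn_ge0// ltW.
  by rewrite (le_trans (ltW (archi_boundP h20)))// ler_nat.
pose node (i : nat) : R := - a + 2 * a * (i%:R / n%:R).
pose al := (2 * a)^-1; pose th x := al * x + 1/2.
exists (fun x => binom_mean (al * x + 1/2) n (fun i => u (node i))); first exact: polyf_binom_mean.
move=> x xa; rewrite -/(th x).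
have ax : x = - a + 2 * a * th x by rewrite /th /al; field; rewrite gt_eqF.
have al0 : 0 < al by rewrite invr_gt0 mulr_gt0.
have th01 : 0 <= th x <= 1.
  have ala : al * a = 1/2 by rewrite /al; field; rewrite gt_eqF.
  have /andP[x1 x2] := xa; have := ler_wpM2l (ltW al0) x1; have := ler_wpM2l (ltW al0) x2.
  by rewrite mulrN ala /th; lra.
have nodeI i : (i <= n)%N -> - a <= node i <= a.
  move=> i_n; have i0 : 0 <= i%:R / n%:R :> R by rewrite divr_ge0.
  have i1 : i%:R / n%:R <= 1 :> R by rewrite ler_pdivrMr// mul1r ler_nat.
  have h1 : 0 <= 2 * a * (i%:R / n%:R) by rewrite !mulr_ge0// ltW.
  have h2 : 2 * a * (i%:R / n%:R) <= 2 * a * 1 by rewrite ler_wpM2l// mulr_ge0// ltW.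
  by rewrite /node; apply/andP; split; lra.
(* From [y <= h + y ^+ 2 / h]: distances become quadratic expressions, whose mean is explicit. *)
pose D i : R := 2 * a * K * (h + (n%:R ^- 2 / h) * (i%:R - n%:R * th x) ^+ 2).
have Dbound i : (i <= n)%N -> `|u x - u (node i)| <= D i.
  move=> i_n; apply: (le_trans (HK x (node i) xa (nodeI i i_n))).
  pose z := (i%:R - n%:R * th x) / n%:R.
  have -> : x - node i = - (2 * a) * z.
    by rewrite [in LHS]ax /node /z; field; rewrite gt_eqF.
  rewrite normrM normrN [`|2 * a|]ger0_norm ?mulr_ge0 ?(ltW a0)//.
  rewrite mulrA [K * _]mulrC /D ler_wpM2l ?mulr_ge0 ?(ltW a0)//.
  have -> : n%:R ^- 2 / h * (i%:R - n%:R * th x) ^+ 2 = `|z| ^+ 2 / h.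
    by rewrite real_normK ?num_real// /z; field; rewrite !gt_eqF.
  have := normr_ge0 z; set y := `|z| => y0.
  have [yh|yh] := leP y h; first by rewrite ler_wpDr// divr_ge0 ?sqr_ge0// ltW.
  apply: (@le_trans _ _ (y ^+ 2 / h)); last by rewrite lerDr ltW.
  by rewrite ler_pdivlMr// expr2 ler_wpM2l// ltW.
have meanD : binom_mean (th x) n D <= e.
  rewrite /D binom_meanZ binom_meanD binom_mean_cst binom_meanZ binom_mean_var subrr expr0n addr0.
  have t14 : th x * (1 - th x) <= 1.
    by have /andP[? ?] := th01; rewrite mulr_ile1//; lra.
  have -> : n%:R ^- 2 / h * (n%:R * th x * (1 - th x)) = (th x * (1 - th x)) * (n%:R^-1 / h).
    by field; rewrite !gt_eqF.
  have nhh : n%:R^-1 / h <= h.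
    rewrite ler_pdivrMr// -expr2 -[leRHS]invrK lef_pV2 ?posrE ?invr_gt0 ?exprn_gt0//.
  have q : th x * (1 - th x) * (n%:R^-1 / h) <= 1 * h.
    have nh0 : 0 <= n%:R^-1 / h by apply: divr_ge0; [rewrite invr_ge0 ler0n|exact: ltW].
    by apply: ler_pM => //; have /andP[? ?] := th01; rewrite mulr_ge0// subr_ge0.
  apply: (@le_trans _ _ (2 * a * K * (h + h))).
    rewrite mul1r in q; apply: ler_wpM2l; last by rewrite lerD2l.
    by rewrite !mulr_ge0// ltW.
  have : 2 * a * K * (h + h) <= K' * (h + h).
    by rewrite ler_wpM2r ?addr_ge0 ?(ltW h0)// /K' lerDl.
  by have -> : K' * (h + h) = e by rewrite /h; field; rewrite gt_eqF.
have A1 := binom_mean_le th01 (fun i ni => le_trans (ler_norm _) (Dbound i ni)).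
have A2 := binom_mean_le th01 (fun i ni => le_trans (lerNnormlW (lexx _)) (Dbound i ni)).
have E : binom_mean (th x) n (fun i => u x - u (node i)) =
    u x - binom_mean (th x) n (fun i => u (node i)).
  rewrite (_ : (fun i => _) = fun i => u x + (-1) * u (node i)); last first.
    by apply/funext => i; rewrite mulN1r.
  by rewrite binom_meanD binom_mean_cst binom_meanZ mulN1r.
have A3 : binom_mean (th x) n (fun i => -1 * (u x - u (node i))) <= e.
  apply: le_trans meanD; apply: binom_mean_le => // i ni.
  by rewrite mulN1r; apply: le_trans (Dbound i ni); rewrite -normrN ler_norm.
rewrite binom_meanZ E mulN1r in A3; rewrite E in A1.
by rewrite ler_norml; apply/andP; split; lra.
Qed.

(** Approximating the derivative and integrating from 0 gains one order; integration multiplies the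
    error by at most [a], hence the tolerance [e / (1 + a)]. *)
Lemma weierstrass_Ck k u (a e : R) : rsmooth u -> 0 < a -> 0 < e ->
  exists2 P, polyf P & forall j x, (j <= k)%N -> - a <= x <= a ->
    `|derive1n j u x - derive1n j P x| <= e.
Proof.
elim: k u e => [|k IH] u e su a0 e0.
  have [P pP HP] := weierstrass su a0 e0.
  by exists P => // j x; rewrite leqn0 => /eqP ->; exact: HP.
pose e' := e / (1 + a); have a1 : 0 < 1 + a by lra.
have e'0 : 0 < e' by rewrite divr_gt0.
have e'e : e' <= e by rewrite ler_pdivrMr// ler_peMr//; lra.
have [Q pQ HQ] := IH _ e' (rsmooth_derive1 su) a0 e'0.
have [P0 pP0 HP0] := polyf_prim pQ.
exists (fun x => P0 x + (u 0 - P0 0)); first by apply: polyfD => //; exact: polyf_cst.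
have D x : is_derive x (1 : R) (fun x => P0 x + (u 0 - P0 0)) (Q x).
  by have h := HP0 x; apply: is_derive_eq; rewrite addr0.
move=> [|j] x jk xa; last first.
  by rewrite !derive1Sn (is_derive_derive1 D); apply: le_trans e'e; exact: HQ.
pose v x := u x - (P0 x + (u 0 - P0 0)).
have Dv t : is_derive t (1 : R) v (derive1 u t - Q t).
  by have h := D t; have h' := rsmooth_is_derive t su; apply: is_deriveB.
have v0 : v 0 = 0 by rewrite /v; ring.
rewrite -/(v x) -[v x]subr0 -v0.
have bound (t : R) : - a <= t <= a -> `|derive1 u t - Q t| <= e'.
  by move=> ta; have := HQ 0%N t isT ta.
have xae : e' * a <= e by rewrite /e' mulrAC ler_pdivrMr//; nra.
have [x0|x0] := leP 0 x.
  have [t /andP[t0 tx] ->] := mvt x0 (fun t _ => Dv t).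
  rewrite subr0 normrM; apply: le_trans xae.
  by apply: ler_pM => //; [apply: bound; lra|rewrite ger0_norm//; lra].
have [t /andP[t0 tx] E] := mvt (ltW x0) (fun t _ => Dv t).
rewrite distrC E sub0r normrM; apply: le_trans xae.
by apply: ler_pM => //; [apply: bound; lra|rewrite ger0_norm//; lra].
Qed.

End Weierstrass.

Section Moments.
Context {R : realType}.
Implicit Types (f : dual R) (t : Cinfty R) (k : nat).

Lemma rsmoothX (u : R -> R) n : rsmooth u -> rsmooth (fun x => u x ^+ n).
Proof.
move=> su; elim: n => [|n IH]; first exact: (rsmooth_cst 1).
rewrite (_ : (fun x => _) = fun x => u x * u x ^+ n); first exact: rsmoothM.
by apply/funext => x; rewrite exprS.
Qed.

Definition creal (u : R -> R) (su : rsmooth u) : Cinfty R := cinfty_of (csmooth_real su).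

Lemma cderiveB j s t x : cderive j (s - t) x = cderive j s x - cderive j t x.
Proof.
have := cderiveD j (Cinfty_csmooth s) (csmoothZ (-1) (Cinfty_csmooth t)).
rewrite cderiveZ; last exact: Cinfty_csmooth.
rewrite (_ : (fun x => _ + _) = Cinfty_fun (s - t)).
  by move=> ->; rewrite mulN1r.
by apply/funext => y; rewrite mulN1r.
Qed.

Lemma dual_polyf0 f (P : R -> R) (sP : rsmooth P) : polyf P ->
  (forall n, f (creal (rsmoothX n (@rsmooth_id R))) = 0) -> f (creal sP) = 0.
Proof.
move=> [s PE] H; elim: s P sP PE => [|[c n] s IH] P sP PE.
  rewrite (_ : creal sP = 0) ?dual0//; apply/val_inj/funext => x.
  by rewrite /= PE /polysum big_nil.
have sQ : rsmooth (polysum s) by apply: polyf_rsmooth; exists s.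
rewrite (_ : creal sP = c%:C *: creal (rsmoothX n (@rsmooth_id R)) + creal sQ).
  by rewrite dualD dualZ H IH// mulr0 addr0.
apply/val_inj/funext => x; rewrite /= PE /polysum big_cons /=.
rewrite rmorphD rmorphM.
by rewrite -[RHS]/(c%:C * (x ^+ n)%:C + (\sum_(j <- s) j.1 * x ^+ j.2)%:C).
Qed.

Lemma dual_eq0_moments f : (forall n, f (creal (rsmoothX n (@rsmooth_id R))) = 0) -> f = 0.
Proof.
move=> H; apply: dual_ext => t; rewrite -[RHS]/(0 : R[i]).
have [k [C C0 fC]] := dual_bounded f.
apply: eq0_normc; apply/eqP; rewrite eq_le modc_ge0 andbT.
apply/ler_addgt0Pr => e e0; rewrite add0r.
have [su sv] := Cinfty_csmooth t.
pose e' := e / (2 * C); have e'0 : 0 < e' by rewrite divr_gt0// mulr_gt0.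
have k1 : 0 < k%:R + 1 :> R by rewrite ltr_wpDl.
have [P pP HP] := weierstrass_Ck k su k1 e'0; have [Q pQ HQ] := weierstrass_Ck k sv k1 e'0.
have sP := polyf_rsmooth pP; have sQ := polyf_rsmooth pQ.
have s : csmooth (fun x => P x +i* Q x) by split.
have f0 : f (cinfty_of s) = 0.
  rewrite (_ : cinfty_of s = creal sP + 'i%C *: creal sQ).
    by rewrite dualD dualZ !dual_polyf0// mulr0 addr0.
  apply/val_inj/funext => x; rewrite -[RHS]/((P x)%:C + 'i%C * (Q x)%:C).
  by apply: complex_eq; rewrite /=; ring.
have -> : f t = f (t - cinfty_of s) by rewrite dualB f0 subr0.
apply: (le_trans (fC _)); rewrite mulrC -ler_pdivlMr//.
apply: pk_le => x xk j jk; rewrite cderiveB.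
apply: (le_trans (modc_le_ReIm _)); rewrite cReD cReN cImD cImN.
have xk' : - (k%:R + 1) <= x <= k%:R + 1.
  by have /andP[? ?] := xk; apply/andP; split; lra.
have h1 := HP j x jk xk'; have h2 := HQ j x jk xk'.
have -> : e / C = e' + e' by rewrite /e'; field; rewrite gt_eqF.
exact: lerD.
Qed.

Section ResolventMoments.
Variables (f : dual R) (k : nat) (C : R).
Hypothesis fC : forall t, modc (f t) <= C * pk k t.
Hypothesis C0 : 0 <= C.
Variable s : R.
Hypothesis s0 : 0 < s.

Let w (x : R) : R[i] := x +i* s.

Let far_w x : far k (w x) s.
Proof.
move=> y _; apply: le_trans (Im_le_modc _); rewrite cImD cImN /= oppr0 addr0.
exact: ler_norm.
Qed.

Let tauM n : csmooth (fun x : R => ((tau k x) ^+ n)%:C).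
Proof. by apply: csmooth_real; apply: rsmoothX; exact: tau_rsmooth. Qed.

Let kmon n x : Cinfty R := cinfty_of (csmoothM (tauM n) (csmooth_kap s0 (far_w x))).

(** Uniform in [x], as [w x] keeps the distance [s] from the real line. *)
Let kmon_bound n : exists2 B : R, 0 <= B & forall x, modc (f (kmon n x)) <= B.
Proof.
have [B0 B00 HB] := @kap_jet_le R k k; have [T HT] := csmooth_jet_bound k (- k%:R) k%:R (tauM n).
pose A := Num.max 1 s^-1.
have A1 : 1 <= A by rewrite le_max lexx.
have sA : s^-1 <= A by rewrite le_max lexx orbT.
pose B := B0 * A ^+ (2 ^ k).
have B_ge0 : 0 <= B by apply: mulr_ge0; [exact: ltW|rewrite exprn_ge0//; lra].
exists (C * (2 ^+ k * (`|T| * B))).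
  by apply: mulr_ge0 => //; apply: mulr_ge0; [exact: exprn_ge0|exact: mulr_ge0].
move=> x; apply: (le_trans (fC _)); rewrite ler_wpM2l//; apply: pk_le => y yk.
have hT := jet_leW (leqnn k) (ler_norm T) (HT y yk).
apply: (jet_leM (tauM n) (csmooth_kap s0 (far_w x)) hT).
exact: (HB (w x) s A s0 (far_w x) A1 sA y yk).
Qed.

(** From [w / (w - y) = 1 + y / (w - y)]: the recursion behind the expansion of the Cauchy transform
    at infinity, whose coefficients are the moments. *)
Let kmonS n x : w x * f (kmon n x) = f (cinfty_of (tauM n)) + f (kmon n.+1 x).
Proof.
rewrite -dualZ -dualD; congr (f _); apply/val_inj/funext => y.
rewrite -[LHS]/(w x * ((tau k y ^+ n)%:C * kap k (w x) y)).
rewrite -[RHS]/((tau k y ^+ n)%:C + (tau k y ^+ n.+1)%:C * kap k (w x) y).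
have n1 := far_neq0 y s0 (far_w x); rewrite /kap exprS !rmorphM /=.
move: n1; set a := (tau k y)%:C; set b := (_ ^+ n)%:C => n1.
by field.
Qed.

Let unbounded_eq0 (z : R[i]) (B : R) : (forall y : R, exists2 x, y <= x & modc (w x * z) <= B) ->
  z = 0.
Proof.
move=> H; apply/eqP; rewrite -modc_eq0; apply: contraT => z0.
have {}z0 : 0 < modc z by rewrite lt_neqAle eq_sym z0 modc_ge0.
have [x yx] := H ((B + 1) / modc z); rewrite normcM => h.
have wx : x <= modc (w x) by apply: le_trans (Re_le_modc _); exact: ler_norm.
have : (B + 1) / modc z * modc z <= modc (w x) * modc z.
  by rewrite ler_wpM2r ?modc_ge0//; exact: le_trans wx.
by rewrite divfK ?gt_eqF//; lra.
Qed.

(** By [kmonS], [w x * z] stays bounded along arbitrarily large [x]. *)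
Let kmon_unbounded n (z : R[i]) : (forall y : R, exists2 x, y <= x & f (kmon n x) = z) -> z = 0.
Proof.
move=> H; have [B B0 HB] := kmon_bound n.+1.
apply: (@unbounded_eq0 _ (modc (f (cinfty_of (tauM n))) + B)) => y.
have [x yx E] := H y; exists x => //; rewrite -E kmonS.
by apply: (le_trans (le_normcD _ _)); rewrite lerD2l.
Qed.

Hypothesis shift : exists2 c : R, 0 < c & forall x, f (Kap k (w (x + c))) = f (Kap k (w x)).

Let kmon0E x : kmon 0 x = Kap k (w x).
Proof.
apply/val_inj/funext => y /=; rewrite (KapE s0 (far_w x)).
by rewrite expr0 mul1r.
Qed.

Lemma dual_eq0_shift : f = 0.
Proof.
(* Periodic in [x], and [O(1/x)] at infinity. *)
have P0 x : f (kmon 0 x) = 0.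
  have [c c0 Hc] := shift; rewrite kmon0E; apply: (@kmon_unbounded 0%N) => y.
  have step m : f (Kap k (w (x + m%:R * c))) = f (Kap k (w x)).
    elim: m => [|m IH]; first by rewrite mul0r addr0.
    by rewrite -natr1 mulrDl mul1r addrA Hc.
  pose m := Num.bound `|(y - x) / c|.
  exists (x + m%:R * c); last by rewrite kmon0E step.
  rewrite -lerBlDl -ler_pdivrMr//; apply: le_trans (ler_norm _) _.
  exact/ltW/archi_boundP/normr_ge0.
(* Once [f] kills [kmon n], the recursion makes [f (kmon n.+1 y)] independent of [y], hence 0. *)
have P n x : f (kmon n x) = 0.
  elim: n x => // n IH x.
  have E y : f (kmon n.+1 y) = - f (cinfty_of (tauM n)).
    by have := kmonS n y; rewrite IH mulr0 => /esym/eqP; rewrite addrC addr_eq0 => /eqP.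
  by rewrite E; apply: (@kmon_unbounded n.+1) => y; exists y => //; rewrite E.
apply: dual_eq0_moments => n.
have tau0 : f (cinfty_of (tauM n)) = 0.
  by have := kmonS n 0; rewrite !P mulr0 addr0.
have -> : f (creal (rsmoothX n (@rsmooth_id R))) = f (creal (rsmoothX n (@rsmooth_id R)) - cinfty_of (tauM n)).
  by rewrite dualB tau0 subr0.
apply: (dual_eq0_near fC) => x xk; exists (1/2); first by lra.
move=> y yx; rewrite -[LHS]/((y ^+ n)%:C - (tau k y ^+ n)%:C).
rewrite tau_id ?subrr//; move/ltr_normlP: yx => [? ?]; have /andP[? ?] := xk.
by rewrite ler_norml; apply/andP; split; lra.
Qed.

End ResolventMoments.

(* Two points of [Vset] with the same [z - i zeta], real [z] and real, resp. slightly
   rotated, [zeta]: their [z + i zeta] differ by a real translation [c]. *)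
Lemma wplus_wminus_shift e n (s : R) : (0 < n)%N -> 0 < s -> s < n%:R^-1 / 2 ->
  exists2 c : R, 0 < c & forall x : R, exists p q : R[i] * R[i],
    [/\ Vset e n p, Vset e n q, wplus p = x +i* s, wplus q = (x + c) +i* s & wminus p = wminus q].
Proof.
move=> n0 s0 sn.
have i0 : 0 < n%:R^-1 :> R by rewrite invr_gt0 ltr0n.
have i1 : n%:R^-1 <= 1 :> R by rewrite invf_le1 ?ltr0n// ler1n.
set i := n%:R^-1 in i0 i1 sn *; pose g := cos i.
have g1 : g < 1.
  have p2 := pi_ge2 R; rewrite -cos0 ltr_cos// in_itv/=; lra.
have g0 : 0 <= g by have := cos_ge1B (ltW i0); rewrite -/g; lra.
(* The rotated [zeta] will be [s - i c / 2]; this [c] gives [g * (s + c / 2) < s], which keeps its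
   argument below [1 / n]. *)
pose c := s * (1 - g); have c0 : 0 < c by rewrite mulr_gt0// subr_gt0.
have cs : c <= s by rewrite ler_piMr; lra.
exists c => // x.
pose zq : R[i] := s -i* (c / 2).
have mp : modc s%:C = s by rewrite modc_real gtr0_norm.
have mq : modc zq <= s + c / 2.
  by apply: (le_trans (modc_le_ReIm _)); rewrite /= normrN !gtr0_norm// divr_gt0.
have mq0 : 0 < modc zq.
  by apply: lt_le_trans (Re_le_modc _); rewrite /= gtr0_norm.
exists (x%:C, s%:C), ((x + c / 2)%:C, zq); split.
- apply: Vset_intro; rewrite -/i //.
  + change (0 < modc s%:C < i); rewrite mp; apply/andP; split; lra.
  + by change (`|(0 : R)| < i); rewrite normr0.
  + move=> _; change (g * modc s%:C < s /\ `|(0 : R)| < i * modc s%:C).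
    by rewrite mp normr0 mulr_gt0// gtr_pMl.
- apply: Vset_intro; rewrite -/i //.
  + change (0 < modc zq < i); apply/andP; split; lra.
  + by change (`|(0 : R)| < i); rewrite normr0.
  + move=> _; change (g * modc zq < s /\ `|(0 : R)| < i * modc zq).
    rewrite normr0 mulr_gt0//; split => //.
    have h1 : g * modc zq <= g * (s + c / 2) by rewrite ler_wpM2l.
    have h2 : g * c <= c by rewrite ler_piMl; lra.
    by have h3 : g * s = s - c; [rewrite /c; ring|lra].
- by apply: complex_eq; rewrite /wplus /=; ring.
- by apply: complex_eq; rewrite /wplus /zq /=; field.
- by apply: complex_eq; rewrite /wminus /zq /=; field.
Qed.

Lemma regularize_inj e f n : (0 < n)%N -> (forall p, Vset e n p -> regularize f p = 0) -> f = 0.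
Proof.
move=> n0 H; have [k [C C0 fC]] := dual_bounded f.
pose m := maxn n (maxn 4 (k + 2)).
have nm : (n <= m)%N by exact: leq_maxl.
have m4 : (4 <= m)%N by rewrite /m !leq_max leqnn orbT.
have km : (k + 2 <= m)%N by rewrite /m !leq_max leqnn !orbT.
have m0 : (0 < m)%N by exact: leq_trans nm.
have G p : Vset e m p -> f (Kap k (wplus p)) = f (Kap k (wminus p)).
  move=> Vp; have := H p (Vset_decr n0 nm Vp).
  rewrite (regularizeE fC m4 km Vp) => /eqP; rewrite mulf_eq0 => /orP[|].
    by rewrite /cauchy_cst invr_eq0 !mulf_eq0 (negbTE two_neq0) (negbTE pi_neq0C) (negbTE i_neq0).
  by rewrite subr_eq0 => /eqP.
pose s : R := m%:R^-1 / 3.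
have s0 : 0 < s by rewrite divr_gt0// invr_gt0 ltr0n.
have sm : s < m%:R^-1 / 2 by rewrite /s ltr_pM2l ?invr_gt0 ?ltr0n//; lra.
apply: (@dual_eq0_shift f k C fC (ltW C0) s s0).
have [c c0 Hc] := wplus_wminus_shift e m0 s0 sm; exists c => // x.
have [p [q [Vp Vq <- <- E]]] := Hc x.
by rewrite !G// E.
Qed.

End Moments.

(** * Continuity *)

Section Ascoli.
Context {R : realType}.
Implicit Types (t : Cinfty R) (k : nat).

Lemma csmooth_lip (g : R -> R[i]) (x y M : R) : csmooth g ->
  (forall z, Num.min x y <= z <= Num.max x y -> modc (cderive 1 g z) <= M) ->
  modc (g y - g x) <= 2 * M * `|y - x|.
Proof.
move=> [g1 g2]; wlog xy : x y / x <= y.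
  move=> H; have [xy|xy] := leP x y => hM; first by apply: H => //; rewrite ?min_l ?max_r.
  by rewrite modcB distrC; apply: H; rewrite ?min_l ?max_r ?ltW.
rewrite (min_idPl xy) (max_idPr xy) => hM.
have [c cxy E] := mvt xy (fun z _ => rsmooth_is_derive z g1).
have [d dxy F] := mvt xy (fun z _ => rsmooth_is_derive z g2).
apply: (le_trans (modc_le_ReIm _)); rewrite cReD cReN cImD cImN.
rewrite /= in E F; rewrite E F !normrM.
have h1 : `|derive1 (Re \o g) c| <= M by apply: le_trans (hM c cxy); exact: (Re_le_modc (cderive 1 g c)).
have h2 : `|derive1 (Im \o g) d| <= M by apply: le_trans (hM d dxy); exact: (Im_le_modc (cderive 1 g d)).
have := ler_wpM2r (normr_ge0 (y - x)) h1; have := ler_wpM2r (normr_ge0 (y - x)) h2; lra.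
Qed.

(** [csmooth_lip] is used for the derivative of [g] and then for [g] minus its linear part; each use
    costs a factor 2. *)
Lemma csmooth_taylor2 (g : R -> R[i]) (x y M : R) : csmooth g ->
  (forall z, Num.min x y <= z <= Num.max x y -> modc (cderive 2 g z) <= M) ->
  modc (g y - g x - cderive 1 g x * (y - x)%:C) <= 4 * M * `|y - x| ^+ 2.
Proof.
move=> gs hM; pose l := cderive 1 g x.
have idsm : csmooth (fun z : R => z%:C) by apply: csmooth_real; exact: rsmooth_id.
have ls : csmooth (fun z : R => - l * z%:C) by exact: csmoothZ.
have rs := csmoothD gs ls.
have D : cderive 1 (fun z => g z + - l * z%:C) = fun z => cderive 1 g z - l.
  rewrite cderiveD// cderiveZ//; apply/funext => z; congr (_ + _).
  rewrite (_ : cderive 1 (fun z : R => z%:C) z = 1) ?mulr1//.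
  apply: complex_eq; rewrite /cderive /=.
    by rewrite (is_derive_derive1 (fun x => is_derive_id x 1)).
  by rewrite (is_derive_derive1 (fun x => is_derive_cst 0 x 1)).
have bnd z : Num.min x y <= z <= Num.max x y ->
    modc (cderive 1 (fun z => g z + - l * z%:C) z) <= 2 * M * `|y - x|.
  move=> zxy; rewrite D.
  have zx : `|z - x| <= `|y - x|.
    move: zxy; have [xy|xy] := leP x y => /andP[h1 h2].
      by rewrite !ger0_norm ?subr_ge0//; lra.
    by rewrite [`|z - x|]distrC [`|y - x|]distrC !ger0_norm ?subr_ge0//; lra.
  have M0 : 0 <= M by apply: le_trans (modc_ge0 _) (hM z zxy).
  apply: le_trans (_ : 2 * M * `|z - x| <= _); last by rewrite ler_wpM2l// mulr_ge0.
  apply: (csmooth_lip (csmooth_cderive1 gs)) => w wxz; rewrite -cderiveSr; apply: hM.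
  move: wxz zxy; have [?|?] := leP x z; have [?|?] := leP x y => /andP[? ?] /andP[? ?];
    apply/andP; split; lra.
have := csmooth_lip rs bnd.
rewrite (_ : g y + - l * y%:C - (g x + - l * x%:C) = g y - g x - l * (y - x)%:C); last first.
  by rewrite rmorphB /=; ring.
by move=> /le_trans; apply; rewrite le_eqVlt; apply/orP; left; apply/eqP; ring.
Qed.

Lemma derive_family (F : nat -> R -> R[i]) :
  (forall j x, is_cderive (F j) x (F j.+1 x)) -> csmooth (F 0%N) /\ forall j, cderive j (F 0%N) = F j.
Proof.
move=> H; have D j : cderive 1 (F j) = F j.+1 by exact: is_cderive_cderive.
split; last by elim=> [|j IH]; [exact: cderive0|rewrite cderiveSr IH D].
split.
  apply: (@rsmooth_coind R [set u | exists j, u = Re \o F j]); last by exists 0%N.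
  move=> _ [j ->]; split=> [x|]; first by have [[]] := H j x.
  by exists j.+1; apply: is_derive_derive1 => x; have [] := H j x.
apply: (@rsmooth_coind R [set u | exists j, u = Im \o F j]); last by exists 0%N.
move=> _ [j ->]; split=> [x|]; first by have [_ []] := H j x.
by exists j.+1; apply: is_derive_derive1 => x; have [] := H j x.
Qed.

Section UltraLimit.
Variables (G : set_system nat) (UG : UltraFilter G) (ooG : \oo `<=` G).
Variables (t : nat -> Cinfty R) (M : nat -> R).
Hypothesis tM : forall k n, (k < n)%N -> pk k (t n) <= M k.

Let eventually_gt k : G [set n | (k < n)%N].
Proof. by apply: ooG; exists k.+1. Qed.

Let in_itv_bound (x : R) : exists k, - k%:R <= x - 1 /\ x + 1 <= k%:R.
Proof.
exists (Num.bound (`|x| + 1)).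
have := archi_boundP (_ : 0 <= `|x| + 1); rewrite addr_ge0// => /(_ isT) h.
by have := ler_norm x; have := lerNnormlW (lexx `|x|); split; lra.
Qed.

Let jet_bound j k n x : (j <= k)%N -> (k < n)%N -> - k%:R <= x <= k%:R ->
  modc (cderive j (t n) x) <= M k.
Proof. by move=> jk kn xk; apply: le_trans (tM kn); exact: pk_ge. Qed.

Lemma jet_limit : exists F : nat -> R -> R[i],
  forall j x, flim G (fun n => cderive j (t n) x) (F j x).
Proof.
suff H (jx : nat * R) : exists z, flim G (fun n => cderive jx.1 (t n) jx.2) z.
  have [F HF] := @choice _ _ (fun (jx : nat * R) z => flim G (fun n => cderive jx.1 (t n) jx.2) z) H.
  by exists (fun j x => F (j, x)) => j x; exact: (HF (j, x)).
case: jx => j x /=; have [k0 [h1 h2]] := in_itv_bound x.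
pose k := maxn j k0; have k0k : k0%:R <= k%:R :> R by rewrite ler_nat leq_maxr.
(* No bound is known for [n <= k]; these finitely many indices do not matter along [G]. *)
pose u n := if (k < n)%N then cderive j (t n) x else 0.
have [|z Hz] := @ultra_lim _ _ G u `|M k| UG.
  move=> n; rewrite /u; case: ifPn => [kn|_]; last by rewrite normc0.
  apply: le_trans (ler_norm _); apply: jet_bound => //; first exact: leq_maxl.
  by apply/andP; split; lra.
exists z => e e0; apply: filterS (filterI (Hz e e0) (eventually_gt k)) => n [/= h kn].
by move: h; rewrite /u kn.
Qed.

(** The pointwise limits [F j] inherit second-order Taylor bounds, so [F j.+1] is the derivative of
    [F j]. A bound on one more derivative gives equicontinuity, which makes the convergence uniform
    on compact intervals. *)
Lemma ascoli : exists T : Cinfty R, (forall k, pk k T <= M k) /\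
  forall k (e : R), 0 < e -> G [set n | pk k (t n - T) <= e].
Proof.
have [F HF] := jet_limit.
have taylor j (x : R) : exists K : R, forall h : R, `|h| <= 1 ->
    modc (F j (x + h) - F j x - F j.+1 x * h%:C) <= K * `|h| ^+ 2.
  have [k0 [h1 h2]] := in_itv_bound x.
  pose k := maxn j.+2 k0; have k0k : k0%:R <= k%:R :> R by rewrite ler_nat leq_maxr.
  exists (4 * M k) => h hh.
  apply: (@flim_le _ _ G _ (fun n => cderive j (t n) (x + h) - cderive j (t n) x - cderive j.+1 (t n) x * h%:C)).
    apply: flim_sub; first by apply: flim_sub; exact: HF.
    rewrite mulrC (_ : (fun n => _) = fun n => h%:C * cderive j.+1 (t n) x).
      by apply: flim_scale; exact: HF.
    by apply/funext => n; rewrite mulrC.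
  apply: filterS (eventually_gt k) => n /= kn.
  have := @csmooth_taylor2 (cderive j (t n)) x (x + h) (M k) (csmooth_cderive j (Cinfty_csmooth (t n))).
  rewrite [x + h]addrC addrK -cderiveSr; apply.
  move=> z zx.
  have -> : cderive 2 (cderive j (t n)) = cderive j.+2 (t n) by [].
  apply: jet_bound => //; first exact: leq_maxl.
  move/ler_normlP: hh => [? ?]; move: zx.
  by have [?|?] := leP x (h + x) => /andP[? ?]; apply/andP; split; lra.
have is_cderiveF j x : is_cderive (F j) x (F j.+1 x).
  have [K HK] := taylor j x.
  have D (P : R[i] -> R) : (forall z w, P (z - w) = P z - P w) -> (forall z, `|P z| <= modc z) ->
      (forall z (r : R), P (z * r%:C) = P z * r) -> is_derive x (1 : R) (P \o F j) (P (F j.+1 x)).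
    move=> PB PL PM; apply/is_derive_epsP => e e0.
    have K1 : 0 < 1 + `|K| by rewrite ltr_wpDr.
    exists (Num.min 1 (e / (1 + `|K|))); first by rewrite lt_min ltr01 divr_gt0.
    move=> h; rewrite lt_min => /andP[h1 he]; rewrite /= -!PB -PM -PB.
    apply: (le_trans (PL _)); apply: (le_trans (HK h (ltW h1))).
    rewrite expr2 mulrA ler_wpM2r//; rewrite ltr_pdivlMr// mulrC in he.
    by apply: le_trans (ltW he); rewrite ler_wpM2r//; have := ler_norm K; lra.
  split; apply: D.
  - by move=> z w; rewrite cReD cReN.
  - exact: Re_le_modc.
  - by move=> z r; rewrite cReM /= mulr0 subr0.
  - by move=> z w; rewrite cImD cImN.
  - exact: Im_le_modc.
  - by move=> z r; rewrite cImM /= mulr0 add0r.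
have [s0 FE] := derive_family is_cderiveF.
pose T := cinfty_of s0; have TE j : cderive j T = F j by exact: FE.
have TM k x : - k%:R <= x <= k%:R -> jet_le k T x (M k).
  move=> xk j jk; rewrite TE; apply: (flim_le (HF j x)).
  by apply: filterS (eventually_gt k) => n /= kn; exact: jet_bound.
exists T; split; first by move=> k; apply: pk_le; exact: TM.
move=> k e e0.
have cj j : G [set n | forall x : R, - k%:R <= x <= k%:R -> modc (cderive j (t n) x - F j x) <= e].
  have := @segment_compact R (- k%:R) k%:R.
  move=> /compact_near_coveringP/(_ nat G (fun n (x : R) => - k%:R <= x <= k%:R -> modc (cderive j (t n) x - F j x) <= e) _).
  have loc (x : R) : `[- k%:R, k%:R]%classic x -> \forall x' \near x & n \near G,
      - k%:R <= x' <= k%:R -> modc (cderive j (t n) x' - F j x') <= e.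
    move=> xk; rewrite /= in_itv /= in xk.
    pose l := maxn j.+1 k; have kl : k%:R <= l%:R :> R by rewrite ler_nat leq_maxr.
    (* [csmooth_lip] then costs at most [e / 3], once for [t n] and once for the limit. *)
    pose eta := e / (6 * (1 + `|M l|)).
    have M1 : 0 < 1 + `|M l| by rewrite ltr_wpDr.
    have eta0 : 0 < eta by rewrite divr_gt0// mulr_gt0.
    have e3 : 0 < e / 3 by rewrite divr_gt0.
    exists (ball x eta, [set n | (l < n)%N] `&` [set n | modc (cderive j (t n) x - F j x) < e / 3]).
      by split; [exact: nbhsx_ballx|apply: filterI; [exact: eventually_gt|exact: HF]].
    move=> [y n] [/= xy [ln hn]] yk.
    have lip (g : R -> R[i]) : csmooth g -> (forall z, - l%:R <= z <= l%:R -> modc (cderive 1 g z) <= M l) ->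
        modc (g y - g x) <= e / 3.
      move=> gs gM; apply: (le_trans (csmooth_lip gs (M := M l) _)).
        move=> z zx; apply: gM; move: zx; have /andP[? ?] := xk; have /andP[? ?] := yk.
        by have [?|?] := leP x y => /andP[? ?]; apply/andP; split; lra.
      have xy' : `|y - x| <= eta by rewrite distrC ltW.
      have h1 : M l * `|y - x| <= (1 + `|M l|) * eta.
        apply: (@le_trans _ _ ((1 + `|M l|) * `|y - x|)).
          by rewrite ler_wpM2r//; have := ler_norm (M l); lra.
        by rewrite ler_wpM2l// ltW.
      have h2 : (1 + `|M l|) * eta = e / 6 by rewrite /eta; field; rewrite gt_eqF.
      lra.
    have A1 : modc (cderive j (t n) y - cderive j (t n) x) <= e / 3.
      apply: lip => [|z zl]; first by apply: csmooth_cderive; exact: Cinfty_csmooth.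
      by rewrite -cderiveSr; apply: jet_bound => //; exact: leq_maxl.
    have A2 : modc (F j y - F j x) <= e / 3.
      rewrite -TE; apply: lip => [|z zl]; first by apply: csmooth_cderive.
      by rewrite -cderiveSr; apply: (TM l) => //; exact: leq_maxl.
    have -> : cderive j (t n) y - F j y = (cderive j (t n) y - cderive j (t n) x)
      + (cderive j (t n) x - F j x) - (F j y - F j x) by ring.
    apply: (le_trans (le_modcB _ _)).
    have := le_normcD (cderive j (t n) y - cderive j (t n) x) (cderive j (t n) x - F j x); lra.
  move=> /(_ loc); apply: filterS => n Hn x xk.
  by apply: (Hn x) => //; change (x \in `[- k%:R, k%:R]); rewrite in_itv.
have all m : G [set n | forall j, (j <= m)%N -> forall x : R, - k%:R <= x <= k%:R ->
    modc (cderive j (t n) x - F j x) <= e].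
  elim: m => [|m IH].
    by apply: filterS (cj 0%N) => n Hn j; rewrite leqn0 => /eqP ->.
  apply: filterS (filterI IH (cj m.+1)) => n [H1 H2] j.
  by rewrite leq_eqVlt => /orP[/eqP ->//|jm]; exact: H1.
apply: filterS (all k) => n Hn /=; apply: pk_le => x xk j jk.
by rewrite cderiveB TE; exact: Hn.
Qed.

End UltraLimit.

(* Otherwise some [t_n] satisfy [modc (f t_n) = 1] and [p_k t_n <= 1 / d k] for [k < n];
   by Ascoli a limit point [t] violates the hypothesis. *)
Lemma dual_finite_bound (f : dual R) (d : nat -> R) : (forall k, 0 < d k) ->
  (forall t, (forall k, pk k t <= (d k)^-1) -> modc (f t) < 1) ->
  exists K, forall t, modc (f t) <= \sum_(0 <= k < K) d k * pk k t.
Proof.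
move=> d0 Hf; apply: contrapT => /forallNP none.
have ex n : exists t, modc (f t) = 1 /\ forall k, (k < n)%N -> pk k t <= (d k)^-1.
  have /existsNP[t /negP] := none n; rewrite -ltNge => ht.
  have sum0 m : 0 <= \sum_(0 <= k < m) d k * pk k t.
    by apply: sumr_ge0 => i _; rewrite mulr_ge0 ?pk_ge0// ltW.
  have ft : 0 < modc (f t) by apply: le_lt_trans ht.
  (* Each single term of the sum is below [modc (f t)], so normalising [f t] to modulus 1 yields the
     bounds on [pk k]. *)
  exists ((modc (f t))^-1%:C *: t); split.
    by rewrite dualZ normcM modc_real gtr0_norm ?invr_gt0// mulVf// gt_eqF.
  move=> k kn; rewrite pkZ modc_real gtr0_norm ?invr_gt0//.
  rewrite ler_pdivrMl// mulrC -ler_pdivrMl ?invr_gt0// invrK.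
  apply: le_trans (ltW ht); rewrite big_mkord (bigD1 (Ordinal kn)) //= lerDl.
  by apply: sumr_ge0 => i _; rewrite mulr_ge0 ?pk_ge0// ltW.
have [t Ht] := @choice _ _ (fun n t => modc (f t) = 1 /\ forall k, (k < n)%N -> pk k t <= (d k)^-1) ex.
have [G [UG ooG]] := @ultraFilterLemma nat \oo _.
have [T [TM cT]] := @ascoli G UG ooG t (fun k => (d k)^-1) (fun k n => (Ht n).2 k).
have := Hf T TM; apply/negP; rewrite -leNgt.
have [k [C C0 fC]] := dual_bounded f.
apply/ler_addgt0Pr => e e0.
have [n Hn] := filter_ex (cT k (e / C) (divr_gt0 e0 C0)).
have := fC (t n - T); rewrite dualB => h.
have h2 : C * pk k (t n - T) <= e by rewrite mulrC -ler_pdivlMr.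
have := le_dist_modc (f (t n)) (f T); rewrite (Ht n).1; lra.
Qed.

End Ascoli.

(** * Hahn-Banach and the splitting of functionals *)

Section SublinearFunctionals.
Context {R : realType} (V : lmodType R[i]).
Implicit Types (s : V -> R) (A : set (V -> R)) (x y : V).

Definition sublin s := (forall x y, s (x + y) <= s x + s y) /\
  (forall (r : R) x, 0 < r -> s (r%:C *: x) <= r * s x).

Lemma sublinZ s (r : R) x : sublin s -> 0 < r -> s (r%:C *: x) = r * s x.
Proof.
move=> [_ sZ] r0; apply/eqP; rewrite eq_le sZ//= -ler_pdivlMl//.
have := sZ r^-1 (r%:C *: x); rewrite invr_gt0 => /(_ r0).
by rewrite scalerA -rmorphM mulVf ?gt_eqF// rmorph1 scale1r.
Qed.

Lemma sublin0 s : sublin s -> s 0 = 0.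
Proof.
move=> /sublinZ/(_ (ltr0n R 2)) => /(_ 0); rewrite scaler0 => h.
lra.
Qed.

Lemma sublinN_ge s x : sublin s -> - s (- x) <= s x.
Proof. by move=> ss; have := ss.1 x (- x); rewrite subrr sublin0//; lra. Qed.

(** The members need not be sublinear, only the family as a whole. It serves three times: for chains
    in Zorn's lemma, for the modification of a functional along a direction, and for an infimal
    convolution. *)
Lemma sublin_inf A (b : V -> R) : A !=set0 -> (forall u x, A u -> b x <= u x) ->
  (forall u v x y, A u -> A v -> exists2 w, A w & w (x + y) <= u x + v y) ->
  (forall u (r : R) x, A u -> 0 < r -> exists2 w, A w & w (r%:C *: x) <= r * u x) ->
  exists m, [/\ sublin m, forall u x, A u -> m x <= u x & forall x, b x <= m x].
Proof.
move=> [u0 Au0] Ab AD AZ; pose m x := inf [set u x | u in A].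
have mu u x : A u -> m x <= u x.
  by move=> Au; apply: ge_inf; [exists (b x) => _ [v Av <-]; exact: Ab|exists u].
have m_ge x (a : R) : (forall u, A u -> a <= u x) -> a <= m x.
  move=> H; apply: lb_le_inf; first by exists (u0 x); exists u0.
  by move=> _ [u Au <-]; exact: H.
exists m; split => // [|x]; last by apply: (m_ge x) => u; exact: Ab.
split=> [x y|r x r0].
  rewrite -lerBlDr; apply: (m_ge x) => u Au; rewrite lerBlDr -lerBlDl.
  apply: (m_ge y) => v Av; rewrite lerBlDl.
  have [w Aw] := AD u v x y Au Av; apply: le_trans; exact: mu.
rewrite mulrC -ler_pdivrMr//; apply: (m_ge x) => u Au; rewrite ler_pdivrMr// mulrC.
by have [w Aw] := AZ u r x Au r0; apply: le_trans; exact: mu.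
Qed.

(* Hahn-Banach by Zorn: a minimal sublinear functional is linear. *)
Lemma sublin_minimal s0 : sublin s0 -> exists s, [/\ sublin s, forall x, s x <= s0 x &
  forall t, sublin t -> (forall x, t x <= s x) -> t = s].
Proof.
move=> ss0; pose T := {s | sublin s /\ forall x, s x <= s0 x}.
pose below (s t : T) := `[< forall x, sval t x <= sval s x >].
have [|||F totF|[s [ss les]] /= smin] := @classical_sets.Zorn T below.
- by move=> t; apply/asboolP.
- move=> r s t /asboolP rs /asboolP st; apply/asboolP => x.
  exact: le_trans (st x) (rs x).
- move=> [s Ps] [t Pt] /asboolP /= st /asboolP /= ts; apply: eq_exist.
  by apply/funext => x; apply/eqP; rewrite eq_le st ts.
- have [[t0 Ft0]|F0] := pselect (F !=set0); last first.
    have P0 : sublin s0 /\ forall x, s0 x <= s0 x by [].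
    by exists (exist _ s0 P0) => t Ft; case: F0; exists t.
  have [||||m [sm mF _]] := @sublin_inf [set sval t | t in F] (fun x => - s0 (- x)).
  + by exists (sval t0); exists t0.
  + move=> _ x [[t [st tle]] _ <-] /=; apply: le_trans (sublinN_ge x st).
    by rewrite lerN2.
  + move=> _ _ x y [u Fu <-] [v Fv <-].
    have [/asboolP uv|/asboolP vu] := totF u v Fu Fv.
      exists (sval v); first by exists v.
      by apply: le_trans ((svalP v).1.1 x y) _; rewrite lerD2r.
    exists (sval u); first by exists u.
    by apply: le_trans ((svalP u).1.1 x y) _; rewrite lerD2l.
  + move=> _ r x [u Fu <-] r0; exists (sval u); first by exists u.
    exact: (svalP u).1.2.
  have mle x : m x <= s0 x.
    by apply: le_trans (mF (sval t0) x _) ((svalP t0).2 x); exists t0.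
  exists (exist _ m (conj sm mle)) => t Ft; apply/asboolP => x /=.
  by apply: mF; exists t.
exists s; split => // t st ts.
have tle x : t x <= s0 x by exact: le_trans (ts x) (les x).
apply: (congr1 sval (smin (exist _ t (conj st tle)) _)); exact/asboolP.
Qed.

(** For a minimal [s], the infimum over [t >= 0] of [s (x + t y) - t * s y] is sublinear and at most
    [s], hence equal to [s]; [t = 1] gives superadditivity. *)
Lemma sublin_dominates s0 : sublin s0 -> exists s, [/\ forall x y, s (x + y) = s x + s y,
  forall (r : R) x, s (r%:C *: x) = r * s x & forall x, s x <= s0 x].
Proof.
move=> /sublin_minimal[s [ss les smin]].
have sD x y : s (x + y) = s x + s y.
  apply/eqP; rewrite eq_le ss.1 /=.
  pose A := [set u | exists2 t : R, 0 <= t & u = fun x => s (x + t%:C *: y) - t * s y].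
  have sty t : 0 <= t -> s (t%:C *: y) = t * s y.
    by rewrite le_eqVlt => /orP[/eqP <-|/sublinZ->//]; rewrite scale0r mul0r sublin0.
  have [||||m [sm mA _]] := @sublin_inf A (fun x => - s (- x)).
  - by exists (fun x => s (x + (0 : R)%:C *: y) - 0 * s y); exists 0.
  - move=> _ z [t t0 ->]; have := ss.1 (z + t%:C *: y) (- z).
    by rewrite addrAC subrr add0r sty//; lra.
  - move=> _ _ z w [t t0 ->] [r r0 ->].
    exists (fun x => s (x + (t + r)%:C *: y) - (t + r) * s y).
      by exists (t + r) => //; rewrite addr_ge0.
    rewrite rmorphD scalerDl addrACA mulrDl.
    by have := ss.1 (z + t%:C *: y) (w + r%:C *: y); lra.
  - move=> _ r z [t t0 ->] r0; exists (fun x => s (x + (r * t)%:C *: y) - (r * t) * s y).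
      by exists (r * t) => //; rewrite mulr_ge0// ltW.
    by rewrite rmorphM -scalerA -scalerDr sublinZ// mulrBr mulrA.
  have {}mA t z : 0 <= t -> m z <= s (z + t%:C *: y) - t * s y.
    by move=> t0; apply: (mA (fun x => s (x + t%:C *: y) - t * s y)); exists t.
  have ms : m = s.
    apply: smin => // z; have := mA 0 z (lexx 0).
    by rewrite scale0r addr0 mul0r subr0.
  by have := mA 1 x ler01; rewrite ms scale1r mul1r lerBrDr.
have sN x : s (- x) = - s x.
  by apply: (addrI (s x)); rewrite -sD !subrr sublin0.
exists s; split => // r x; have [r0|r0|->] := ltrgt0P r.
- exact: sublinZ.
- have := @sublinZ s (- r) x ss; rewrite oppr_gt0 => /(_ r0).
  by rewrite rmorphN scaleNr sN mulNr => /oppr_inj.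
- by rewrite scale0r mul0r sublin0.
Qed.

Definition cseminorm (p : V -> R) := (forall x y, p (x + y) <= p x + p y) /\
  forall (a : R[i]) x, p (a *: x) = modc a * p x.

(** Multiplying [x] by a number of modulus 1 makes [F x] real and nonnegative without changing
    [p x]. *)
Lemma linear_modc_le (F : V -> R[i]) p : linear F -> cseminorm p ->
  (forall x, Re (F x) <= p x) -> forall x, modc (F x) <= p x.
Proof.
move=> lF [_ pZ] Fp x.
have F0 : F 0 = 0.
  by have := lF (-1) 0 0; rewrite scaler0 addr0 scaleN1r addNr.
have FZ (a : R[i]) y : F (a *: y) = a * F y by have := lF a y 0; rewrite !addr0 F0 addr0.
have [Fx0|Fx0] := eqVneq (F x) 0; first by have := Fp x; rewrite Fx0 normc0.
have m0 : 0 < modc (F x) by rewrite modc_gt0.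
pose c : R[i] := (modc (F x))%:C / F x.
have c1 : modc c = 1 by rewrite normcM normcV modc_real gtr0_norm// divff// gt_eqF.
by have := Fp (c *: x); rewrite FZ pZ c1 mul1r /c divfK.
Qed.

(* Hahn-Banach for the infimal convolution of [p] and [Re F + q]. *)
Lemma linear_split (F : V -> R[i]) p q : linear F -> cseminorm p -> cseminorm q ->
  (forall x, modc (F x) <= p x + q x) -> exists G : V -> R[i],
  [/\ linear G, forall x, modc (G x) <= p x & forall x, modc (F x - G x) <= q x].
Proof.
move=> lF sp sq Fpq; have [pD pZ] := sp; have [qD qZ] := sq.
have F0 : F 0 = 0.
  by have := lF (-1) 0 0; rewrite scaler0 addr0 scaleN1r addNr.
have FZ (a : R[i]) y : F (a *: y) = a * F y by have := lF a y 0; rewrite !addr0 F0 addr0.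
have FD x y : F (x + y) = F x + F y by have := lF 1 x y; rewrite !scale1r.
have pN x : p (- x) = p x by rewrite -scaleN1r pZ normcN normc1 mul1r.
have qN x : q (- x) = q x by rewrite -scaleN1r qZ normcN normc1 mul1r.
have p0 : p 0 = 0 by have := pZ 0 0; rewrite scale0r normc0 mul0r.
have q0 : q 0 = 0 by have := qZ 0 0; rewrite scale0r normc0 mul0r.
pose u y := fun x => p (x - y) + Re (F y) + q y.
have [||||s0 [ss s0u _]] := @sublin_inf (range u) (fun x => - p x).
- by exists (u 0); exists 0.
- move=> _ x [y _ <-]; rewrite /u.
  have h1 := pD (x - y) (- x); rewrite addrAC subrr add0r !pN in h1.
  have := Fpq y; have := Re_le_modc (F y); have := lerNnormlW (lexx `|Re (F y)|).
  by have := ler_norm (- Re (F y)); rewrite normrN; lra.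
- move=> _ _ x x' [y _ <-] [y' _ <-]; exists (u (y + y')); first by exists (y + y').
  rewrite /u opprD addrACA FD cReD.
  by have := pD (x - y) (x' - y'); have := qD y y'; lra.
- move=> _ r x [y _ <-] r0; exists (u (r%:C *: y)); first by exists (r%:C *: y).
  rewrite /u -scalerBr pZ qZ FZ modc_real gtr0_norm// cReM /= mul0r subr0.
  by rewrite !mulrDr.
have {}s0u y x : s0 x <= p (x - y) + Re (F y) + q y by apply: (s0u (u y)); exists y.
(* The choices [y = 0] and [y = x] in the infimum give the bounds for [G] and for [F - G]. *)
have s0p x : s0 x <= p x by have := s0u 0 x; rewrite subr0 F0 q0 !addr0.
have s0q x : s0 x <= Re (F x) + q x by have := s0u x x; rewrite subrr p0 add0r.
have [g [gD gZ gs0]] := sublin_dominates ss.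
have gN x : g (- x) = - g x.
  by have := gZ (-1) x; rewrite rmorphN rmorph1 scaleN1r mulN1r.
(* The complex-linear functional with real part [g]. *)
pose G x : R[i] := g x +i* (- g ('i%C *: x)).
have lG : linear G.
  move=> [a b] x y; rewrite /G.
  have E (v : V) : (a +i* b) *: v = a%:C *: v + b%:C *: ('i%C *: v).
    rewrite scalerA -scalerDl; congr (_ *: _).
    by apply: complex_eq; rewrite /=; ring.
  have -> : 'i%C *: ((a +i* b) *: x + y) = a%:C *: ('i%C *: x) - b%:C *: x + 'i%C *: y.
    rewrite scalerDr; congr (_ + _); rewrite !scalerA -scalerBl; congr (_ *: _).
    by apply: complex_eq; rewrite /=; ring.
  rewrite E !gD gN !gZ; apply: complex_eq; rewrite /=; ring.
exists G; split => // [|x]; first by apply: linear_modc_le => // x; exact: le_trans (gs0 x) _.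
apply: (@linear_modc_le (fun x => F x - G x)) => // [a y z|y].
  by rewrite lF lG scalerBr opprD addrACA.
rewrite cReD cReN /=; have := gs0 (- y); have := s0q (- y).
by rewrite gN qN -scaleN1r FZ mulN1r cReN; lra.
Qed.

End SublinearFunctionals.

Section RegularizationMap.
Context {R : realType} (e : ends).
Implicit Types (f g : dual R) (t : Cinfty R).
Local Notation D := (@pow2_algebra R e).

(** A common order [m] lets [regularizeE] express all three regularizations through the same
    kernels. *)
Lemma regularize_linear (a : R[i]) f g : exists2 n, (0 < n)%N & forall p, Vset e n p ->
  regularize (a *: f + g) p = a * regularize f p + regularize g p.
Proof.
have [k [A A0 fA]] := dual_bounded f; have [l [B B0 gB]] := dual_bounded g.
have linE t : (a *: f + g) t = a * f t + g t by [].
pose m := maxn k l; pose C := A + B + modc a * A.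
have C1 : A <= C by rewrite /C -addrA lerDl addr_ge0 ?mulr_ge0 ?modc_ge0// ltW.
have C2 : B <= C by rewrite /C addrAC lerDr addr_ge0 ?mulr_ge0 ?modc_ge0// ltW.
have fm t : modc (f t) <= A * pk m t.
  by apply: le_trans (fA t) _; rewrite ler_pM2l// pk_mono// leq_maxl.
have gm t : modc (g t) <= B * pk m t.
  by apply: le_trans (gB t) _; rewrite ler_pM2l// pk_mono// leq_maxr.
have fC t : modc (f t) <= C * pk m t.
  by apply: le_trans (fm t) _; rewrite ler_wpM2r ?pk_ge0.
have gC t : modc (g t) <= C * pk m t.
  by apply: le_trans (gm t) _; rewrite ler_wpM2r ?pk_ge0.
have sC t : modc ((a *: f + g) t) <= C * pk m t.
  rewrite linE; apply: le_trans (le_normcD _ _) _.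
  rewrite normcM; have := ler_wpM2l (modc_ge0 a) (fm t); have := gm t.
  have := mulr_ge0 (ltW A0) (pk_ge0 m t).
  rewrite /C !mulrDl -mulrA; lra.
have n4 : (4 <= maxn 4 (m + 2))%N by exact: leq_maxl.
have mn : (m + 2 <= maxn 4 (m + 2))%N by exact: leq_maxr.
exists (maxn 4 (m + 2)) => [|p Vp]; first by exact: leq_trans n4.
rewrite (regularizeE sC n4 mn Vp) (regularizeE fC n4 mn Vp) (regularizeE gC n4 mn Vp).
rewrite !linE; ring.
Qed.

Lemma regularize_defined_near f : exists2 n, (0 < n)%N &
  forall p, Vset e n p -> regularize_defined f p.
Proof.
have [k [C C0 fC]] := dual_bounded f.
have n4 : (4 <= maxn 4 (k + 2))%N by exact: leq_maxl.
exists (maxn 4 (k + 2)) => [|p Vp]; first exact: leq_trans n4.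
exact: (regularize_defined_Vset fC n4 (leq_maxr _ _) Vp).
Qed.

Lemma regularize_alg k : exists2 A : R, 0 < A & forall f (C : R), 0 <= C ->
  (forall t, modc (f t) <= C * pk k t) ->
  exists2 h : alg_step D k.+2, Hnorm h <= A * C &
    germ_of e h = germ_of e (regularize f).
Proof.
have [A A0 HA] := @regularize_step R e k; exists A => // f C C0 fC.
have [h hn hE] := HA f C C0 fC; exists h => //; apply/germ_of_eq.
by exists (pow2 k.+2) => //; exact: pow2_gt0.
Qed.

Lemma regularization_ex : exists J : dual R -> alg D,
  forall f, alg_germ (J f) = germ_of e (regularize f).
Proof.
suff H f : exists u : alg D, alg_germ u = germ_of e (regularize f).
  have [J HJ] := @choice _ _ (fun f (u : alg D) => alg_germ u = germ_of e (regularize f)) H.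
  by exists J.
have [k [C C0 fC]] := dual_bounded f; have [A _ HA] := regularize_alg k.
have [h _ hE] := HA f C (ltW C0) fC.
by exists (alg_inj h).
Qed.

Variables (J : dual R -> alg D) (JE : forall f, alg_germ (J f) = germ_of e (regularize f)).

Lemma regularization_linear : linear J.
Proof.
move=> a f g; apply: val_inj; rewrite /= JE.
rewrite -[RHS]/(a *: alg_germ (J f) + alg_germ (J g)) !JE -germ_ofZ -germ_ofD.
by apply/germ_of_eq; exact: regularize_linear.
Qed.

Lemma regularization0 : J 0 = 0.
Proof. by have := regularization_linear (-1) 0 0; rewrite scaler0 addr0 scaleN1r addNr. Qed.

Lemma regularizationD f g : J (f + g) = J f + J g.
Proof. by have := regularization_linear 1 f g; rewrite !scale1r. Qed.

Lemma regularization_inj : injective J.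
Proof.
move=> f g fg; apply/eqP; rewrite -subr_eq0; apply/eqP.
have : alg_germ (J (f - g)) = germ_of e (regularize 0).
  have -> : J (f - g) = J 0; last by rewrite JE.
  rewrite regularization0 addrC -scaleN1r regularization_linear fg scaleN1r addNr //.
have [n n0 H0] := regularize_linear (-1) 0 0.
rewrite JE => /germ_of_eq[m m0 Hm].
have k0 : (0 < maxn n m)%N by rewrite leq_max n0.
apply: (regularize_inj (e := e) k0) => p Vp.
rewrite Hm; last by apply: Vset_decr Vp => //; exact: leq_maxr.
have := H0 p (Vset_decr n0 (leq_maxl _ _) Vp).
by rewrite scaler0 addr0 mulN1r addNr.
Qed.

Section Neighborhood.
Variables (U : set (alg D)) (nU : alg_nbhs0 U).

(** All functionals dominated by a multiple of [pk k] land in one step of the algebra, with norm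
    controlled by the multiple, and there the preimage of [U] is a neighborhood of 0. *)
Lemma regularization_small k : exists2 d : R, 0 < d & forall g, (forall t, modc (g t) <= d * pk k t) ->
  U ((2 ^+ k.+1 : R[i]) *: J g).
Proof.
have [d d0 Hd] := (nbhs_HspaceP _ _).1 (nU.2 k.+2).
have [A A0 HA] := regularize_alg k; pose T : R := 2 ^+ k.+1.
have T0 : 0 < T by rewrite exprn_gt0.
exists (d / (2 * A * T)) => [|g Hg]; first by rewrite divr_gt0// !mulr_gt0.
have [|h hn hE] := HA g _ _ Hg; first by rewrite divr_ge0 ?ltW// !mulr_gt0.
have TE : (2 ^+ k.+1 : R[i]) = T%:C by rewrite rmorphXn /= rmorphMn.
have /Hd : Hnorm ((2 ^+ k.+1 : R[i]) *: h - 0) < d.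
  rewrite subr0 HnormZ TE modc_real gtr0_norm//.
  apply: le_lt_trans (_ : T * (A * (d / (2 * A * T))) < _); first by rewrite ler_pM2l.
  rewrite (_ : T * _ = d / 2); first by lra.
  by field; rewrite !gt_eqF.
rewrite /preimage /= (_ : alg_inj _ = (2 ^+ k.+1 : R[i]) *: J g)//.
apply: val_inj; rewrite /= germ_ofZ hE.
by rewrite -[RHS]/((2 ^+ k.+1 : R[i]) *: alg_germ (J g)) JE.
Qed.

(* By convexity: [g] is a sum of functionals [g_i] with [g_i <= d i * p_i], and
   [J g] is the combination of the [2 ^ i.+1 * J g_i] with weights [2 ^ - i.+1]. *)
Lemma regularization_sum (d : nat -> R) : (forall k, 0 < d k) ->
  (forall k g, (forall t, modc (g t) <= d k * pk k t) -> U ((2 ^+ k.+1 : R[i]) *: J g)) ->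
  forall K m g, (forall t, modc (g t) <= \sum_(0 <= i < K) d (m + i)%N * pk (m + i) t) ->
  U ((2 ^+ m : R[i]) *: J g).
Proof.
move=> d0 Hd; elim=> [|K IH] m g Hg.
  have -> : g = 0.
    apply: dual_ext => t; apply: eq0_normc; apply/eqP.
    by rewrite eq_le modc_ge0 andbT; have := Hg t; rewrite big_nil.
  rewrite regularization0 scaler0; have := nbhs_singleton (nU.2 0%N); rewrite /preimage /=.
  rewrite (_ : alg_inj _ = 0)//; apply: val_inj => /=.
  by have := @germ_ofZ R e 0 0; rewrite !scale0r.
pose q t := \sum_(0 <= i < K) d (m.+1 + i)%N * pk (m.+1 + i) t.
have cs k : cseminorm (fun t => d k * pk k t).
  split=> [s t|a t]; first by rewrite -mulrDr ler_pM2l// pkD.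
  by rewrite pkZ mulrCA.
have cq : cseminorm q.
  split=> [s t|a t]; last by rewrite mulr_sumr; apply: eq_bigr => i _; exact: (cs _).2.
  by rewrite -big_split; apply: ler_sum => i _; exact: (cs _).1.
have Hpq t : modc (g t) <= d m * pk m t + q t.
  apply: le_trans (Hg t) _; rewrite big_nat_recl// addn0 lerD2l /q.
  by rewrite le_eqVlt; apply/orP; left; apply/eqP; apply: eq_bigr => i _; rewrite addnS.
have [G [lG Gp Gq]] := linear_split (@dual_linear _ g) (cs m) cq Hpq.
pose h := DualOf (dual_of_linear lG Gp).
have Uh : U ((2 ^+ m.+1 : R[i]) *: J h) by exact: Hd.
have Ugh : U ((2 ^+ m.+1 : R[i]) *: J (g - h)) by apply: IH => t; exact: Gq.
(* [2 ^+ m *: J g] is the half-sum of the two elements just placed in [U]. *)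
have := nU.1 2^-1 2^-1 _ _ _ Uh Ugh.
rewrite !scalerA exprS mulKf ?pnatr_eq0// -scalerDr -regularizationD addrCA subrr addr0; apply.
rewrite normfV normr_nat -mulr2n -[X in X *+ 2]mul1r -mulrnAl.
by rewrite divff// pnatr_eq0.
Qed.

End Neighborhood.

Lemma regularization_continuous : continuous J.
Proof.
move=> f0 W; rewrite nbhsE => -[V [oV VJ] VW].
have [U nU UV] := (oV : alg_open V) _ VJ.
have ex k : exists d : R, 0 < d /\ forall g, (forall t, modc (g t) <= d * pk k t) ->
    U ((2 ^+ k.+1 : R[i]) *: J g).
  by have [d d0 Hd] := regularization_small nU k; exists d.
have [d Hd] := @choice _ _ (fun k (d : R) => 0 < d /\
  forall g, (forall t, modc (g t) <= d * pk k t) -> U ((2 ^+ k.+1 : R[i]) *: J g)) ex.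
have := @dual_nbhs R [set t | forall k, pk k t <= (d k)^-1] f0.
have /[swap] /[apply] : forall k, exists M : R, forall t,
    [set t | forall k, pk k t <= (d k)^-1] t -> pk k t <= M.
  by move=> k; exists (d k)^-1 => t; exact.
apply: filterS => f Hf; apply: VW.
rewrite -[f](subrK f0) addrC regularizationD; apply: UV.
have [|K HK] := @dual_finite_bound R (f - f0) d (fun k => (Hd k).1).
  by move=> t; exact: Hf.
have := regularization_sum nU (fun k => (Hd k).1) (fun k => (Hd k).2) (K := K) (m := 0) (g := f - f0).
by rewrite expr0 scale1r; apply.
Qed.

End RegularizationMap.

Theorem proposition3 (R : realType) (e : ends) :
  exists (D : algebra_data R e) (j : dual R -> alg D),
    [/\ forall f : dual R,
          (exists2 n, (0 < n)%N &
             forall p, Vset e n p -> regularize_defined f p) /\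
          alg_germ (j f) = germ_of e (regularize f),
        injective j
      & continuous j].
Proof.
have [J JE] := @regularization_ex R e.
exists (@pow2_algebra R e), J; split; [|exact: regularization_inj|exact: regularization_continuous].
by move=> f; split; [exact: regularize_defined_near|exact: JE].
Qed.
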